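(* Let $\rho_0\in L^1(\mathbb R)\cap L^\infty(\mathbb R)$ be nonnegative with $\int_{\mathbb R}\rho_0=1$ and $\mathcal F(\rho_0)<\infty$, let $L>0$, and let $(\rho_0)_L$ be the $L$-periodic extension to $\mathbb T_L$ of $\rho_0\chi_{[-L/2,L/2]}$. Then for all $T>0$ the deterministic particle approximations $\{\rho^N_L\}$ starting from $(\rho_0)_L$, defined on $[0,T]\times\mathbb T_L$ (for $N$ sufficiently large), converge, up to subsequences as $N\to+\infty$, to a function $\rho_L$ in $L^1([0,T]\times\mathbb T_L)$.
   Context: Standing assumptions: $K:\mathbb R\to\mathbb R$ satisfies $K(z)=K(|z|)$, $K\in C^0(\mathbb R)\cap C^2(\mathbb R\setminus\{0\})$, $K,K'\in L^\infty(\mathbb R)$, $K''\in L^\infty(\mathbb R\setminus\{0\})$, $\|K'\|_{L^1(\mathbb R)}<\infty$. $W:[0,\infty)\to[0,\infty)$ and $\phi(\rho):=\rho W'(\rho)-W(\rho)$ is $C^1$ with $\phi(0)=0$, $\phi$ strictly increasing, $\phi'(\rho)\rho\le c_0\phi(\rho)$, $\phi(\rho)\le\max\{\rho,c_0W(\rho)\}$ for some $c_0>0$, and there are $c_1,c_2>0$, $\hat\rho<1<\bar\rho$ with $\phi(\rho)\le c_1\rho$ for $\rho\le\hat\rho$ and $\phi(\rho)\ge c_2\rho$ for $\rho\ge\bar\rho$. $\mathcal F(\rho)=\frac12\int_{\mathbb R}\int_{\mathbb R}K(x-y)\rho(x)\rho(y)\,dx\,dy+\int_{\mathbb R}W(\rho)\,dx$.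 $\mathbb T_L=\mathbb R/L\mathbb Z\cong[-L/2,L/2)$. Deterministic particle approximation starting from $\rho_{0,L}\ge0$ with $c_L=\int_{\mathbb T_L}\rho_{0,L}\le1$: set $x_0=-L/2$, $x_k=\sup\{x:\int_{x_{k-1}}^x\rho_{0,L}<c_L/N\}$, $k=1,\dots,N$; particles $x_k(t)$ (indices mod $N$) solve $\dot x_k=-\frac{c_L}{N}\sum_{j\ne k}K'(x_k-x_j)-\frac{N}{c_L}[\phi(\rho_k)-\phi(\rho_{k-1})]$, $x_k(0)=x_k$, with $\rho_k(t)=\frac{c_L}{N(x_{k+1}(t)-x_k(t))}$, and $\rho^N_L(t,x)=\sum_{k=0}^{N-1}\rho_k(t)\chi_{[x_k(t),x_{k+1}(t))}(x)$. *)

(* Defs.v *)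
From HB Require Import structures.
From mathcomp Require Import all_boot all_order all_algebra.
From mathcomp Require Import all_classical all_reals all_analysis.
Set Implicit Arguments. Unset Strict Implicit. Unset Printing Implicit Defensive.
Import Order.TTheory GRing.Theory Num.Theory.
Import numFieldNormedType.Exports.
Local Open Scope classical_set_scope.
Local Open Scope ring_scope.

Notation leb := (@lebesgue_measure _).

Definition Fenergy (R : realType) (K W rho : R -> R) : \bar R :=
  ((2%:R^-1)%:E * \int[@lebesgue_measure R]_x
       \int[@lebesgue_measure R]_y (K (x - y) * rho x * rho y)%:E
   + \int[@lebesgue_measure R]_x (W (rho x))%:E)%E.

(* L-periodic extension to T_L ~ [-L/2, L/2) of rho0 * chi_[-L/2, L/2] *)
Definition per_ext (R : realType) (rho0 : R -> R) (L : R) (x : R) : R :=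
  rho0 (x - L * (Num.floor ((x + L / 2) / L))%:~R).

Definition massL (R : realType) (rho0 : R -> R) (L : R) : R :=
  fine (\int[@lebesgue_measure R]_(x in `[- (L / 2), L / 2]) (rho0 x)%:E).

Fixpoint x_init (R : realType) (rho0 : R -> R) (L : R) (N : nat) (k : nat) : R :=
  match k with
  | 0 => - (L / 2)
  | k'.+1 => sup [set x : R |
       (\int[@lebesgue_measure R]_(y in `[x_init rho0 L N k', x]) (per_ext rho0 L y)%:E
          < (massL rho0 L / N%:R)%:E)%E]
  end.

(* next particle, indices mod N: x_N = x_0 + L on the real line (same point of T_L) *)
Definition x_next (R : realType) (L : R) (N : nat) (x : nat -> R -> R) (k : nat) (t : R) : R :=
  if k.+1 == N then x 0%N t + L else x k.+1 t.

Definition dens (R : realType) (cL L : R) (N : nat) (x : nat -> R -> R) (k : nat) (t : R) : R :=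
  cL / (N%:R * (x_next L N x k t - x k t)).

Definition dens_prev (R : realType) (cL L : R) (N : nat) (x : nat -> R -> R) (k : nat) (t : R) : R :=
  if k is k'.+1 then dens cL L N x k' t else dens cL L N x N.-1 t.

Definition velocity (R : realType) (dK phi : R -> R) (cL L : R) (N : nat)
    (x : nat -> R -> R) (k : nat) (t : R) : R :=
  - (cL / N%:R) * (\sum_(j < N | (j : nat) != k) dK (x k t - x j t))
  - (N%:R / cL) * (phi (dens cL L N x k t) - phi (dens_prev cL L N x k t)).

Definition particle_sol (R : realType) (dK phi rho0 : R -> R) (L T : R) (N : nat)
    (x : nat -> R -> R) : Prop :=
  forall k, (k < N)%N ->
    [/\ x k 0 = x_init rho0 L N k,
        {within `[0, T], continuous (x k)},
        (forall t, 0 < t < T ->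
           is_derive t 1 (x k) (velocity dK phi (massL rho0 L) L N x k t)) &
        (forall t, 0 <= t <= T -> x k t <= x_next L N x k t)].

Definition torus_indic (R : realType) (L a b : R) (y : R) : R :=
  \1_[set z : R | exists m : int, a <= z + m%:~R * L < b] y.

Definition rhoN (R : realType) (rho0 : R -> R) (L : R) (N : nat) (x : nat -> R -> R)
    (ty : R * R) : R :=
  \sum_(k < N) dens (massL rho0 L) L N x k ty.1
               * torus_indic L (x k ty.1) (x_next L N x k ty.1) ty.2.

(* Main.v *)
Require Import Defs.
From HB Require Import structures.
From mathcomp Require Import all_boot all_order all_algebra.
From mathcomp Require Import all_classical all_reals all_analysis.
From mathcomp Require Import measurable_realfun ring lra zify.
Import Order.TTheory GRing.Theory Num.Theory.
Import numFieldNormedType.Exports.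
Local Open Scope classical_set_scope.
Local Open Scope ring_scope.

(* The particle system is the gradient flow of the discrete energy
     E_N = c^2/(2 N^2) \sum_(i <> j) K(x_i - x_j) + (c/N) \sum_k w(rho_k),   w(r) = W(r)/r,
   since w' = phi/r^2.  The linear growth of phi makes w unbounded, so the bound on E_N excludes
   collisions; this gives global existence, and along the flow E_N dissipates
   D = (c/N) \sum_k |x_k'|^2, whose time integral is bounded uniformly in N.  By the equations of
   motion the total variation of phi(rho_N(t)) is at most D(t) + C.

   Compactness: the mollified densities S_N(t, y) = (c/N) \sum_k psi(x_k(t) - y) are bounded and
   equicontinuous, so they are compared through finitely many samples.  At a time with D(t) <= A the
   densities are bounded by some R(A), and S_N is uniformly close to rho_N at every y such that the
   jumps of phi(rho_N) within distance h of y sum to less than delta.  The remaining points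
   contribute, after integration in time and space, O(h/delta) for the large jumps and O(1/A) for
   the times of large dissipation.  Hence the sequence rho_N has an L^1-Cauchy subsequence. *)

(** As [phi] may be degenerate, the variation of phi(rho_N) does not bound the variation of rho_N:
    it only makes densities close through a modulus of the inverse of phi, valid on a bounded range.
    The variation bound D(t) + C is merely integrable in time, so it bounds the densities only off a
    set of times. This is why the times are split at D(t) = A and why delta depends on R(A); h and
    the mollifier are chosen after delta, and nothing depends on N.

    The velocity field is singular at collisions and K' may jump at 0. Existence is therefore
    obtained for a field truncated at small gaps, and the energy barrier shows that the truncation
    is never active. The same barrier applies to an arbitrary solution, which is only assumed weakly
    ordered, so the estimates hold for any family of solutions and uniqueness is not an issue.

    The mass c of rho_0 on [-L/2, L/2] may be 0; this case is treated apart. *)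

Set Implicit Arguments. Unset Strict Implicit. Unset Printing Implicit Defensive.

(** * Functions of a real variable *)

Section real_functions.
Context {R : realType}.
Implicit Types (f F : R -> R) (a b t : R).

Lemma maxr_continuous (T : topologicalType) (f g : T -> R) :
  continuous f -> continuous g -> continuous (fun x => Num.max (f x) (g x)).
Proof.
move=> cf cg x; rewrite /continuous_at maxr_absE.
rewrite (_ : (fun x => _) = fun x => (f x + g x + `|f x - g x|) / 2); last first.
  by apply/funext => y; rewrite maxr_absE.
apply: cvgM; last exact: cvg_cst.
apply: cvgD; first exact: cvgD (cf x) (cg x).
by apply: cvg_norm; apply: cvgB; [exact: cf|exact: cg].
Qed.

Lemma minr_continuous (T : topologicalType) (f g : T -> R) :
  continuous f -> continuous g -> continuous (fun x => Num.min (f x) (g x)).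
Proof.
move=> cf cg x; rewrite /continuous_at minr_absE.
rewrite (_ : (fun x => _) = fun x => (f x + g x - `|f x - g x|) / 2); last first.
  by apply/funext => y; rewrite minr_absE.
apply: cvgM; last exact: cvg_cst.
apply: cvgB; first exact: cvgD (cf x) (cg x).
by apply: cvg_norm; apply: cvgB; [exact: cf|exact: cg].
Qed.

Definition clamp a b t : R := Num.min (Num.max t a) b.

Lemma clamp_id a b t : a <= t <= b -> clamp a b t = t.
Proof. by move=> /andP[at_ tb]; rewrite /clamp (max_idPl at_) (min_idPl tb). Qed.

Lemma clamp_itv a b t : a <= b -> a <= clamp a b t <= b.
Proof. by move=> ab; rewrite /clamp le_min ge_min ab lexx le_max lexx !orbT. Qed.

Lemma clamp_continuous a b : continuous (clamp a b).
Proof.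
apply: minr_continuous; last by move=> ?; exact: cvg_cst.
by apply: maxr_continuous => ?; [exact: cvg_id | exact: cvg_cst].
Qed.

(** Trajectories are continuous on [0, T] only; composed with [clamp 0 T] they become continuous on
    the whole line, which spares later arguments the subspace topology. *)
Lemma comp_clamp_continuous a b f : a <= b ->
  {within `[a, b], continuous f} -> continuous (f \o clamp a b).
Proof.
move=> ab /subspace_continuousP cf t.
have ct : `[a, b]%classic (clamp a b t) by rewrite /= in_itv /= clamp_itv.
move: (cf _ ct) => fct A /= /fct; rewrite /= nbhs_filterE.
rewrite /fmap /= withinE /= => -[V /= Vn VE].
have : \forall s \near t, V (clamp a b s) by exact: (@clamp_continuous a b t V Vn).
apply: filterS => s /= Vs.
have : (f @^-1` A `&` `[a, b]%classic) (clamp a b s).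
  by rewrite VE; split => //=; rewrite in_itv/= clamp_itv.
by case.
Qed.

Lemma is_derive_near f F a df : (\forall x \near a, f x = F x) ->
  is_derive a 1 f df -> is_derive a 1 F df.
Proof. exact: near_eq_is_derive. Qed.

Lemma near_clamp_id a b t : a < t < b -> \forall s \near t, clamp a b s = s.
Proof.
move=> tab; have : \forall s \near t, s \in `]a, b[ by exact: near_in_itvoo.
by apply: filterS => s; rewrite in_itv/= => /andP[/ltW as_ /ltW sb];
  rewrite clamp_id// as_ sb.
Qed.

Lemma is_derive_continuous f a df : is_derive a 1 f df -> {for a, continuous f}.
Proof. by case=> + _ => /derivable1_diffP/differentiable_continuous. Qed.

Lemma nonincreasing_of_derive f (df : R -> R) a b : a <= b ->
  {within `[a, b], continuous f} ->
  (forall t, a < t < b -> is_derive t 1 f (df t)) ->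
  (forall t, a < t < b -> df t <= 0) -> f b <= f a.
Proof.
rewrite le_eqVlt => /predU1P[-> //|ab] cf fd df0.
have fd' x : x \in `]a, b[ -> is_derive x 1 f (df x) by rewrite in_itv => /fd.
have [c] := MVT ab fd' cf.
rewrite in_itv /= => cab E; rewrite -subr_le0 E.
by rewrite mulr_le0_ge0 ?df0// subr_ge0 ltW.
Qed.

Lemma lipschitz_of_derive f (df : R -> R) a b (M : R) : a <= b ->
  {within `[a, b], continuous f} ->
  (forall t, a < t < b -> is_derive t 1 f (df t)) ->
  (forall t, a < t < b -> `|df t| <= M) -> `|f b - f a| <= M * (b - a).
Proof.
rewrite le_eqVlt => /predU1P[->|ab] cf fd df0.
  by rewrite !subrr normr0 mulr0.
have fd' x : x \in `]a, b[ -> is_derive x 1 f (df x) by rewrite in_itv => /fd.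
have [c] := MVT ab fd' cf.
rewrite in_itv /= => cab ->.
by rewrite normrM [X in _ * X]gtr0_norm ?subr_gt0// ler_wpM2r ?df0 ?subr_ge0 ?(ltW ab).
Qed.

Lemma eq_of_derive f F (df : R -> R) a b : a <= b ->
  {within `[a, b], continuous f} -> {within `[a, b], continuous F} ->
  (forall t, a < t < b -> is_derive t 1 f (df t)) ->
  (forall t, a < t < b -> is_derive t 1 F (df t)) ->
  f b - f a = F b - F a.
Proof.
move=> ab cf cF fd gd.
have h : {within `[a, b], continuous (f - F)} by exact: within_continuousB.
have /= : `|(f - F) b - (f - F) a| <= 0 * (b - a).
  apply: (@lipschitz_of_derive _ (fun=> 0)) => //.
  - by move=> t tab; have := is_deriveB (fd _ tab) (gd _ tab); rewrite subrr.
  - by move=> t _; rewrite normr0.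
by rewrite mul0r normr_le0 subr_eq0 => /eqP; rewrite !fctE; lra.
Qed.

(** An integral with a fixed lower endpoint is a primitive only to the right of that endpoint. The
    primitive on the whole line is glued from the functions [G B], based at -B and vanishing at 0,
    which agree on their common half-line. *)
Lemma continuous_primitive f : continuous f ->
  exists F, F 0 = 0 /\ forall t, is_derive t 1 F (f t).
Proof.
move=> cf.
pose G B x := (\int[@lebesgue_measure R]_(s in `[- B, x]) f s)%R - (\int[@lebesgue_measure R]_(s in `[- B, 0%R]) f s)%R.
have G0 B : G B 0 = 0 by exact: subrr.
have dG (B x : R) : - B < x -> is_derive x 1 (G B) (f x).
  move=> Bx.
  have fi : (@lebesgue_measure R).-integrable `[- B, x + 1] (EFin \o f).
    by apply: continuous_compact_integrable;
      [exact: segment_compact | exact: continuous_subspaceT].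
  have x1 : x < x + 1 by rewrite ltrDl.
  have [d1 d2] := continuous_FTC1_closed x1 fi Bx (cf x).
  have D : is_derive x 1 (fun x => \int[@lebesgue_measure R]_(s in `[- B, x]) f s)%R (f x).
    by apply: DeriveDef; [exact: d1 | rewrite -derive1E; exact: d2].
  by have := is_deriveB D (is_derive_cst (\int[@lebesgue_measure R]_(s in `[- B, 0%R]) f s)%R x 1); rewrite subr0.
have GB (B B' x : R) : 0 < B -> B <= B' -> - B < x -> G B x = G B' x.
  move=> B0 BB' Bx.
  have aux (u v : R) : - B < u -> u <= v -> G B v - G B u = G B' v - G B' u.
    move=> Bu uv; apply: (@eq_of_derive _ _ f) => //.
    - apply: derivable_within_continuous => z; rewrite in_itv/= => /andP[uz _].
      by have [] := dG B z (lt_le_trans Bu uz).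
    - apply: derivable_within_continuous => z; rewrite in_itv/= => /andP[uz _].
      have B'z : - B' < z by rewrite (le_lt_trans _ (lt_le_trans Bu uz))// lerN2.
      by have [] := dG B' z B'z.
    - by move=> t /andP[ut _]; apply: dG; exact: lt_trans ut.
    - move=> t /andP[ut _]; apply: dG; apply: le_lt_trans (lt_trans Bu ut).
      by rewrite lerN2.
  have [x0|x0] := leP 0 x.
    by have := aux 0 x; rewrite !G0 !subr0 oppr_lt0 => /(_ B0 x0).
  by have := aux x 0; rewrite !G0 !sub0r (ltW x0) => /(_ Bx erefl)/oppr_inj.
exists (fun x => G (`|x| + 1) x); split; first by rewrite /G normr0 add0r subrr.
(* The parameter |x| + 1 varies with x; near t it is replaced by the fixed |t| + 2 without changing
   the value. *)
move=> t; apply: (@is_derive_near (G (`|t| + 2))); last first.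
  by apply: dG; rewrite ltrNl (le_lt_trans (ler_norm _))// normrN ltrDl.
near=> x; have xt : `|x - t| < 1.
  by near: x; exists 1 => //= z /=; rewrite distrC.
have xt2 : `|x| < `|t| + 1.
  by rewrite -ltrBlDl (le_lt_trans _ xt)// lerB_dist.
rewrite -(@GB (`|x| + 1))//.
- by lra.
- by rewrite ltrNl (le_lt_trans (ler_norm _))// normrN ltrDl.
Unshelve. all: by end_near. Qed.
End real_functions.

(** * Sequences and ordinary differential equations *)

Section real_sequences.
Context {R : realType}.

Lemma abs_le_of_derive (f df g dg : R -> R) a b : a <= b ->
  {within `[a, b], continuous f} -> {within `[a, b], continuous g} ->
  (forall t, a < t < b -> is_derive t 1 f (df t)) ->
  (forall t, a < t < b -> is_derive t 1 g (dg t)) ->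
  (forall t, a < t < b -> `|df t| <= dg t) -> `|f b - f a| <= g b - g a.
Proof.
move=> ab cf cg fd gd dfg; rewrite ler_norml opprB; apply/andP; split.
- have H : (- f - g) b <= (- f - g) a.
    apply: (@nonincreasing_of_derive _ (- f - g) (fun t => - df t - dg t)) => //.
    + by apply: within_continuousB => // x; apply: continuousN; exact: cf.
    + by move=> t tab; apply: is_deriveB; [exact/is_deriveN/fd | exact: gd].
    + by move=> t tab; have := dfg _ tab; rewrite ler_norml => /andP[h _]; rewrite subr_le0 lerNl.
  by move: H; rewrite !fctE; lra.
- have H : (f - g) b <= (f - g) a.
    apply: (@nonincreasing_of_derive _ (f - g) (fun t => df t - dg t)) => //.
    + exact: within_continuousB.
    + by move=> t tab; apply: is_deriveB; [exact: fd | exact: gd].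
    + by move=> t tab; have := dfg _ tab; rewrite ler_norml => /andP[_ h]; rewrite subr_le0.
  by move: H; rewrite !fctE; lra.
Qed.

(** The intervals of radius 2B/2^n about u_n are nested, so the supremum of their left ends lies in
    all of them: this gives the limit together with its rate. *)
Lemma geometric_limit (u : nat -> R) (B : R) :
  (forall n, `|u n.+1 - u n| <= B / 2 ^+ n) ->
  exists l, forall n, `|u n - l| <= 2 * B / 2 ^+ n.
Proof.
move=> hu.
have half n : 2 * B / 2 ^+ n.+1 = B / 2 ^+ n.
  by rewrite exprS invfM mulrACA mulfV ?mul1r.
have dbl n : 2 * B / 2 ^+ n = B / 2 ^+ n + B / 2 ^+ n.
  by rewrite -mulrA mulr_natl mulr2n.
pose a n := u n - 2 * B / 2 ^+ n; pose b n := u n + 2 * B / 2 ^+ n.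
have aS n : a n <= a n.+1.
  by have := hu n; rewrite /a half dbl ler_norml => /andP[h _]; lra.
have bS n : b n.+1 <= b n.
  by have := hu n; rewrite /b half dbl ler_norml => /andP[_ h]; lra.
have B0 n : 0 <= B / 2 ^+ n by exact: le_trans (normr_ge0 _) (hu n).
have ab n m : a n <= b m.
  have [nm|/ltnW mn] := leqP n m.
    apply: (@le_trans _ _ (a m)); last by rewrite /a /b dbl; have := B0 m; lra.
    by apply: (@homo_leq _ a (fun x y => x <= y)) nm => // ? ? ?; exact: le_trans.
  apply: (@le_trans _ _ (b n)); first by rewrite /a /b dbl; have := B0 n; lra.
  by apply: (@homo_leq _ b (fun x y => y <= x)) mn => // ? ? ? h1 h2; exact: le_trans h2 h1.
have supa : has_sup (range a).
  by split; [exists (a 0), 0 | exists (b 0) => _ [n _ <-]].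
exists (sup (range a)) => n.
have h1 : a n <= sup (range a) by apply: ub_le_sup; [exact: supa.2 | exists n].
have h2 : sup (range a) <= b n by apply: ge_sup; [exact: supa.1 | move=> _ [m _ <-]].
by rewrite ler_norml; move: h1 h2; rewrite /a /b => ? ?; apply/andP; split; lra.
Qed.

Lemma le0_of_geometric (x C : R) : (forall n, x <= C / 2 ^+ n) -> x <= 0.
Proof.
move=> h; rewrite leNgt; apply/negP => x0.
have [n hn] : exists n : nat, C / x < n%:R.
  exists (Num.bound `|C / x|); apply: le_lt_trans (ler_norm _) _.
  exact: archi_boundP.
have := h n; rewrite leNgt => /negP; apply.
rewrite ltr_pdivrMr ?exprn_gt0// -ltr_pdivrMl// mulrC (lt_trans hn)//.
by rewrite -natrX ltr_nat ltn_expl.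
Qed.

(** Total in [f], so that the Picard iterates can be defined by recursion before they are known to
    be continuous; the value at a discontinuous [f] is arbitrary. *)
Definition primitive_of (f : R -> R) : R -> R :=
  if pselect (continuous f) is left cf then projT1 (cid (continuous_primitive cf)) else f.

Lemma primitive_ofP f : continuous f ->
  primitive_of f 0 = 0 /\ forall t : R, is_derive t 1 (primitive_of f) (f t).
Proof. by move=> cf; rewrite /primitive_of; case: pselect => // ?; case: cid. Qed.

Lemma derive_continuous_within (f df : R -> R) (A : set R) :
  (forall t : R, is_derive t 1 f (df t)) -> {within A, continuous f}.
Proof.
by move=> h; apply: continuous_subspaceT => x; exact: is_derive_continuous (h x).
Qed.

End real_sequences.

(** * Picard iteration for globally Lipschitz fields *)

Section picard.
Context {R : realType}.
Variables (N : nat) (F : (nat -> R) -> nat -> R) (Lam T : R) (x0 : nat -> R).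
Hypotheses (Lam0 : 0 <= Lam) (T0 : 0 <= T).
Hypothesis FL : forall X Y k, `|F X k - F Y k| <= Lam * \sum_(j < N) `|X j - Y j|.

Lemma lipschitz_field_continuous (v : nat -> R -> R) k :
  (forall j, (j < N)%N -> continuous (v j)) -> continuous (fun s => F (v^~ s) k).
Proof.
move=> cv t; apply/cvgrPdist_le => e e0.
have hc : continuous (fun s => Lam * \sum_(j < N) `|v j t - v j s|).
  move=> s; apply: cvgM; first exact: cvg_cst.
  apply: cvg_big => [|i _]; first by move=> p; exact: add_continuous.
  by apply: cvg_norm; apply: cvgB; [exact: cvg_cst | exact: cv].
have h0 : Lam * \sum_(j < N) `|v j t - v j t| = 0.
  by rewrite big1 ?mulr0// => j _; rewrite subrr normr0.
have := hc t; rewrite /continuous_at h0 => /cvgrPdist_le/(_ e e0).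
apply: filterS => s /=; rewrite sub0r normrN => hs.
exact: le_trans (FL _ _ _) (le_trans (ler_norm _) hs).
Qed.

Fixpoint picard_iter (n : nat) : nat -> R -> R :=
  if n is n'.+1 then
    fun k t => x0 k + primitive_of (fun s => F (fun j => picard_iter n' j (clamp 0 T s)) k) t
  else fun k _ => x0 k.

Let fld (v : nat -> R -> R) k : R -> R := fun s => F (fun j => v j (clamp 0 T s)) k.

Let fld_cont v k : (forall j, continuous (v j)) -> continuous (fld v k).
Proof.
move=> cv; apply: (@lipschitz_field_continuous (fun j => v j \o clamp 0 T)) => j _ t.
by apply: continuous_comp; [exact: clamp_continuous | exact: cv].
Qed.

Let step_derive (v : nat -> R -> R) k : (forall j, continuous (v j)) -> forall t : R,
  is_derive t 1 (fun t => x0 k + primitive_of (fld v k) t) (fld v k t).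
Proof.
move=> cv t; have [_ /(_ t) h] := primitive_ofP (@fld_cont v k cv).
by have := is_deriveD (is_derive_cst (x0 k) t 1) h; rewrite add0r.
Qed.

Let iter_cont n k : continuous (picard_iter n k).
Proof.
elim: n k => [|n IH] k; first by move=> ?; exact: cvg_cst.
move=> t; exact: is_derive_continuous (step_derive k IH t).
Qed.

Let step0 v k : (forall j, continuous (v j)) -> x0 k + primitive_of (fld v k) 0 = x0 k.
Proof. by move=> cv; have [-> _] := primitive_ofP (@fld_cont v k cv); rewrite addr0. Qed.

Let A : R := 2 * N%:R * Lam.
Let B : R := (\sum_(k < N) `|F x0 k|) * T.

(** With the weight exp(A t), A = 2 N Lam, a Picard step contracts by 1/2 on the whole of [0, T],
    whatever the size of T. *)
Let iter_bound n k t : (k < N)%N -> 0 <= t <= T ->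
  `|picard_iter n.+1 k t - picard_iter n k t| <= B * expR (A * t) / 2 ^+ n.
Proof.
have A0 : 0 <= A by rewrite !mulr_ge0.
elim: n k t => [|n IH] k t kN /andP[t0 tT].
  rewrite expr0 divr1.
  have hE (s : R) : is_derive s 1 (picard_iter 1 k) (F x0 k).
    by apply: (step_derive (v := fun k _ => x0 k)) => j ?; exact: cvg_cst.
  have : `|picard_iter 1 k t - picard_iter 1 k 0| <= `|F x0 k| * (t - 0).
    apply: (@lipschitz_of_derive _ _ (fun=> F x0 k)) => //.
    exact: derive_continuous_within hE.
  have -> : picard_iter 1 k 0 = x0 k by apply: (step0 (v := fun k _ => x0 k)) => j ?; exact: cvg_cst.
  move=> /le_trans; apply; rewrite subr0.
  have h1 : `|F x0 k| * t <= B.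
    rewrite ler_pM// (bigD1 (Ordinal kN))//= lerDl sumr_ge0//.
  by apply: (le_trans h1); rewrite ler_peMr ?(le_trans _ h1) ?mulr_ge0// (le_trans _ (expR_ge1Dx _))// lerDl mulr_ge0.
have hE m (s : R) : is_derive s 1 (picard_iter m.+1 k) (fld (picard_iter m) k s).
  exact: step_derive.
have z0 m : picard_iter m.+1 k 0 = x0 k by apply: step0; exact: iter_cont.
(* A primitive of the bound on the derivative of the difference: g' = Lam N B exp(A s) / 2^n by the
   choice of A. *)
pose g s := B / 2 ^+ n.+1 * expR (A * s).
have gE (s : R) : is_derive s 1 g (B / 2 ^+ n.+1 * (expR (A * s) * A)).
  have h : is_derive s 1 (fun s => A * s) A.
    by have := is_deriveZ A (is_derive_id s 1); rewrite /GRing.scale /= mulr1.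
  have h2 := is_derive1_comp (is_derive_expR (A * s)) h.
  exact: (is_deriveZ (B / 2 ^+ n.+1) h2).
have : `|(picard_iter n.+2 k - picard_iter n.+1 k) t -
         (picard_iter n.+2 k - picard_iter n.+1 k) 0| <= g t - g 0.
  apply: (@abs_le_of_derive _ _
    (fun s => fld (picard_iter n.+1) k s - fld (picard_iter n) k s) _
    (fun s => B / 2 ^+ n.+1 * (expR (A * s) * A)) 0 t t0).
  - by apply: within_continuousB; exact: derive_continuous_within (hE _).
  - exact: derive_continuous_within gE.
  - move=> s /andP[s0 st]; apply: le_trans (FL _ _ _) _.
    have sT : 0 <= s <= T by rewrite (ltW s0) (le_trans (ltW st)).
    rewrite clamp_id//.
    apply: (@le_trans _ _ (Lam * \sum_(j < N) (B * expR (A * s) / 2 ^+ n))).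
      by rewrite ler_wpM2l// ler_sum// => j _; exact: IH.
    rewrite sumr_const card_ord -mulr_natl /A exprS invfM le_eqVlt; apply/orP; left; apply/eqP.
    by field; rewrite expf_neq0.
rewrite !fctE !z0 subrr subr0 => /le_trans; apply.
rewrite /g mulr0 expR0 mulr1 mulrAC lerBlDr lerDl divr_ge0 ?exprn_ge0// mulr_ge0//.
by rewrite sumr_ge0.
Qed.

Theorem lipschitz_ode_exists : exists u : nat -> R -> R, forall k, (k < N)%N ->
  [/\ u k 0 = x0 k, continuous (u k) &
      forall t, 0 < t < T -> is_derive t 1 (u k) (F (u^~ t) k)].
Proof.
have A0 : 0 <= A by rewrite !mulr_ge0.
have B0 : 0 <= B by rewrite mulr_ge0// sumr_ge0.
pose C := B * expR (A * T).
have C0 : 0 <= C by rewrite mulr_ge0// expR_ge0.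
have bound n k t : (k < N)%N ->
    `|picard_iter n.+1 k (clamp 0 T t) - picard_iter n k (clamp 0 T t)| <= C / 2 ^+ n.
  move=> kN; have ct := clamp_itv t T0.
  apply: le_trans (iter_bound n kN ct) _.
  rewrite ler_wpM2r ?invr_ge0 ?exprn_ge0// ler_wpM2l// ler_expR ler_wpM2l//.
  by case/andP: ct.
have lim k t : exists l, (k < N)%N -> forall n, `|picard_iter n k (clamp 0 T t) - l| <= 2 * C / 2 ^+ n.
  have [kN|] := boolP (k < N)%N; last by exists 0.
  by have [l hl] := geometric_limit (fun n => bound n k t kN); exists l.
have /choice[v hv] : forall k, exists vk : R -> R, forall t, (k < N)%N -> forall n, `|picard_iter n k (clamp 0 T t) - vk t| <= 2 * C / 2 ^+ n.
  by move=> k; have [vk hvk] := choice (lim k); exists vk => t kN; exact: hvk.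
have small (e : R) : 0 < e -> exists n : nat, 2 * C / 2 ^+ n < e.
  move=> e0; apply: contrapT => hn.
  have : e <= 0.
    by apply: (@le0_of_geometric _ e (2 * C)) => n; rewrite leNgt; apply/negP => ?; apply: hn; exists n.
  by rewrite leNgt e0.
have cv k : (k < N)%N -> continuous (v k).
  move=> kN t; apply/cvgrPdist_lt => e e0.
  have e3 : 0 < e / 3 by rewrite divr_gt0.
  have [n hn] := small _ e3.
  have /cvgrPdist_lt/(_ _ e3) :
      (picard_iter n k \o clamp 0 T) @ t --> (picard_iter n k \o clamp 0 T) t.
    by apply: continuous_comp; [exact: clamp_continuous | exact: iter_cont].
  apply: filterS => s /= hs.
  have h1 := hv k t kN n; have h2 := hv k s kN n.
  apply: (@le_lt_trans _ _ (2 * C / 2 ^+ n + (e / 3 + 2 * C / 2 ^+ n))); last by lra.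
  apply: le_trans (ler_distD (picard_iter n k (clamp 0 T t)) _ _) _.
  apply: lerD; first by rewrite distrC.
  apply: le_trans (ler_distD (picard_iter n k (clamp 0 T s)) _ _) _.
  by apply: lerD => //; exact: ltW.
pose fv k s := F (v^~ s) k.
have fvc k : continuous (fv k) by exact: lipschitz_field_continuous.
(* The limit [v] is only known to be continuous. The candidate [u] integrates the field along [v],
   hence is differentiable, and equals [v] on [0, T] because both are close to the iterates. *)
pose u k t := x0 k + primitive_of (fv k) t.
have uE k (t : R) : is_derive t 1 (u k) (fv k t).
  have [_ /(_ t) h] := primitive_ofP (fvc k).
  by have := is_deriveD (is_derive_cst (x0 k) t 1) h; rewrite add0r.
have u0 k : u k 0 = x0 k by rewrite /u; have [-> _] := primitive_ofP (fvc k); rewrite addr0.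
have uv k t : (k < N)%N -> 0 <= t <= T -> u k t = v k t.
  move=> kN tT; have /andP[t0 tT'] := tT.
  apply/eqP; rewrite -subr_eq0 -normr_le0.
  apply: (@le0_of_geometric _ _ (Lam * N%:R * (2 * C) * T + C)) => n.
  have h1 := hv k t kN n.+1; rewrite clamp_id// in h1.
  have h2 : `|u k t - picard_iter n.+1 k t| <= Lam * (N%:R * (2 * C / 2 ^+ n)) * T.
    have : `|(u k - picard_iter n.+1 k) t - (u k - picard_iter n.+1 k) 0| <=
        Lam * (N%:R * (2 * C / 2 ^+ n)) * (t - 0).
      apply: (@lipschitz_of_derive _ _ (fun s => fv k s - fld (picard_iter n) k s)) => //.
    - apply: within_continuousB; first exact: derive_continuous_within (uE k).
      by apply: continuous_subspaceT; exact: iter_cont.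
    - by move=> s _; apply: is_deriveB; exact: step_derive.
    - move=> s _; apply: le_trans (FL _ _ _) _.
      rewrite ler_wpM2l// -[in leRHS](card_ord N) mulr_natl -sumr_const ler_sum// => j _.
      by rewrite distrC; exact: hv.
    have z0 : picard_iter n.+1 k 0 = x0 k by apply: step0; exact: iter_cont.
    rewrite !fctE u0 z0 subrr !subr0 => /le_trans; apply.
    by rewrite ler_wpM2l// mulr_ge0// mulr_ge0// divr_ge0 ?exprn_ge0// mulr_ge0// mulr_ge0// expR_ge0.
  rewrite -(subrK (picard_iter n.+1 k t) (u k t)) -addrA.
  apply: le_trans (ler_normD _ _) _; apply: le_trans (lerD h2 h1) _.
  rewrite exprS invfM le_eqVlt; apply/orP; left; apply/eqP.
  by field; rewrite expf_neq0.
exists u => k kN; split => //.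
  by move=> t; exact: is_derive_continuous (uE k t).
move=> t /andP[t0 tT]; have tI : 0 <= t <= T by rewrite !ltW.
suff -> : F (u^~ t) k = fv k t by exact: uE.
apply/eqP; rewrite -subr_eq0 -normr_le0 (le_trans (FL _ _ _))//.
by rewrite big1 ?mulr0// => j _; rewrite uv// subrr normr0.
Qed.

End picard.

(** * Subsequences converging in L^1 *)

Section extraction.
Context {R : realType}.

(** The limit is the supremum of the levels that lie below the sequence on a set of the
    ultrafilter. *)
Lemma ultrafilter_bounded_limit (G : set_system nat) (s : nat -> R) (B : R) :
  UltraFilter G -> G [set n | `|s n| <= B] ->
  exists l : R, forall e : R, 0 < e -> G [set n | `|s n - l| < e].
Proof.
move=> GU GB; have GP : ProperFilter G by [exact: ultra_proper]; pose A := [set x : R | G [set n | x <= s n]].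
have [n0 sn0] : [set n | `|s n| <= B] !=set0 by exact: (filter_ex GB).
have AB : has_sup A.
  split.
    exists (- B); rewrite /A /=; apply: filterS GB => n /=.
    by rewrite ler_norml => /andP[].
  exists B => x /= Ax; have [n [/= xs]] := filter_ex (filterI Ax GB).
  by rewrite ler_norml => /andP[_]; exact: le_trans.
exists (sup A) => e e0.
have [x Ax xl] := sup_adherent e0 AB.
have h2 : G [set n | s n < sup A + e].
  have [//|] := in_ultra_setVsetC [set n | sup A + e / 2 <= s n] GU.
    move=> h; have : sup A + e / 2 <= sup A by apply: ub_le_sup => //; exact: AB.2.
    by rewrite gerDl leNgt divr_gt0.
  by apply: filterS => n /= /negP; rewrite -ltNge => /lt_trans; apply; rewrite ltrD2l ltr_pdivrMr// ltr_pMr// ltr1n.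
apply: filterS2 Ax h2 => n /= h1 h2.
by rewrite ltr_norml; apply/andP; split; lra.
Qed.

(** The samples depend on the precision e, which would call for a diagonal extraction. An
    ultrafilter finer than the tails makes all bounded samples converge at once, so for each e one
    of its sets consists of indices at mutual distance at most e. *)
Lemma cauchy_subsequence (d : nat -> nat -> \bar R) (N0 : nat) :
  (forall e : R, 0 < e -> exists (n1 m : nat) (s : nat -> nat -> R) (B delta : R),
     [/\ 0 < delta,
         forall i n, (i < m)%N -> (n1 <= n)%N -> `|s i n| <= B &
         forall n n', (n1 <= n)%N -> (n1 <= n')%N ->
           (forall i, (i < m)%N -> `|s i n - s i n'| < delta) -> (d n n' <= e%:E)%E]) ->
  exists sub : nat -> nat,
    [/\ forall n, (N0 <= sub n)%N, {homo sub : m n / (m < n)%N >-> (m < n)%N} &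
        forall k l, (k <= l)%N -> (d (sub k) (sub l) <= (1 / (2 ^ k.+1)%:R)%:E)%E].
Proof.
move=> hd; have [G [GU ooG]] := ultraFilterLemma eventually_filter.
have GP : ProperFilter G by exact: ultra_proper.
have Goo p : G [set n | (p <= n)%N] by apply: ooG; exists p.
have clus (e : R) : 0 < e -> exists U : set nat,
    G U /\ forall n n', U n -> U n' -> (d n n' <= e%:E)%E.
  move=> /hd[n1 [m [s [B [delta [d0 sB hdd]]]]]].
  have ex i : exists l : R, (i < m)%N -> forall e : R, 0 < e -> G [set n | `|s i n - l| < e].
    have [im|] := boolP (i < m)%N; last by exists 0.
    have [|l hl] := @ultrafilter_bounded_limit G (s i) B GU.
      by apply: filterS (Goo n1) => n /= ?; exact: sB.
    by exists l.
  have [l hl] := choice ex.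
  have d2 : 0 < delta / 2 by rewrite divr_gt0.
  have fin p : (p <= m)%N -> G [set n | forall i, (i < p)%N -> `|s i n - l i| < delta / 2].
    elim: p => [_|p IH pm]; first by apply: filterS (Goo 0%N).
    apply: filterS2 (IH (ltnW pm)) (hl p pm (delta / 2) d2) => n /= h1 h2 i.
    by rewrite ltnS leq_eqVlt => /predU1P[->//|]; exact: h1.
  exists ([set n | (n1 <= n)%N] `&` [set n | forall i, (i < m)%N -> `|s i n - l i| < delta / 2]).
  split; first by apply: filterI; [exact: Goo | exact: fin].
  move=> n n' [/= n1n hn] [/= n1n' hn']; apply: hdd => // i im.
  apply: le_lt_trans (ler_distD (l i) _ _) _; rewrite [ltRHS](splitr delta) ltrD ?hn//.
  by rewrite distrC hn'.
have ek k : 0 < 1 / (2 ^ k.+1)%:R :> R by rewrite divr_gt0 ?ltr0n ?expn_gt0.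
have /choice[U hU] := fun k => clus _ (ek k).
(* Finitely many of these sets still meet beyond any index, so the k-th term can be picked in all
   the sets up to [U k]. *)
pose V k := [set n | forall j, (j <= k)%N -> U j n].
have GV k : G (V k).
  elim: k => [|k IH].
    by apply: filterS (hU 0%N).1 => n /= Un j; rewrite leqn0 => /eqP ->.
  apply: filterS2 IH (hU k.+1).1 => n /= h1 h2 j.
  by rewrite leq_eqVlt => /predU1P[->//|]; exact: h1.
have pick k p : exists n, V k n /\ (p <= n)%N.
  by have [n [Vn pn]] := filter_ex (filterI (GV k) (Goo p)); exists n.
have /choice[f hf] : forall kp : nat * nat, exists n, V kp.1 n /\ (kp.2 <= n)%N.
  by move=> [k p]; exact: pick.
pose sub := fix sub n := if n is m.+1 then f (m.+1, (sub m).+1) else f (0%N, N0).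
have subV k : V k (sub k) by case: k => [|k] /=; [have [] := hf (0%N, N0) | have [] := hf (k.+1, (sub k).+1)].
have subS k : (sub k < sub k.+1)%N by have [] := hf (k.+1, (sub k).+1).
have inc : {homo sub : m n / (m < n)%N >-> (m < n)%N} by apply: homo_ltn => // ? ? ?; exact: ltn_trans.
exists sub; split => //.
  case=> [|n]; first by have [] := hf (0%N, N0).
  by apply: leq_trans (ltnW (inc 0%N n.+1 isT)); have [] := hf (0%N, N0).
by move=> k l kl; apply: (hU k).2; [exact: subV | exact: subV].
Qed.
End extraction.

(** * Completeness of L^1 along rapidly Cauchy sequences *)

Section L1_complete.
Context d (T : measurableType d) (R : realType).
Variables (mu : {measure set T -> \bar R}) (D : set T) (mD : measurable D).
Local Open Scope ereal_scope.

Lemma L1_rapid_limit (f : nat -> T -> R) :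
  (forall n, measurable_fun D (f n)) -> mu.-integrable D (EFin \o f 0%N) ->
  (forall k l, (k <= l)%N ->
     \int[mu]_(x in D) (`|f k x - f l x|%R)%:E <= (1 / (2 ^ k.+1)%:R)%:E) ->
  exists g : T -> R, mu.-integrable D (EFin \o g) /\
    (fun n => \int[mu]_(x in D) (`|f n x - g x|%R)%:E) @ \oo --> 0.
Proof.
move=> mf if0 hf.
(* The upper limit is defined and measurable everywhere; almost everywhere it is the pointwise
   limit. *)
pose g x := fine (limn_esup (fun n => (f n x)%:E)).
have mg : measurable_fun D g.
  have ml : measurable_fun D ((fun x => limn_esup (fun n => (f n x)%:E)) : T -> \bar R).
    by apply: (@measurable_fun_limn_esup _ _ _ _ (fun n x => (f n x)%:E)) => n; exact/measurable_EFinP.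
  exact: (measurableT_comp (@fine_measurable R setT measurableT) ml).
have mdist (u v : T -> R) : measurable_fun D u -> measurable_fun D v ->
    measurable_fun D (fun x => (`|u x - v x|%R)%:E).
  by move=> mu' mv; apply/measurable_EFinP; apply: measurableT_comp => //; exact: measurable_funB.
(* The variation of the sequence at x. Its integral is at most the sum of the 1/2^(k+1), so it is
   finite almost everywhere and f_n(x) converges. *)
pose S (x : T) : \bar R := \sum_(0 <= k <oo) (`|f k x - f k.+1 x|%R)%:E.
have mS : measurable_fun D S.
  by apply: ge0_emeasurable_sum => [k x _ _|k _]; [rewrite lee_fin | exact: mdist].
have S0 x : 0 <= S x by apply: nneseries_ge0 => ? _ _; rewrite lee_fin.
have iS : mu.-integrable D S.
  apply/integrableP; split => //.
  under eq_integral do rewrite gee0_abs//.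
  rewrite integral_nneseries//; last by move=> n; exact: mdist.
  apply: (@le_lt_trans _ _ (1%:E : \bar R)); last exact: ltry.
  apply: le_trans (epsilon_trick0 xpredT ler01).
  apply: lee_nneseries => [k _ _|k _]; first by apply: integral_ge0 => ? _; rewrite lee_fin.
  exact: hf.
have cvg_ae : \forall x \ae mu, D x -> (fun n => f n x) @ \oo --> g x.
  apply: filterS (integrable_ae mD iS) => x /= Sfin Dx.
  have {}Sfin := Sfin Dx.
  have cf : cvgn (f ^~ x).
    have : cvgn (fun n => \sum_(0 <= k < n) `|telescope (f ^~ x) k|)%R.
      apply: nondecreasing_is_cvgn.
        by apply/nondecreasing_seqP => n; rewrite big_nat_recr//= lerDl.
      exists (fine (S x)) => _ [n _ <-].
      rewrite -lee_fin fineK// -sumEFin.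
      have := @nneseries_lim_ge R (fun k => (`|f k x - f k.+1 x|%R)%:E) xpredT 0%N n.
      have h k : (0 <= k)%N -> xpredT k -> 0 <= (`|f k x - f k.+1 x|%R)%:E by rewrite lee_fin.
      by move=> /(_ h); under [X in X <= _ -> _]eq_bigr do rewrite distrC.
    move=> h; have /cvg_ex[l hl] : cvgn (series (telescope (f ^~ x))) by exact: normed_cvg.
    apply/cvg_ex; exists (f 0%N x + l)%R.
    have -> : (f ^~ x) = (fun n => f 0%N x + series (telescope (f ^~ x)) n)%R.
      by apply/funext => n; exact: eq_sum_telescope.
    by apply: cvgD => //; exact: cvg_cst.
  have hl : (fun n => (f n x)%:E) @ \oo --> (limn (f ^~ x))%:E by apply: cvg_EFin; [exact: nearW | exact: cf].
  by rewrite /g (cvg_limn_einf_sup hl).2 /=.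
(* By Fatou's lemma the rate of the sequence passes to the limit in l of |f_k - f_l|. *)
have bound k : \int[mu]_(x in D) (`|f k x - g x|%R)%:E <= (1 / (2 ^ k.+1)%:R)%:E.
  have -> : \int[mu]_(x in D) (`|f k x - g x|%R)%:E =
      \int[mu]_(x in D) limn_einf (fun l => (`|f k x - f l x|%R)%:E).
    apply: ge0_ae_eq_integral => //.
    - exact: mdist.
    - have ml : measurable_fun D (fun x => limn_esup (fun n => - (`|f k x - f n x|%R)%:E)).
        apply: (@measurable_fun_limn_esup _ _ _ _ (fun n x => - (`|f k x - f n x|%R)%:E)) => n.
        exact: (measurableT_comp (@oppe_measurable R setT) (mdist _ _ (mf k) (mf n))).
      exact: (measurableT_comp (@oppe_measurable R setT) ml).
    - move=> x _; rewrite limn_einf_lim; apply: lime_ge; first exact: is_cvg_einfs.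
      by apply: nearW => n; apply: le_ereal_inf_tmp => _ [m _ <-]; rewrite lee_fin.
    - apply: filterS cvg_ae => x /= h Dx.
      have hl : (fun l => (`|f k x - f l x|%R)%:E) @ \oo --> (`|f k x - g x|%R)%:E.
        apply: cvg_EFin; first exact: nearW.
        by apply: cvg_norm; apply: cvgB; [exact: cvg_cst | exact: h].
      by rewrite (cvg_limn_einf_sup hl).1.
  apply: le_trans (fatou mu mD _ _) _.
  - by move=> n; exact: mdist.
  - by move=> n x _; rewrite lee_fin.
  rewrite limn_einf_lim; apply: lime_le.
    by apply: is_cvg_einfs.
  apply: nearW => n; apply: le_trans (ereal_inf_lbound _) (hf k (maxn k n) _).
    by exists (maxn k n) => //=; rewrite leq_maxr.
  by rewrite leq_maxl.
exists g; split.
  have ig0 : mu.-integrable D (EFin \o (f 0%N \- g)%R).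
    apply/integrableP; split; first by apply/measurable_EFinP; exact: measurable_funB.
    by apply: le_lt_trans (bound 0%N) _; exact: ltry.
  have : mu.-integrable D ((EFin \o f 0%N) \- (EFin \o (f 0%N \- g)%R)) by exact: integrableB.
  apply: eq_integrable => // x _ /=.
  by rewrite -EFinB opprB addrC subrK.
apply: (@squeeze_cvge _ _ _ _ (fun=> 0) _ (fun k => (1 / (2 ^ k.+1)%:R)%:E)).
- by apply: nearW => n; rewrite bound andbT; apply: integral_ge0 => ? _; rewrite lee_fin.
- exact: cvg_cst.
- apply: cvg_EFin; first exact: nearW.
  have h : (`|1 / 2| < 1 :> R)%R by rewrite ger0_norm// ltr_pdivrMr// mul1r ltr1n.
  have := cvg_geometric (1 / 2)%R h.
  apply: cvg_trans; apply: near_eq_cvg; apply: nearW => n.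
  by rewrite /geometric /= expr_div_n expr1n mulrACA mulr1 -invfM natrX exprS.
Qed.
End L1_complete.

(** * Cells of the torus *)

Section torus_cells.
Context {R : realType}.
Local Notation mu := (@lebesgue_measure R).

Lemma torus_indicE (L a b y : R) :
  torus_indic L a b y = (`[< exists m : int, a <= y + m%:~R * L < b >] : bool)%:R.
Proof.
by rewrite /torus_indic indicE; congr (nat_of_bool _)%:R.
Qed.

Lemma torus_indic_shift2 (L a b y : R) (m : int) :
  torus_indic L (a + m%:~R * L) (b + m%:~R * L) y = torus_indic L a b y.
Proof.
rewrite !torus_indicE; congr (nat_of_bool _)%:R; apply/asboolP/asboolP => -[n /andP[h1 h2]].
- exists (n - m)%R; rewrite intrD intrN mulrDl mulNr; apply/andP; split; lra.
- exists (n + m)%R; rewrite intrD mulrDl; apply/andP; split; lra.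
Qed.

Lemma torus_indic_ge0 (L a b y : R) : 0 <= torus_indic L a b y.
Proof. by rewrite torus_indicE ler0n. Qed.

Lemma torus_floor (L a y : R) : 0 < L -> exists m : int, a <= y + m%:~R * L < a + L.
Proof.
move=> L0; exists (- Num.floor ((y - a) / L)).
have h1 : (Num.floor ((y - a) / L))%:~R <= (y - a) / L by exact: ge_floor.
have h2 : (y - a) / L < (Num.floor ((y - a) / L))%:~R + 1 by rewrite -intrD1; exact: floorD1_gt.
rewrite ler_pdivlMr// in h1; rewrite ltr_pdivrMr// mulrDl mul1r in h2.
rewrite intrN mulNr; apply/andP; split; lra.
Qed.

Lemma measurable_torus_cell d (T : measurableType d) (L : R) (p q z : T -> R) :
  measurable_fun setT p -> measurable_fun setT q -> measurable_fun setT z ->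
  measurable_fun setT (fun x => torus_indic L (p x) (q x) (z x)).
Proof.
move=> mp mq mz.
pose A : set T := \bigcup_(m : int) [set x | p x <= z x + m%:~R * L < q x].
have -> : (fun x => torus_indic L (p x) (q x) (z x)) = \1_A.
  apply/funext => x; rewrite torus_indicE indicE; congr (nat_of_bool _)%:R.
  apply/idP/idP; first by move/asboolP => [m h]; rewrite inE; exists m.
  by rewrite inE => -[m _ h]; apply/asboolP; exists m.
apply: measurable_indic; apply: countable_bigcupT_measurable => [|m]; first exact: countableP.
rewrite (_ : [set x | _] = [set x | p x <= z x + m%:~R * L] `&` [set x | z x + m%:~R * L < q x]); last first.
  by apply/seteqP; split => x /= => [/andP[]|[-> ->]].
have mzz : measurable_fun setT (fun x => z x + m%:~R * L) by exact: measurable_funD.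
apply: measurableI.
- by rewrite -[X in measurable X]setTI; apply: measurable_fun_le.
- rewrite (_ : [set x | _] = ~` [set x | q x <= z x + m%:~R * L]); last first.
    by apply/seteqP; split => x /=; [rewrite ltNge => /negP | move/negP; rewrite -ltNge].
  by apply: measurableC; rewrite -[X in measurable X]setTI; apply: measurable_fun_le.
Qed.

(** After a translation the arc starts in the fundamental domain and, being at most one period long,
    wraps around at most once: [A1] covers the piece up to L/2, [A2] the piece that re-enters at
    -L/2. *)
Lemma torus_cell_measure_le (L a b : R) : 0 < L -> a <= b -> b <= a + L ->
  (\int[mu]_(y in `[(- (L / 2))%R, (L / 2)%R[) (torus_indic L a b y)%:E <= (b - a)%:E)%E.
Proof.
move=> L0 ab bL.
wlog aI : a b ab bL / - (L / 2) <= a < - (L / 2) + L => [hw|].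
  have [m hm] := torus_floor (- (L / 2)) a L0.
  have := hw (a + m%:~R * L) (b + m%:~R * L).
  under eq_integral do rewrite torus_indic_shift2.
  rewrite (_ : b + m%:~R * L - (a + m%:~R * L) = b - a); last by lra.
  by apply => //; lra.
have {aI} /andP[a1 a2] := aI.
pose A1 := `[a, Num.min b (L / 2)]%classic : set R.
pose A2 := `[(- (L / 2))%R, Num.max (- (L / 2))%R (b - L)]%classic : set R.
have mA1 : measurable A1 by exact: measurable_itv.
have mA2 : measurable A2 by exact: measurable_itv.
have le1 : (\int[mu]_(y in `[(- (L / 2))%R, (L / 2)%R[) (torus_indic L a b y)%:E <=
            \int[mu]_(y in `[(- (L / 2))%R, (L / 2)%R[) ((\1_A1 y)%:E + (\1_A2 y)%:E))%E.
  apply: ge0_le_integral => //.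
  - by move=> y _; rewrite lee_fin torus_indic_ge0.
  - by apply/measurable_EFinP; apply: measurable_funTS; exact: measurable_torus_cell.
  - by apply: emeasurable_funD; apply/measurable_EFinP; exact: measurable_indic.
  move=> y /=; rewrite in_itv /= => /andP[y1 y2]; rewrite lee_fin torus_indicE !indicE.
  case: asboolP => [[m /andP[m1 m2]]|_]; last by rewrite addr_ge0.
  (* Only the unshifted arc and its copy shifted by one period can meet the fundamental domain. *)
  have m0 : (-1 < m)%R by rewrite -(ltr_int R) -(ltr_pM2r L0); lra.
  have m3 : (m < 2)%R by rewrite -(ltr_int R) -(ltr_pM2r L0); lra.
  have [m4|m4] : m = 0 \/ m = 1 by lia.
    rewrite (mem_set (_ : A1 y)) ?lerDl//= /A1 /= in_itv /= le_min.
    by rewrite m4 mul0r addr0 in m1 m2; rewrite m1 (ltW m2) (ltW y2).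
  rewrite (mem_set (_ : A2 y)) ?lerDr//= /A2 /= in_itv /= le_max y1 /=.
  by rewrite m4 mul1r in m1 m2; apply/orP; right; lra.
apply: (le_trans le1); rewrite ge0_integralD//; last 2 first.
- by apply/measurable_EFinP; exact: measurable_indic.
- by apply/measurable_EFinP; exact: measurable_indic.
rewrite !integral_indic//.
apply: (@le_trans _ _ (mu A1 + mu A2)%E).
  by apply: leeD; apply: le_measure; rewrite ?inE //; apply: measurableI => //.
rewrite /A1 /A2 !lebesgue_measure_itv /= !lte_fin.
have [h1|h1] := ltP a (Num.min b (L / 2)); have [h2|h2] := ltP (- (L / 2)) (Num.max (- (L / 2)) (b - L)).
- rewrite -EFinB -EFinB -EFinD lee_fin; move: h1 h2; case: (leP b (L / 2)) => hb; case: (leP (- (L / 2)) (b - L)) => hc; lra.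
- rewrite adde0 -EFinB lee_fin; move: h1 h2; case: (leP b (L / 2)) => hb; case: (leP (- (L / 2)) (b - L)) => hc; lra.
- rewrite add0e -EFinB lee_fin; move: h1 h2; case: (leP b (L / 2)) => hb; case: (leP (- (L / 2)) (b - L)) => hc; lra.
- by rewrite adde0 lee_fin subr_ge0.
Qed.

(** By Tonelli the space integral is taken first, where each arc has length at most q - p. *)
Lemma integral_prod_torus_le (L T : R) n (a p q : 'I_n -> R -> R) : 0 < L ->
  (forall i, continuous (a i)) -> (forall i, continuous (p i)) ->
  (forall i, continuous (q i)) -> (forall i t, 0 <= a i t) ->
  (forall i t, p i t <= q i t <= p i t + L) ->
  (\int[(mu \x mu)%E]_(z in `[0%R, T] `*` `[(- (L / 2))%R, (L / 2)%R[)
      (\sum_(i < n) a i z.1 * torus_indic L (p i z.1) (q i z.1) z.2)%:E <=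
   \int[mu]_(t in `[0%R, T]) (\sum_(i < n) a i t * (q i t - p i t))%:E)%E.
Proof.
move=> L0 ca cp cq a0 pq.
have mc (f : R -> R) : continuous f -> measurable_fun setT (f \o fst : R * R -> R).
  by move=> cf; apply: measurableT_comp => //; exact: continuous_measurable_fun.
pose F (z : R * R) := \sum_(i < n) a i z.1 * torus_indic L (p i z.1) (q i z.1) z.2.
have F0 z : 0 <= F z.
  by rewrite sumr_ge0// => i _; rewrite mulr_ge0 ?torus_indic_ge0//.
have mF : measurable_fun setT F.
  apply: measurable_sum => i; apply: measurable_funM; first exact: mc.
  by apply: measurable_torus_cell; [exact: mc | exact: mc |].
pose E : set (R * R) := `[0%R, T] `*` `[(- (L / 2))%R, (L / 2)%R[.
have mE : measurable E by apply: measurableX; exact: measurable_itv.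
rewrite integral_mkcond fubini_tonelli1; last 2 first.
- apply/(measurable_restrictT _ mE)/measurable_EFinP.
  exact: measurable_funTS.
- by move=> z; rewrite patchE; case: ifP => // _; rewrite lee_fin; exact: F0.
rewrite [leRHS]integral_mkcond; apply: ge0_le_integral => //.
- move=> t _; apply: integral_ge0 => y _.
  by rewrite patchE; case: ifP => // _; rewrite lee_fin; exact: F0.
- apply: measurable_fun_fubini_tonelli_F.
    apply/(measurable_restrictT _ mE)/measurable_EFinP.
    exact: measurable_funTS.
  by move=> z; rewrite patchE; case: ifP => // _; rewrite lee_fin; exact: F0.
- apply/(measurable_restrictT _ (measurable_itv _))/measurable_EFinP.
  apply: measurable_funTS; apply: measurable_sum => i.
  apply: measurable_funM; first exact: continuous_measurable_fun.
  by apply: measurable_funB; exact: continuous_measurable_fun.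
move=> t _; rewrite /fubini_F [leRHS]patchE; case: ifPn => tT; last first.
  rewrite integral0_eq// => y _; rewrite patchE ifF//.
  by apply/negbTE; apply: contra tT; rewrite !inE => -[].
rewrite (_ : \int[mu]_y _ = \int[mu]_(y in `[(- (L / 2))%R, (L / 2)%R[) (F (t, y))%:E)%E; last first.
  rewrite [RHS]integral_mkcond; apply: eq_integral => y _; rewrite !patchE.
  by congr (if _ then _ else _); apply/idP/idP; rewrite !inE /E /=; [case | split => //; rewrite inE in tT].
rewrite /F /=; under eq_integral do rewrite -sumEFin.
rewrite ge0_integral_sum//; last 2 first.
- move=> i; apply/measurable_EFinP; apply: measurable_funTS; apply: measurable_funM => //.
  exact: measurable_torus_cell.
- by move=> i y _; rewrite lee_fin mulr_ge0// torus_indic_ge0.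
rewrite -sumEFin; apply: lee_sum => i _.
under eq_integral do rewrite EFinM.
rewrite ge0_integralZl; first last.
- by rewrite lee_fin.
- by move=> y _; rewrite lee_fin torus_indic_ge0.
- by apply/measurable_EFinP; apply: measurable_funTS; exact: measurable_torus_cell.
- exact: measurable_itv.
rewrite EFinM lee_wpmul2l ?lee_fin//.
by have /andP[h1 h2] := pq i t; exact: torus_cell_measure_le.
Qed.
End torus_cells.

(** * Mollified densities *)

Section configuration.
Context {R : realType}.
Variables (L cL : R) (N : nat) (x : nat -> R -> R) (t : R).
Hypotheses (L0 : 0 < L) (c0 : 0 < cL) (N0 : (0 < N)%N).
Hypothesis hx : forall k, (k < N)%N -> x k t < x_next L N x k t.

(* Lifts of the particles to the universal cover of the torus. *)
Definition unrolled (j : nat) : R := x (j %% N) t + (j %/ N)%:R * L.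
Definition cell_dens (j : nat) : R := dens cL L N x (j %% N) t.

Lemma unrolled_lt j : (j < N)%N -> unrolled j = x j t.
Proof. by move=> jN; rewrite /unrolled modn_small// divn_small// mul0r addr0. Qed.

Lemma cell_dens_lt j : (j < N)%N -> cell_dens j = dens cL L N x j t.
Proof. by move=> jN; rewrite /cell_dens modn_small. Qed.

Lemma unrolledDN j : unrolled (j + N) = unrolled j + L.
Proof.
by rewrite /unrolled modnDr divnDr// divnn N0 natrD mulrDl mul1r addrA.
Qed.

Lemma cell_densDN j : cell_dens (j + N) = cell_dens j.
Proof. by rewrite /cell_dens modnDr. Qed.

Lemma modn_succ j : (j.+1 %% N = if (j %% N).+1 == N then 0 else (j %% N).+1)%N.
Proof.
rewrite -addn1 -modnDml addn1; case: eqP => [->|h]; first by rewrite modnn.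
by rewrite modn_small// ltn_neqAle ltn_pmod// andbT; apply/eqP.
Qed.

Lemma divn_succ j : (j.+1 %/ N = if (j %% N).+1 == N then (j %/ N).+1 else j %/ N)%N.
Proof.
have e : j.+1 = (j %/ N * N + (j %% N).+1)%N by rewrite addnS -divn_eq.
rewrite {1}e divnMDl//; case: eqP => [->|h]; first by rewrite divnn N0 addn1.
by rewrite [X in (_ + X)%N]divn_small ?addn0// ltn_neqAle ltn_pmod// andbT; apply/eqP.
Qed.

Lemma unrolledS j : unrolled j.+1 = x_next L N x (j %% N) t + (j %/ N)%:R * L.
Proof.
rewrite /unrolled /x_next modn_succ divn_succ; case: eqP => // _.
by rewrite -addn1 natrD mulrDl mul1r addrAC addrA.
Qed.

Lemma x_next_unrolled k : (k < N)%N -> x_next L N x k t = unrolled k.+1.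
Proof. by move=> kN; rewrite unrolledS modn_small// divn_small// mul0r addr0. Qed.

Lemma unrolled_ltS j : unrolled j < unrolled j.+1.
Proof. by rewrite unrolledS ltrD2r hx// ltn_pmod. Qed.

Lemma unrolled_le i j : (i <= j)%N -> unrolled i <= unrolled j.
Proof.
by apply: (@homo_leq _ unrolled (fun x y => x <= y)) => // [? ? ?|k];
  [exact: le_trans | exact/ltW/unrolled_ltS].
Qed.

Lemma cell_dens_gap j : cell_dens j * (unrolled j.+1 - unrolled j) = cL / N%:R.
Proof.
have h : x_next L N x (j %% N) t - x (j %% N) t = unrolled j.+1 - unrolled j.
  by rewrite unrolledS /unrolled; lra.
have g0 : unrolled j.+1 - unrolled j != 0 by rewrite subr_eq0 gt_eqF// unrolled_ltS.
by rewrite /cell_dens /dens h invfM mulrA mulfVK.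
Qed.

Lemma cell_dens_gt0 j : 0 < cell_dens j.
Proof.
have := cell_dens_gap j; have g0 : 0 < unrolled j.+1 - unrolled j by rewrite subr_gt0 unrolled_ltS.
by move=> h; rewrite -(pmulr_lgt0 _ g0) h divr_gt0// ltr0n.
Qed.

Lemma dens_prev_succ j : dens_prev cL L N x (j.+1 %% N) t = cell_dens j.
Proof.
rewrite modn_succ /cell_dens; case: eqP => [h|//] /=.
by congr (dens _ _ _ _ _ _); rewrite -[in LHS]h.
Qed.

(** Lets a sum over all particles start at any cell, in particular at the one that contains a given
    point. *)
Lemma sum_periodic (V : nmodType) (f : nat -> V) s : (forall j, f (j + N)%N = f j) ->
  \sum_(i < N) f (s + i)%N = \sum_(i < N) f i.
Proof.
move=> fN; elim: s => [|s <-]; first by apply: eq_bigr => i _; rewrite add0n.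
case: N fN => [|n] fN; first by rewrite !big_ord0.
rewrite big_ord_recr big_ord_recl /= addn0 addrC; congr (_ + _).
  by rewrite -(fN s); congr f; lia.
by apply: eq_bigr => i _; congr f; rewrite /bump /=; lia.
Qed.

Lemma sum_gaps s : \sum_(i < N) (unrolled (s + i).+1 - unrolled (s + i)) = L.
Proof.
rewrite -(big_mkord xpredT (fun i => unrolled (s + i).+1 - unrolled (s + i))).
under eq_bigr do rewrite -addnS.
by rewrite (telescope_sumr (fun i => unrolled (s + i)))// addn0 unrolledDN addrC addKr.
Qed.

Lemma locate y : exists k (m : int), (k < N)%N /\ unrolled k <= y + m%:~R * L < unrolled k.+1.
Proof.
have [m /andP[m1 m2]] := torus_floor (unrolled 0) y L0.
rewrite -unrolledDN add0n in m2.
suff : forall n, y + m%:~R * L < unrolled n -> (n <= N)%N ->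
    exists k, (k < N)%N /\ unrolled k <= y + m%:~R * L < unrolled k.+1.
  by move=> /(_ N m2 (leqnn _)) [k hk]; exists k, m.
elim=> [|n IH] hn nN; first by move: m1; rewrite leNgt hn.
have [h|h] := ltP (y + m%:~R * L) (unrolled n); first by apply: IH => //; exact: ltnW.
by exists n; rewrite nN h hn.
Qed.

Lemma torus_dens_at y k (m : int) : (k < N)%N ->
  unrolled k <= y + m%:~R * L < unrolled k.+1 ->
  \sum_(i < N) dens cL L N x i t * torus_indic L (x i t) (x_next L N x i t) y = cell_dens k.
Proof.
move=> kN /andP[m1 m2].
have {}m3 : unrolled 0 <= y + m%:~R * L by apply: le_trans m1; exact: unrolled_le.
have {}m4 : y + m%:~R * L < unrolled 0 + L.
  by apply: (lt_le_trans m2); rewrite -unrolledDN add0n; exact: unrolled_le.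
rewrite (bigD1 (Ordinal kN))//= big1 => [|i ik].
  rewrite addr0 torus_indicE (_ : `[< _ >] = true) ?mulr1 ?cell_dens_lt//.
  by apply/asboolP; exists m; rewrite -(unrolled_lt kN) x_next_unrolled// m1.
rewrite torus_indicE (_ : `[< _ >] = false) ?mulr0//.
apply/negbTE/asboolPn => -[n]; rewrite -(unrolled_lt (ltn_ord i)) x_next_unrolled//.
move=> /andP[n1 n2].
have n3 : unrolled 0 <= y + n%:~R * L by apply: le_trans n1; exact: unrolled_le.
have n4 : y + n%:~R * L < unrolled 0 + L.
  by apply: (lt_le_trans n2); rewrite -unrolledDN add0n; exact: unrolled_le.
(* Both lifts of y lie in the same period, so the shifts coincide; the ordering of the lifted
   particles then excludes i different from k. *)
have h1 : (n < m + 1)%R by rewrite -(ltr_int R) -(ltr_pM2r L0) intrD mulrDl; lra.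
have h2 : (m < n + 1)%R by rewrite -(ltr_int R) -(ltr_pM2r L0) intrD mulrDl; lra.
have nm : n = m by apply/eqP; rewrite eq_le -!ltzD1 h1 h2.
rewrite nm in n1 n2.
have [ik'|ki|ki] := ltngtP i k.
- by have := le_lt_trans m1 n2; rewrite ltNge unrolled_le.
- by have := le_lt_trans n1 m2; rewrite ltNge unrolled_le.
- by move/eqP: ik; apply; apply/val_inj.
Qed.

Lemma ler_telescope (f : nat -> R) a b : (a <= b)%N ->
  `|f b - f a| <= \sum_(a <= l < b) `|f l.+1 - f l|.
Proof. by move=> ab; rewrite -telescope_sumr// ler_norm_sum. Qed.

(** * Mollification by a periodic bump [psi] supported near LZ, whose primitive [H] grows by 1 per
    period *)

Variables (psi H : R -> R) (Lip h : R).
Hypotheses (h0 : 0 < h) (hL : h + h <= L).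
Hypotheses (psi_lip : forall a b, `|psi a - psi b| <= Lip * `|a - b|)
  (psi_ge0 : forall z, 0 <= psi z) (psi_per : forall z, psi (z + L) = psi z)
  (psi_supp : forall z, h <= z <= L - h -> psi z = 0)
  (H_der : forall z : R, is_derive z 1 H (psi z)) (H_per : forall z, H (z + L) = H z + 1).

(** The variation of phi(rho_N) within distance h of y. The arc of radius h about the interface x_k
    is tested at y, which makes the integral in y immediate. *)
Definition jump_sum (phi : R -> R) (y : R) : R :=
  \sum_(k < N) `|phi (dens cL L N x k t) - phi (dens_prev cL L N x k t)|
     * torus_indic L (x k t - h) (x k t + h) y.

Definition smoothed_dens (y : R) : R := cL / N%:R * \sum_(k < N) psi (x k t - y).

Let Lip0 : 0 <= Lip.
Proof. by have := le_trans (normr_ge0 _) (psi_lip 1 0); rewrite subr0 normr1 mulr1. Qed.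

Lemma psi_per_int z (m : int) : psi (z + m%:~R * L) = psi z.
Proof.
have pn n w : psi (w + n%:R * L) = psi w.
  elim: n w => [|n IH] w; first by rewrite mul0r addr0.
  by rewrite -addn1 natrD mulrDl mul1r addrA psi_per IH.
case: m => n; first exact: pn.
by rewrite NegzE mulrNz mulNr -(pn n.+1 (_ - _)) subrK.
Qed.

Lemma H_nd a b : a <= b -> H a <= H b.
Proof.
move=> ab; rewrite -lerN2; apply: (@nonincreasing_of_derive _ (- H) (fun z => - psi z)) => //.
- by apply: (@derive_continuous_within _ _ (fun z => - psi z)) => z; exact: is_deriveN.
- by move=> z _; rewrite oppr_le0.
Qed.

(** The error of the left-endpoint rule for the integral of [psi] over one cell. *)
Lemma H_taylor a b : a <= b -> `|(b - a) * psi a - (H b - H a)| <= Lip * (b - a) ^+ 2.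
Proof.
move=> ab; rewrite distrC.
have dG (z : R) : is_derive z 1 (H - (fun w => psi a * w)) (psi z - psi a).
  apply: is_deriveB.
  by have := is_deriveZ (psi a) (is_derive_id z 1); rewrite /GRing.scale /= mulr1.
have : `|(H - (fun w => psi a * w)) b - (H - (fun w => psi a * w)) a| <= Lip * (b - a) * (b - a).
  apply: (@lipschitz_of_derive _ _ (fun z => psi z - psi a)) => //.
    exact: derive_continuous_within dG.
  move=> z /andP[az zb]; apply: le_trans (psi_lip _ _) _.
  rewrite ler_wpM2l// gtr0_norm ?subr_gt0// lerB// ltW//.
rewrite -mulrA -expr2; congr (`| _ | <= _); rewrite !fctE; lra.
Qed.

(** With the particles numbered from the cell k of y, S_N(y) is a left Riemann sum of rho_N psi;
    passing to the exact integrals [dH] of [psi] over the cells costs Lip c/N times the gap in each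
    cell. The [dH] sum to 1, and where [dH] is not 0 the cell is joined to cell k through interfaces
    within h of y, so [jump_sum] controls the difference of the densities. *)
Lemma smoothed_dens_near (phi : R -> R) (delta eta Rb y : R) :
  (forall k, (k < N)%N -> dens cL L N x k t <= Rb) ->
  (forall a b, 0 <= a <= Rb -> 0 <= b <= Rb -> `|phi a - phi b| < delta -> `|a - b| <= eta) ->
  jump_sum phi y < delta ->
  `|smoothed_dens y - \sum_(i < N) dens cL L N x i t * torus_indic L (x i t) (x_next L N x i t) y|
    <= eta + Lip * L * cL / N%:R.
Proof.
move=> dR phi_inj hV; have [k [m [kN ym]]] := locate y.
rewrite (torus_dens_at kN ym); have /andP[m1 m2] := ym.
set z := y + m%:~R * L in m1 m2.
pose U l := `|phi (dens cL L N x (l %% N) t) - phi (dens_prev cL L N x (l %% N) t)|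
     * torus_indic L (x (l %% N)%N t - h) (x (l %% N)%N t + h) y.
have U0 l : 0 <= U l by rewrite mulr_ge0// torus_indic_ge0.
have VU : jump_sum phi y = \sum_(k <= l < k + N) U l.+1.
  rewrite -{1}[k]add0n (addnC k N) big_addn addnK big_mkord.
  under eq_bigr do rewrite addnC.
  rewrite (sum_periodic (f := fun j => U j.+1)) => [|j]; last by rewrite /U -addSn modnDr.
  rewrite (sum_periodic (f := U) 1) => [|j]; last by rewrite /U modnDr.
  by apply: eq_bigr => i _; rewrite /U modn_small.
have cR j : 0 <= cell_dens j <= Rb.
  by rewrite ltW ?cell_dens_gt0//= /cell_dens dR// ltn_pmod.
have UE l (n : int) : unrolled l.+1 - h <= y + n%:~R * L < unrolled l.+1 + h ->
    `|phi (cell_dens l.+1) - phi (cell_dens l)| = U l.+1.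
  move=> hn; rewrite /U dens_prev_succ (_ : torus_indic _ _ _ _ = 1) ?mulr1//.
  rewrite -(torus_indic_shift2 L _ _ y (l.+1 %/ N)%:Z) torus_indicE.
  rewrite (_ : `[< _ >] = true)//; apply/asboolP; exists n.
  by rewrite addrAC (addrAC _ h).
pose dH i := H (unrolled (k + i).+1 - z) - H (unrolled (k + i) - z).
have dH0 i : 0 <= dH i by rewrite subr_ge0 H_nd// lerD2r ltW// unrolled_ltS.
have sdH : \sum_(i < N) dH i = 1.
  rewrite -(big_mkord xpredT dH) /dH; under eq_bigr do rewrite -addnS.
  rewrite (telescope_sumr (fun i => H (unrolled (k + i) - z)))//.
  by rewrite unrolledDN addn0 (addrAC _ L) H_per addrAC subrr add0r.
have close i : (i < N)%N -> `|cell_dens (k + i) - cell_dens k| * dH i <= eta * dH i.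
  move=> iN; set j := (k + i)%N.
  have kj : (k <= j)%N by exact: leq_addr.
  have jN : (j <= k + N)%N by rewrite leq_add2l ltnW.
  (* The cell j begins before z + h: the interfaces from cell k up to cell j lie in (z, z + h). *)
  have [hA|hA] := ltP (unrolled j) (z + h).
    apply: ler_wpM2r => //; apply: phi_inj => //; apply: le_lt_trans hV.
    apply: le_trans (@ler_telescope (fun j => phi (cell_dens j)) k j (leq_addr _ _)) _.
    rewrite VU (big_cat_nat kj jN) /=.
    rewrite ler_wpDr//; first by rewrite sumr_ge0.
    rewrite le_eqVlt; apply/orP; left; apply/eqP/eq_big_nat => l /andP[kl lj].
    have h1 : unrolled l.+1 <= unrolled j by exact: unrolled_le.
    have h2 : unrolled k.+1 <= unrolled l.+1 by exact: unrolled_le.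
    by apply: (UE _ m); rewrite -/z; apply/andP; split; lra.
  (* The cell j ends after z + L - h: go on to the copy k + N of cell k, through interfaces in (z +
     L - h, z + L]. *)
  have [hB|hB] := ltP (z + L - h) (unrolled j.+1).
    apply: ler_wpM2r => //; apply: phi_inj => //; rewrite -(cell_densDN k) distrC; apply: le_lt_trans hV.
    apply: le_trans (@ler_telescope (fun j => phi (cell_dens j)) j (k + N)%N jN) _.
    rewrite VU (big_cat_nat kj jN) /=.
    rewrite ler_wpDl//; first by rewrite sumr_ge0.
    rewrite le_eqVlt; apply/orP; left; apply/eqP/eq_big_nat => l /andP[jl lk].
    apply: (UE _ (m + 1)%R); rewrite intrD mulrDl mul1r addrA -/z.
    have h1 : unrolled l.+1 <= unrolled k + L by rewrite -unrolledDN; exact: unrolled_le.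
    have h2 : unrolled j.+1 <= unrolled l.+1 by exact: unrolled_le.
    by apply/andP; split; lra.
  (* Otherwise [psi] vanishes on the whole cell. *)
  suff -> : dH i = 0 by rewrite !mulr0.
  apply/eqP; rewrite -normr_le0 -[0](mul0r (unrolled j.+1 - z - (unrolled j - z))).
  apply: (@lipschitz_of_derive _ _ psi) => //.
  - by rewrite lerD2r ltW// unrolled_ltS.
  - exact: derive_continuous_within H_der.
  - by move=> w /andP[w1 w2]; rewrite psi_supp ?normr0//; apply/andP; split; lra.
have SE : smoothed_dens y = \sum_(i < N) cell_dens (k + i) * ((unrolled (k + i).+1 - unrolled (k + i)) * psi (unrolled (k + i) - z)).
  rewrite /smoothed_dens mulr_sumr.
  transitivity (\sum_(i < N) cL / N%:R * psi (x ((k + i) %% N)%N t - y)).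
    rewrite (sum_periodic (f := fun j => cL / N%:R * psi (x (j %% N)%N t - y))) => [|j].
      by apply: eq_bigr => i _; rewrite modn_small.
    by rewrite modnDr.
  apply: eq_bigr => i _; rewrite mulrA cell_dens_gap; congr (_ * _).
  rewrite -(psi_per_int _ (((k + i) %/ N)%N%:Z - m)%R); congr psi.
  rewrite /unrolled /z intrD intrN; lra.
rewrite SE -[cell_dens k]mulr1 -sdH mulr_sumr -sumrB.
apply: le_trans (ler_norm_sum _ _ _) _.
apply: (@le_trans _ _ (\sum_(i < N) (eta * dH i + Lip * cL / N%:R * (unrolled (k + i).+1 - unrolled (k + i))))).
  apply: ler_sum => i _.
  rewrite (_ : _ - _ = cell_dens (k + i) * ((unrolled (k + i).+1 - unrolled (k + i)) * psi (unrolled (k + i) - z) - dH i) + (cell_dens (k + i) - cell_dens k) * dH i); last by lra.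
  rewrite addrC; apply: le_trans (ler_normD _ _) _; apply: lerD.
    by rewrite normrM [`|dH i|]ger0_norm//; exact: close.
  rewrite normrM [`|cell_dens _|]gtr0_norm ?cell_dens_gt0//.
  have zz : unrolled (k + i) - z <= unrolled (k + i).+1 - z by rewrite lerD2r ltW// unrolled_ltS.
  have := H_taylor zz.
  rewrite (_ : unrolled (k + i).+1 - z - (unrolled (k + i) - z) = unrolled (k + i).+1 - unrolled (k + i)); last by lra.
  move=> /(ler_wpM2l (ltW (cell_dens_gt0 (k + i)))) /le_trans; apply.
  by rewrite -(mulrA Lip cL) -(cell_dens_gap (k + i)) le_eqVlt; apply/orP; left; apply/eqP; ring.
rewrite big_split/= -!mulr_sumr sdH mulr1 lerD2l sum_gaps; lra.
Qed.
End configuration.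

(** * Energy and dissipation *)

Section derivatives.
Context {R : realType}.

Lemma is_derive_fsum n (f : 'I_n -> R -> R) (df : 'I_n -> R) (t : R) :
  (forall i, is_derive t 1 (f i) (df i)) ->
  is_derive t 1 (fun s => \sum_(i < n) f i s) (\sum_(i < n) df i).
Proof.
move=> h; have -> : (fun s => \sum_(i < n) f i s) = \sum_(i < n) f i.
  by apply/funext => s; rewrite fct_sumE.
exact: is_derive_sum.
Qed.

(** Summation by parts on the cycle, without boundary terms. *)
Lemma cyclic_shift_sum n (a b : nat -> R) :
  \sum_(k < n.+1) a k * (if k.+1 == n.+1 then b 0%N else b k.+1) =
  \sum_(k < n.+1) (if (k : nat) is k'.+1 then a k' else a n) * b k.
Proof.
rewrite big_ord_recr big_ord_recl /= eqxx addrC; congr (_ + _).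
by apply: eq_bigr => i _; rewrite /= /bump /= add1n eqSS ltn_eqF.
Qed.

Lemma cyclic_pred_lt n k : (k < n)%N -> ((if k is k'.+1 then k' else n.-1) < n)%N.
Proof. by case: k => [|k] kn; [rewrite ltn_predL | exact: ltnW]. Qed.

(** Continuous induction, with [S] the supremum of the times up to which the bound holds. At s = 0
    the premise of the step is vacuous, so the hypothesis contains the initial bound. *)
Lemma continuous_barrier (f : R -> R) (T delta : R) : 0 <= T -> continuous f ->
  (forall s, 0 <= s <= T -> (forall r, 0 <= r <= s -> r < s -> delta < f r) -> delta < f s) ->
  forall s, 0 <= s <= T -> delta < f s.
Proof.
move=> T0 cf step.
pose A := [set s | 0 <= s <= T /\ forall r, 0 <= r <= s -> delta < f r].
have A0 : A 0.
  split; first by rewrite lexx.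
  move=> r /andP[r0 r1]; have -> : r = 0 by apply/eqP; rewrite eq_le r0 r1.
  by apply: step; [rewrite lexx | move=> ? /andP[? ?]; lra].
have supA : has_sup A by split; [exists 0 | exists T => s [/andP[]]].
set S := sup A.
have S0 : 0 <= S by apply: ub_le_sup => //; exact: supA.2.
have ST : S <= T by apply: ge_sup; [exists 0 | move=> s [/andP[]]].
have below r : 0 <= r < S -> delta < f r.
  move=> /andP[r0 rS]; have [s As rs] := sup_adherent (ltac:(by rewrite subr_gt0; exact: rS) : 0 < S - r) supA.
  by apply: As.2; rewrite r0 /=; rewrite subKr in rs; exact: ltW.
have atS : delta < f S.
  by apply: step => [|r /andP[r0 _] rS]; [rewrite S0 | apply: below; rewrite r0].
have ST' : S = T.
  apply/eqP; rewrite eq_le ST leNgt; apply/negP => SltT.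
  have : \forall r \near S, delta < f r by exact: (cvgr_gt (f S) (cf S)).
  move=> /nbhs_ballP[e /= e0 he].
  have e2 : 0 < Num.min (e / 2) (T - S) by rewrite lt_min divr_gt0// subr_gt0.
  have : S + Num.min (e / 2) (T - S) <= S.
    apply: ub_le_sup; first exact: supA.2.
    split.
      rewrite addr_ge0 ?(ltW e2)//= -lerBrDl ge_min lexx orbT//.
    move=> r /andP[r0 r1]; have [rS|Sr] := ltP r S; first by apply: below; rewrite r0.
    apply: he; rewrite /ball /= distrC ger0_norm ?subr_ge0// ltrBlDl (le_lt_trans r1)//.
    by rewrite ltrD2l gt_min ltr_pdivrMr// ltr_pMr// ltr1n.
  by rewrite gerDl leNgt e2.
move=> s /andP[s0 sT]; have [h|h] := ltP s S; first by apply: below; rewrite s0.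
by have -> : s = S by apply/eqP; rewrite eq_le h ST' sT.
Qed.

End derivatives.

(** * The specific internal energy w(r) = W(r)/r *)

Section internal_energy.
Context {R : realType}.
Variables (W phi dphi : R -> R) (c2 rhobar : R).
Hypotheses (Wnn : forall r : R, 0 <= r -> 0 <= W r)
  (phidef : forall r : R, 0 < r -> derivable W r 1 /\ phi r = r * derive1 W r - W r)
  (phi_0 : phi 0 = 0)
  (phiincr : forall a b, 0 <= a -> a < b -> phi a < phi b)
  (c2_0 : 0 < c2) (rhobar1 : 1 < rhobar)
  (phi4 : forall r : R, rhobar <= r -> phi r >= c2 * r).

Definition specific_energy (r : R) : R := W r / r.

Lemma phi_ge0 r : 0 <= r -> 0 <= phi r.
Proof. by rewrite le_eqVlt => /predU1P[<-|r0]; rewrite ?phi_0// -phi_0 ltW// phiincr. Qed.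

Lemma specific_energy_derive (r : R) : 0 < r ->
  is_derive r 1 specific_energy (phi r / r ^+ 2).
Proof.
move=> r0; have [dW ->] := phidef r0.
have hW : is_derive r 1 W (derive1 W r) by apply: DeriveDef => //; rewrite derive1E.
have hi : is_derive r 1 (fun s : R => s^-1) (- r ^- 2).
  have := @is_deriveV R id r 1 1 (lt0r_neq0 r0) (is_derive_id r 1).
  by rewrite /GRing.scale /= mulr1.
have := is_deriveM hW hi; rewrite /GRing.scale /=.
rewrite (_ : W r * - r ^- 2 + r^-1 * derive1 W r = (r * derive1 W r - W r) / r ^+ 2)//.
by field; rewrite lt0r_neq0.
Qed.

Lemma specific_energy_ge0 r : 0 <= r -> 0 <= specific_energy r.
Proof. by move=> r0; rewrite divr_ge0// Wnn. Qed.

Lemma specific_energy_nd a b : 0 < a -> a <= b -> specific_energy a <= specific_energy b.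
Proof.
move=> a0 ab; rewrite -lerN2.
apply: (@nonincreasing_of_derive _ (- specific_energy) (fun r => - (phi r / r ^+ 2))) => //.
- apply: derivable_within_continuous => r; rewrite in_itv/= => /andP[ar _].
  have r0 : 0 < r by exact: lt_le_trans ar.
  by have /is_deriveN[] := specific_energy_derive r0.
- move=> r /andP[ar _]; apply: is_deriveN; apply: specific_energy_derive; exact: lt_trans ar.
- move=> r /andP[ar _]; have r0 := lt_trans a0 ar.
  by rewrite oppr_le0 divr_ge0 ?exprn_ge0 ?phi_ge0// ltW.
Qed.

(** Beyond [rhobar] the growth of phi gives w' >= c2/r, so w grows at least like c2 ln r. *)
Lemma specific_energy_unbounded B : exists r0, 0 < r0 /\ forall r, r0 <= r -> B < specific_energy r.
Proof.
have rb0 : 0 < rhobar by rewrite (lt_trans _ rhobar1).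
pose C := specific_energy rhobar - c2 * ln rhobar.
have grow r : rhobar <= r -> C + c2 * ln r <= specific_energy r.
  move=> rr; have : c2 * ln r - specific_energy r <= c2 * ln rhobar - specific_energy rhobar.
    have hd s : rhobar <= s -> is_derive s 1 ((fun r => c2 * ln r) - specific_energy) (c2 / s - phi s / s ^+ 2).
      move=> rs; have s0 : 0 < s by exact: lt_le_trans rs.
      apply: is_deriveB; last exact: specific_energy_derive.
      by have := is_deriveZ c2 (is_derive1_ln s0); rewrite /GRing.scale /=.
    apply: (@nonincreasing_of_derive _ ((fun r => c2 * ln r) - specific_energy) (fun s => c2 / s - phi s / s ^+ 2)) => //.
    - apply: derivable_within_continuous => s; rewrite in_itv/= => /andP[rs _].
      by have [] := hd s rs.
    - by move=> s /andP[rs _]; apply: hd; exact: ltW.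
    - move=> s /andP[rs _]; have s0 : 0 < s by exact: lt_trans rs.
      rewrite subr_le0 ler_pdivlMr ?exprn_gt0// expr2 mulrA mulfVK ?lt0r_neq0//.
      exact/phi4/ltW.
  by rewrite /C; lra.
exists (Num.max rhobar (expR ((B - C) / c2 + 1))); split.
  by rewrite lt_max rb0.
move=> r; rewrite ge_max => /andP[rr er].
apply: lt_le_trans (grow _ rr).
rewrite -ltrBlDl mulrC -ltr_pdivrMr//.
apply: (@lt_le_trans _ _ ((B - C) / c2 + 1)); first by rewrite ltrDl.
rewrite -[leLHS]expRK ler_ln ?posrE ?expR_gt0//.
exact: lt_le_trans rr.
Qed.

End internal_energy.

(** * The derivative of the discrete energy *)

Section dynamics.
Context {R : realType}.
Variables (K dK W phi : R -> R) (L cL : R) (N : nat).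
Hypotheses (L0 : 0 < L) (c0 : 0 < cL) (N0 : (0 < N)%N).
Hypotheses (Keven : forall z, K z = K `|z|) (Kcont : continuous K)
  (KdK : forall z : R, z != 0 -> is_derive z 1 K (dK z)).
Hypotheses (phidef : forall r : R, 0 < r -> derivable W r 1 /\ phi r = r * derive1 W r - W r).

Let w := specific_energy W.
Let vel (x : nat -> R -> R) k t := velocity dK phi cL L N x k t.

Definition energy (x : nat -> R -> R) (t : R) : R :=
  (cL / N%:R) ^+ 2 / 2 *
    (\sum_(i < N) \sum_(j < N) (if j == i then 0 else K (x i t - x j t)))
  + cL / N%:R * \sum_(k < N) w (dens cL L N x k t).

Lemma dK_odd z : z != 0 -> dK (- z) = - dK z.
Proof.
move=> z0; have nz0 : - z != 0 by rewrite oppr_eq0.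
have hN : is_derive z 1 (fun w : R => - w) (-1) by exact: is_deriveN.
have h1 := is_derive1_comp (KdK nz0) hN.
have e : K \o (fun w : R => - w) = K.
  by apply/funext => y /=; rewrite Keven normrN -Keven.
rewrite e in h1.
have := @derive_val _ _ _ _ _ _ _ h1; have := @derive_val _ _ _ _ _ _ _ (KdK z0) => -> ->.
by rewrite mulrN1 opprK.
Qed.

Variables (x : nat -> R -> R).

Lemma particles_lt t i j : (forall k, (k < N)%N -> x k t < x_next L N x k t) ->
  (i < j)%N -> (j < N)%N -> x i t < x j t.
Proof.
move=> hx ij jN; have iN := ltn_trans ij jN.
rewrite -(unrolled_lt L x t iN) -(unrolled_lt L x t jN).
by apply: lt_le_trans (unrolled_ltS N0 hx i) _; exact: unrolled_le.
Qed.

Lemma particles_neq t (i j : 'I_N) : (forall k, (k < N)%N -> x k t < x_next L N x k t) ->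
  j != i -> x i t - x j t != 0.
Proof.
move=> hx ij; rewrite subr_eq0; have [h|h|h] := ltngtP (i : nat) (j : nat).
- by rewrite lt_eqF// (particles_lt hx).
- by rewrite gt_eqF// (particles_lt hx).
- by move/eqP: ij; case; exact/val_inj.
Qed.

Lemma dens_gt0 t k : (forall k, (k < N)%N -> x k t < x_next L N x k t) -> (k < N)%N ->
  0 < dens cL L N x k t.
Proof.
by move=> hx kN; rewrite /dens divr_gt0// mulr_gt0 ?ltr0n// subr_gt0 hx.
Qed.

(** The velocities [v] are arbitrary, so the identity says that [vel] is minus the gradient of the
    energy for the inner product with weight c/N. The oddness of K' handles the interaction,
    summation by parts the internal energy. *)
Lemma energy_derive (v : nat -> R) (t : R) :
  (forall k, (k < N)%N -> x k t < x_next L N x k t) ->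
  (forall k, (k < N)%N -> is_derive t 1 (x k) (v k)) ->
  is_derive t 1 (energy x) (- (cL / N%:R) * \sum_(k < N) v k * vel x k t).
Proof.
move=> hx hv; have NR : N%:R != 0 :> R by rewrite pnatr_eq0 -lt0n.
pose I i := \sum_(j < N | (j : nat) != i) dK (x i t - x j t).
pose vn k := if k.+1 == N then v 0%N else v k.+1.
have dint : is_derive t 1 (fun s => \sum_(i < N) \sum_(j < N) (if j == i then 0 else K (x i s - x j s)))
    (\sum_(i < N) \sum_(j < N) (if j == i then 0 else dK (x i t - x j t) * (v i - v j))).
  apply: is_derive_fsum => i; apply: is_derive_fsum => j.
  case: eqP => [_|/eqP ij]; first exact: is_derive_cst.
  have hd : is_derive t 1 (fun s => x i s - x j s) (v i - v j) by apply: is_deriveB; exact: hv.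
  exact: (@is_derive1_comp R K (fun s => x i s - x j s) t _ _ (KdK (particles_neq hx ij)) hd).
(* Exchanging i and j turns the terms in v_j into those in v_i; the factor 2 cancels the 1/2 in the
   energy. *)
have Eint : \sum_(i < N) \sum_(j < N) (if j == i then 0 else dK (x i t - x j t) * (v i - v j))
    = 2 * \sum_(i < N) v i * I i.
  have E1 : \sum_(i < N) \sum_(j < N) (if j == i then 0 else dK (x i t - x j t) * v i) = \sum_(i < N) v i * I i.
    apply: eq_bigr => i _; rewrite /I mulr_sumr [RHS]big_mkcond; apply: eq_bigr => j _.
    by rewrite -(inj_eq val_inj); case: eqP => //= _; rewrite mulrC.
  have E2 : \sum_(i < N) \sum_(j < N) (if j == i then 0 else dK (x i t - x j t) * v j) = - \sum_(i < N) v i * I i.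
    rewrite exchange_big -E1 -sumrN; apply: eq_bigr => j _; rewrite -sumrN; apply: eq_bigr => i _.
    rewrite eq_sym; case: eqP => [_|/eqP ij]; first by rewrite oppr0.
    by rewrite -mulNr -dK_odd ?opprB// particles_neq.
  rewrite mulr2n mulrDl mul1r -[in X in _ = _ + X](opprK (\sum_(i < N) v i * I i)) -E2 -E1 -sumrB.
  apply: eq_bigr => i _; rewrite -sumrB; apply: eq_bigr => j _.
  by case: eqP => _; rewrite ?subr0// mulrBr.
have dint2 : forall k : 'I_N, is_derive t 1 (fun s => w (dens cL L N x k s))
    (N%:R / cL * (phi (dens cL L N x k t) * (v k - vn k))).
  move=> k; have kN := ltn_ord k.
  have dn : is_derive t 1 (fun s => x_next L N x k s) (vn k).
    rewrite /x_next /vn; case: eqP => [_|/eqP h].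
      by have := is_deriveD (hv _ N0) (is_derive_cst L t 1); rewrite addr0.
    by apply: hv; rewrite ltn_neqAle h.
  have g0 : 0 < x_next L N x k t - x k t by rewrite subr_gt0 hx.
  have hg : is_derive t 1 (fun s => N%:R * (x_next L N x k s - x k s)) (N%:R * (vn k - v k)).
    exact: (is_deriveZ (N%:R) (is_deriveB dn (hv _ kN))).
  have Ng0 : N%:R * (x_next L N x k t - x k t) != 0 by rewrite mulf_neq0// lt0r_neq0.
  have hd : is_derive t 1 (fun s => dens cL L N x k s) (cL * (- (N%:R * (x_next L N x k t - x k t)) ^- 2 * (N%:R * (vn k - v k)))).
    exact: (is_deriveZ cL (@is_deriveV R (fun s => N%:R * (x_next L N x k s - x k s)) t _ 1 Ng0 hg)).
  apply: (is_derive_eq (@is_derive1_comp R w (fun s => dens cL L N x k s) t _ _ (specific_energy_derive phidef (dens_gt0 hx kN)) hd)).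
  rewrite /dens; set g := x_next _ _ _ _ _ - _ in g0 Ng0 *.
  by field; rewrite NR !lt0r_neq0.
apply: (is_derive_eq (is_deriveD (is_deriveZ ((cL / N%:R) ^+ 2 / 2) dint) (is_deriveZ (cL / N%:R) (is_derive_fsum dint2)))).
rewrite Eint /GRing.scale /= -mulr_sumr.
have S2 : \sum_(k < N) phi (dens cL L N x k t) * (v k - vn k) =
    \sum_(k < N) v k * (phi (dens cL L N x k t) - phi (dens_prev cL L N x k t)).
  under eq_bigr do rewrite mulrBr; under [RHS]eq_bigr do rewrite mulrBr.
  rewrite !sumrB; congr (_ - _); first by apply: eq_bigr => k _; rewrite mulrC.
  rewrite /vn; case: N N0 => // n _.
  rewrite (cyclic_shift_sum n (fun k => phi (dens cL L n.+1 x k t))).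
  by apply: eq_bigr => -[[|k] kn] _ /=; rewrite mulrC.
rewrite S2 !mulr_sumr -big_split/=; apply: eq_bigr => k _.
rewrite /vel /velocity -/(I k).
by field; rewrite NR lt0r_neq0.
Qed.

End dynamics.

(** * The energy barrier against collisions *)

Section no_collision.
Context {R : realType}.
Variables (K dK W phi : R -> R) (L cL : R) (N : nat) (MK c2 rhobar : R).
Hypotheses (L0 : 0 < L) (c0 : 0 < cL) (N0 : (0 < N)%N).
Hypotheses (Keven : forall z, K z = K `|z|) (Kcont : continuous K)
  (KdK : forall z : R, z != 0 -> is_derive z 1 K (dK z))
  (KMK : forall z, `|K z| <= MK).
Hypotheses (Wnn : forall r : R, 0 <= r -> 0 <= W r)
  (phidef : forall r : R, 0 < r -> derivable W r 1 /\ phi r = r * derive1 W r - W r)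
  (phi_0 : phi 0 = 0)
  (phiincr : forall a b, 0 <= a -> a < b -> phi a < phi b)
  (c2_0 : 0 < c2) (rhobar1 : 1 < rhobar)
  (phi4 : forall r : R, rhobar <= r -> phi r >= c2 * r).

Local Notation w := (specific_energy W).
Local Notation E := (energy K W L cL N).
Local Notation vel := (velocity dK phi cL L N).

Variable x : nat -> R -> R.
Hypothesis cx : forall k, (k < N)%N -> continuous (x k).

Lemma x_next_continuous k : (k < N)%N -> continuous (x_next L N x k).
Proof.
move=> kN; rewrite /x_next; case: eqP => [_|/eqP h].
  by move=> t; apply: cvgD; [exact: cx | exact: cvg_cst].
by move=> t; apply: cx; rewrite ltn_neqAle h.
Qed.

Lemma dens_continuous t k : (k < N)%N -> x k t < x_next L N x k t ->
  {for t, continuous (dens cL L N x k)}.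
Proof.
move=> kN hx; apply: cvgM; first exact: cvg_cst.
apply: cvgV; first by rewrite mulf_neq0 ?pnatr_eq0 -?lt0n// subr_eq0 gt_eqF.
apply: cvgM; first exact: cvg_cst.
by apply: cvgB; [exact: x_next_continuous | exact: cx].
Qed.

Lemma energy_continuous t : (forall k, (k < N)%N -> x k t < x_next L N x k t) ->
  {for t, continuous (E x)}.
Proof.
move=> hx; apply: cvgD.
  apply: cvgM; first exact: cvg_cst.
  apply: cvg_big => [|i _]; first by move=> p; exact: add_continuous.
  apply: cvg_big => [|j _]; first by move=> p; exact: add_continuous.
  case: eqP => _; first exact: cvg_cst.
  apply: (@continuous_comp _ _ _ (fun s => x i s - x j s) K); last exact: Kcont.
  by apply: cvgB; exact: cx.
apply: cvgM; first exact: cvg_cst.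
apply: cvg_big => [|i _]; first by move=> p; exact: add_continuous.
apply: (@continuous_comp _ _ _ (dens cL L N x i) w); first by apply: dens_continuous => //; exact: hx.
exact: is_derive_continuous (specific_energy_derive phidef (dens_gt0 c0 N0 hx (ltn_ord i))).
Qed.

Lemma interaction_bound t :
  `|(cL / N%:R) ^+ 2 / 2 * (\sum_(i < N) \sum_(j < N) (if j == i then 0 else K (x i t - x j t)))|
    <= cL ^+ 2 / 2 * MK.
Proof.
have MK0 : 0 <= MK by exact: le_trans (normr_ge0 _) (KMK 0).
have NR : N%:R != 0 :> R by rewrite pnatr_eq0 -lt0n.
rewrite normrM ger0_norm ?divr_ge0 ?exprn_ge0 ?divr_ge0 ?(ltW c0)//.
apply: (@le_trans _ _ ((cL / N%:R) ^+ 2 / 2 * (\sum_(i < N) \sum_(j < N) MK))).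
  rewrite ler_wpM2l ?divr_ge0 ?exprn_ge0 ?divr_ge0 ?(ltW c0)//.
  apply: le_trans (ler_norm_sum _ _ _) _; apply: ler_sum => i _.
  apply: le_trans (ler_norm_sum _ _ _) _; apply: ler_sum => j _.
  by case: eqP => _; rewrite ?normr0.
rewrite !sumr_const !card_ord -mulr_natl -(mulr_natl MK) le_eqVlt; apply/orP; left; apply/eqP.
by field.
Qed.

Lemma energy_ge t : (forall k, (k < N)%N -> x k t < x_next L N x k t) ->
  - (cL ^+ 2 / 2 * MK) <= E x t.
Proof.
move=> hx; have := interaction_bound t; rewrite ler_norml => /andP[h _].
rewrite /energy ler_wpDr// mulr_ge0 ?divr_ge0 ?(ltW c0)// sumr_ge0// => k _.
by apply: specific_energy_ge0 => //; apply/ltW/dens_gt0.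
Qed.

Lemma energy_le t (r : R) : 0 < r -> (forall k, (k < N)%N -> x k t < x_next L N x k t) ->
  (forall k, (k < N)%N -> dens cL L N x k t <= r) ->
  E x t <= cL ^+ 2 / 2 * MK + cL * w r.
Proof.
move=> r0 hx hr; have := interaction_bound t; rewrite ler_norml => /andP[_ h].
have NR : N%:R != 0 :> R by rewrite pnatr_eq0 -lt0n.
rewrite /energy lerD//.
apply: (@le_trans _ _ (cL / N%:R * (\sum_(k < N) w r))).
  rewrite ler_wpM2l ?divr_ge0 ?(ltW c0)//; apply: ler_sum => k _.
  by apply: (specific_energy_nd phidef phi_0 phiincr); [exact: dens_gt0 | exact: hr].
by rewrite sumr_const card_ord -[w r *+ N]mulr_natl mulrA divfK.
Qed.

Lemma dens_energy_le t k : (forall k, (k < N)%N -> x k t < x_next L N x k t) -> (k < N)%N ->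
  cL / N%:R * w (dens cL L N x k t) <= E x t + cL ^+ 2 / 2 * MK.
Proof.
move=> hx kN; have := interaction_bound t; rewrite ler_norml => /andP[h _].
rewrite /energy.
have : cL / N%:R * w (dens cL L N x k t) <= cL / N%:R * \sum_(k < N) w (dens cL L N x k t).
  rewrite ler_wpM2l ?divr_ge0 ?(ltW c0)// (bigD1 (Ordinal kN))//= lerDl sumr_ge0// => j _.
  by apply: specific_energy_ge0 => //; apply/ltW/dens_gt0.
lra.
Qed.

(** A single gap equal to [delta] would already put the internal energy above [E0] plus the
    interaction bound, so no gap shrinks to [delta] while the energy is at most [E0]. This [delta]
    depends on N and serves only to exclude collisions. *)
Definition gap_threshold (E0 delta : R) : Prop :=
  0 < delta /\ E0 + cL ^+ 2 / 2 * MK < cL / N%:R * w (cL / (N%:R * delta)).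

Lemma gap_threshold_exists (E0 d0 : R) : 0 < d0 -> exists delta : R, gap_threshold E0 delta /\ delta < d0.
Proof.
move=> d00; have NR : 0 < N%:R :> R by rewrite ltr0n.
have [r0 [r00 hr]] := specific_energy_unbounded phidef c2_0 rhobar1 phi4
  ((E0 + cL ^+ 2 / 2 * MK) / (cL / N%:R)).
(* The first summand makes w(r) large enough, the second makes [delta] = c/(N r) smaller than
   [d0]. *)
pose r := r0 + cL / (N%:R * d0) + 1.
have q0 : 0 < cL / (N%:R * d0) by rewrite divr_gt0// mulr_gt0.
have rr0 : 0 < r by rewrite /r; lra.
have rn0 : r != 0 by rewrite lt0r_neq0.
exists (cL / (N%:R * r)); split; last first.
  rewrite ltr_pdivrMr ?mulr_gt0// mulrCA mulrA -ltr_pdivrMl ?mulr_gt0// mulrC /r; lra.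
split; first by rewrite divr_gt0 ?mulr_gt0.
rewrite [ltRHS]mulrC -ltr_pdivrMr ?divr_gt0//.
rewrite (_ : cL / (N%:R * (cL / (N%:R * r))) = r); last by field; rewrite rn0 !lt0r_neq0.
by apply: hr; rewrite /r; lra.
Qed.

(** The equation of motion is assumed only where the gaps are at least [delta], so the lemma covers
    the truncated system as well as true solutions. If the gaps exceed [delta] before s, they are at
    least [delta] at s by continuity; the energy then decreases on [0, s], and the threshold makes
    the inequality strict at s. *)
Lemma gaps_stay (E0 delta T : R) : 0 <= T -> gap_threshold E0 delta ->
  (forall t : R, 0 < t < T -> (forall k, (k < N)%N -> delta <= x_next L N x k t - x k t) ->
     forall k, (k < N)%N -> is_derive t 1 (x k) (vel x k t)) ->
  (forall k, (k < N)%N -> delta < x_next L N x k 0 - x k 0) ->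
  E x 0 <= E0 ->
  forall t : R, 0 <= t <= T -> forall k, (k < N)%N -> delta < x_next L N x k t - x k t.
Proof.
move=> T0 [d0 hE] hder g0 E00.
have NR : 0 < N%:R :> R by rewrite ltr0n.
pose g k t := x_next L N x k t - x k t.
have cg k : (k < N)%N -> continuous (g k).
  by move=> kN t; apply: cvgB; [exact: x_next_continuous | exact: cx].
pose m t := \big[Num.min/g 0%N t]_(k < N) g k t.
have mP t : delta < m t <-> forall k, (k < N)%N -> delta < g k t.
  split; first by move=> /bigmin_gtP[_ h] k kN; exact: (h (Ordinal kN)).
  by move=> h; apply/bigmin_gtP; split; [exact: h | move=> i _; exact: h].
have cm : continuous m.
  have h (s : seq 'I_N) : continuous (fun t => \big[Num.min/g 0%N t]_(k <- s) g k t).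
    elim: s => [|k s IH].
      by under eq_fun do rewrite big_nil; exact: cg.
    by under eq_fun do rewrite big_cons; apply: minr_continuous => //; exact: cg.
  exact: h.
move=> t tT; suff : delta < m t by move/mP.
apply: (@continuous_barrier _ m T delta) => // s /andP[s0 sT] below.
have below' r : 0 <= r < s -> forall k, (k < N)%N -> delta < g k r.
  by move=> /andP[r0 rs]; apply/mP/below => //; rewrite r0 ltW.
have at_s k : (k < N)%N -> delta <= g k s.
  move=> kN; move: s0; rewrite le_eqVlt => /predU1P[<-|s0]; first exact/ltW/g0.
  rewrite leNgt; apply/negP => gs.
  have : \forall r \near s, g k r < delta by exact: (cvgr_lt (g k s) (cg k kN s)).
  move=> /nbhs_ballP[e /= e0 he].
  have r1 : Num.max 0 (s - e / 2) < s by rewrite gt_max s0 ltrBlDr ltrDl divr_gt0.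
  have r2 : 0 <= Num.max 0 (s - e / 2) by rewrite le_max lexx.
  have := below' (Num.max 0 (s - e / 2)); rewrite r1 r2 => /(_ erefl k kN).
  apply/negP; rewrite -leNgt ltW// he// /ball /= gtr0_norm ?subr_gt0//.
  rewrite ltrBlDr -ltrBlDl lt_max; apply/orP; right; lra.
have pos r : 0 <= r <= s -> forall k, (k < N)%N -> delta <= g k r.
  move=> /andP[r0]; rewrite le_eqVlt => /predU1P[->|rs] k kN; first exact: at_s.
  by apply/ltW/below' => //; rewrite r0.
have pos0 r : 0 <= r <= s -> forall k, (k < N)%N -> x k r < x_next L N x k r.
  by move=> rs k kN; rewrite -subr_gt0 (lt_le_trans d0)//; exact: pos.
have s0s : 0 <= s <= s by rewrite s0 lexx.
have Es : E x s <= E x 0.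
  apply: (@nonincreasing_of_derive _ (E x) (fun t => - (cL / N%:R) * \sum_(k < N) vel x k t * vel x k t) _ _ s0).
  - apply: continuous_in_subspaceT => r; rewrite inE /= in_itv /= => rs.
    by apply: energy_continuous; exact: pos0.
  - move=> r /andP[r0 rs]; have rI : 0 <= r <= s by rewrite !ltW.
    apply: (@energy_derive R K dK W phi L cL N c0 N0 Keven KdK phidef x (fun k => vel x k r) r (pos0 r rI)).
    by apply: hder; [rewrite r0 (lt_le_trans rs) | exact: pos].
  - move=> r _; rewrite mulNr oppr_le0 mulr_ge0 ?divr_ge0 ?(ltW c0)// sumr_ge0// => k _.
    by rewrite -expr2 sqr_ge0.
apply/mP => k kN.
have hw := dens_energy_le (pos0 s s0s) kN.
have : w (dens cL L N x k s) < w (cL / (N%:R * delta)).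
  by rewrite -(ltr_pM2l (divr_gt0 c0 NR)) (le_lt_trans hw)// (le_lt_trans _ hE)// lerD2r (le_trans Es).
(* As w is nondecreasing, a gap of at most [delta] would give at least the threshold value of w. *)
rewrite ltNge [delta < _]ltNge; apply: contra => gd.
by apply: (specific_energy_nd phidef phi_0 phiincr); rewrite ?divr_gt0 ?mulr_gt0// /dens ler_pM2l// lef_pV2 ?posrE ?mulr_gt0 ?ler_pM2l// subr_gt0 pos0.
Qed.

(** * Dissipation, pressure jumps and displacement *)

Section dissipation.
Variables (T MdK : R).
Hypotheses (T0 : 0 < T) (dKM : forall z : R, z != 0 -> `|dK z| <= MdK)
  (dKc : forall z : R, z != 0 -> {for z, continuous dK})
  (phic : forall r : R, 0 < r -> {for r, continuous phi}).
Hypothesis hx : forall t k, (k < N)%N -> x k t < x_next L N x k t.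
Hypothesis hder : forall t : R, 0 < t < T ->
  forall k, (k < N)%N -> is_derive t 1 (x k) (vel x k t).

Definition dissipation (t : R) : R := cL / N%:R * \sum_(k < N) vel x k t ^+ 2.

Lemma dens_prevE t k : (k < N)%N -> dens_prev cL L N x k t = dens cL L N x (if k is k'.+1 then k' else N.-1) t.
Proof. by case: k. Qed.

Lemma velocity_continuous k : (k < N)%N -> continuous (vel x k).
Proof.
move=> kN t.
have hphi l : (l < N)%N -> (fun s => phi (dens cL L N x l s)) @ t --> phi (dens cL L N x l t).
  move=> lN; apply: (@continuous_comp _ _ _ (dens cL L N x l) phi).
    by apply: dens_continuous => //; exact: hx.
  by apply: phic; apply: dens_gt0 => //; exact: hx.
apply: cvgB; apply: cvgM; try exact: cvg_cst.
  apply: cvg_big => [|j jk]; first by move=> p; exact: add_continuous.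
  apply: (@continuous_comp _ _ _ (fun s => x k s - x j s) dK).
    by apply: cvgB; exact: cx.
  apply: dKc; apply: (@particles_neq R L N N0 x t (Ordinal kN) j (hx t)).
  by apply: contra jk => /eqP ->.
apply: cvgB; first exact: hphi.
have lN : ((if k is k'.+1 then k' else N.-1) < N)%N by exact: cyclic_pred_lt.
rewrite dens_prevE//; under eq_fun do rewrite dens_prevE//.
exact: hphi.
Qed.

Lemma dissipation_continuous : continuous dissipation.
Proof.
move=> t; apply: cvgM; first exact: cvg_cst.
apply: cvg_big => [|k _]; first by move=> p; exact: add_continuous.
by rewrite expr2; under eq_fun do rewrite expr2; apply: cvgM; exact: velocity_continuous.
Qed.

Lemma dissipation_ge0 t : 0 <= dissipation t.
Proof. by rewrite mulr_ge0 ?divr_ge0 ?(ltW c0)// sumr_ge0// => k _; exact: sqr_ge0. Qed.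

Lemma energy_derive_dissipation (t : R) : 0 < t < T -> is_derive t 1 (E x) (- dissipation t).
Proof.
move=> tT; apply: (is_derive_eq (@energy_derive R K dK W phi L cL N c0 N0 Keven KdK phidef x (fun k => vel x k t) t (hx t) (hder tT))).
by rewrite mulNr; under eq_bigr do rewrite -expr2.
Qed.

Lemma integral_dissipation :
  (\int[@lebesgue_measure R]_(t in `[0%R, T]) (dissipation t)%:E = (E x 0 - E x T)%:E)%E.
Proof.
have cE : continuous (E x) by move=> t; apply: energy_continuous; exact: hx.
have dE (t : R) : 0 < t < T -> is_derive t 1 (- E x) (dissipation t).
  by move=> tT; apply: (is_derive_eq (is_deriveN (energy_derive_dissipation tT))); rewrite opprK.
have cNE : continuous (- E x) by move=> t; apply: cvgN; exact: cE.
rewrite (@continuous_FTC2 _ _ (- E x)) //.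
- by rewrite -EFinB !fctE opprK addrC.
- by apply: continuous_subspaceT; exact: dissipation_continuous.
- split.
  + by move=> t; rewrite in_itv /= => /dE[].
  + exact: cvg_at_right_filter (cNE 0).
  + exact: cvg_at_left_filter (cNE T).
- by move=> t; rewrite in_itv /= => /dE h; rewrite derive1E; apply: derive_val.
Qed.

(** The equation of motion is solved for the pressure jump, and |v| <= v^2 + 1. The terms 1 sum to
    c, the interaction terms to at most c^2 MdK. *)
Lemma total_jump_le t :
  \sum_(k < N) `|phi (dens cL L N x k t) - phi (dens_prev cL L N x k t)|
    <= dissipation t + (cL + cL ^+ 2 * MdK).
Proof.
have NR : 0 < N%:R :> R by rewrite ltr0n.
have M0 : 0 <= MdK by apply: le_trans (normr_ge0 _) (dKM (oner_neq0 R)).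
have hI (k : 'I_N) : `|\sum_(j < N | (j : nat) != k) dK (x k t - x j t)| <= N%:R * MdK.
  apply: le_trans (ler_norm_sum _ _ _) _.
  apply: (@le_trans _ _ (\sum_(j < N) MdK)); last by rewrite sumr_const card_ord mulr_natl.
  rewrite big_mkcond; apply: ler_sum => j _; case: ifP => // jk.
  apply: dKM; apply: (@particles_neq R L N N0 x t k j (hx t)).
  by apply: contra jk => /eqP ->.
apply: (@le_trans _ _ (\sum_(k < N) (cL / N%:R * vel x k t ^+ 2 + (cL / N%:R + cL / N%:R * (cL * MdK))))).
  apply: ler_sum => k _.
  have -> : phi (dens cL L N x k t) - phi (dens_prev cL L N x k t) =
      - (cL / N%:R * (vel x k t + cL / N%:R * (\sum_(j < N | (j : nat) != k) dK (x k t - x j t)))).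
    by rewrite /velocity; field; rewrite !lt0r_neq0.
  rewrite normrN normrM ger0_norm ?divr_ge0 ?(ltW c0)//.
  rewrite -[X in X + _ * (cL * MdK)]mulr1 -!mulrDr ler_wpM2l ?divr_ge0 ?(ltW c0)//.
  apply: le_trans (ler_normD _ _) _; rewrite addrA; apply: lerD.
    have [h|h] := ler0P (vel x k t); nra.
  rewrite normrM ger0_norm ?divr_ge0 ?(ltW c0)//.
  apply: le_trans (ler_wpM2l _ (hI k)) _; first by rewrite divr_ge0// ltW.
  by rewrite mulrA divfK// lt0r_neq0.
rewrite big_split/= -mulr_sumr lerD2l sumr_const card_ord -mulr_natl le_eqVlt.
by apply/orP; left; apply/eqP; field; rewrite lt0r_neq0.
Qed.

(** Integrated form of |v| <= lam v^2 + 1/(4 lam). The signs of the displacements are frozen in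
    [sg], so that the auxiliary [f] is differentiable and it suffices that f' <= 0. *)
Lemma displacement_le (lam s t : R) : 0 < lam -> 0 <= s -> s <= t -> t <= T ->
  cL / N%:R * \sum_(k < N) `|x k t - x k s| <= lam * (E x s - E x t) + cL * (t - s) / (4 * lam).
Proof.
move=> lam0 s0 st tT; have NR : 0 < N%:R :> R by rewrite ltr0n.
pose sg k : R := if x k s <= x k t then 1 else -1.
pose f r := cL / N%:R * (\sum_(k < N) sg k * x k r) + (lam * E x r + (- (cL / (4 * lam))) * r).
pose df r := cL / N%:R * (\sum_(k < N) sg k * vel x k r) + (lam * (- dissipation r) + (- (cL / (4 * lam))) * 1).
have fd (r : R) : 0 < r < T -> is_derive r 1 f (df r).
  move=> rT.
  have h1 : is_derive r 1 (fun r => \sum_(k < N) sg k * x k r) (\sum_(k < N) sg k * vel x k r).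
    by apply: is_derive_fsum => k; exact: (is_deriveZ (sg k) (hder rT (ltn_ord k))).
  exact: (is_deriveD (is_deriveZ (cL / N%:R) h1) (is_deriveD (is_deriveZ lam (energy_derive_dissipation rT)) (is_deriveZ (- (cL / (4 * lam))) (is_derive_id r 1)))).
have cf : continuous f.
  move=> r; apply: cvgD.
    apply: cvgM; first exact: cvg_cst.
    apply: cvg_big => [|k _]; first by move=> p; exact: add_continuous.
    by apply: cvgM; [exact: cvg_cst | exact: cx].
  apply: cvgD; apply: cvgM; try exact: cvg_cst; last exact: cvg_id.
  by apply: energy_continuous; exact: hx.
have : f t <= f s.
  apply: (@nonincreasing_of_derive _ f df) => //.
  - by apply: continuous_subspaceT.
  - by move=> r /andP[sr rt]; apply: fd; rewrite (le_lt_trans s0)// (lt_le_trans rt).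
  - move=> r _; rewrite /df /dissipation mulr1.
    (* Completing the square, as sg_k^2 = 1. *)
    rewrite (_ : _ + _ = - (cL / N%:R * \sum_(k < N) lam * (vel x k r - sg k / (2 * lam)) ^+ 2)).
      rewrite oppr_le0 mulr_ge0 ?divr_ge0 ?(ltW c0)// sumr_ge0// => k _.
      by rewrite mulr_ge0 ?sqr_ge0// ltW.
    have sgE k : sg k ^+ 2 = 1 by rewrite /sg; case: ifP => _; rewrite ?sqrrN expr1n.
    have -> : cL / (4 * lam) = cL / N%:R * \sum_(k < N) (sg k ^+ 2 / (4 * lam)).
      under eq_bigr do rewrite sgE.
      by rewrite sumr_const card_ord -mulr_natl; field; rewrite !lt0r_neq0.
    rewrite -!mulrN mulrCA -!mulrDr; congr (_ * _).
    rewrite mulrN mulr_sumr -!sumrN -!big_split/=; apply: eq_bigr => k _.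
    by field; rewrite lt0r_neq0.
rewrite /f => h.
have -> : cL / N%:R * (\sum_(k < N) `|x k t - x k s|) =
    cL / N%:R * (\sum_(k < N) sg k * x k t) - cL / N%:R * (\sum_(k < N) sg k * x k s).
  rewrite -mulrBr -sumrB; congr (_ * _); apply: eq_bigr => k _; rewrite -mulrBr /sg.
  case: ifPn => [xx|]; first by rewrite mul1r ger0_norm// subr_ge0.
  by rewrite -ltNge => xx; rewrite mulN1r ltr0_norm// subr_lt0.
rewrite (_ : cL * (t - s) / (4 * lam) = cL / (4 * lam) * t - cL / (4 * lam) * s); last by field; rewrite lt0r_neq0.
lra.
Qed.

End dissipation.
End no_collision.

(** * Initial positions *)

Section initial_positions.
Context {R : realType}.
Variables (rho0 : R -> R) (L : R) (N : nat) (M : R).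
Hypotheses (L0 : 0 < L) (N0 : (0 < N)%N) (M0 : 0 < M).
Hypotheses (rho_ge0 : forall x : R, 0 <= rho0 x)
  (rho_L1 : (@lebesgue_measure R).-integrable setT (EFin \o rho0))
  (rho_M : {ae @lebesgue_measure R, forall x, `|rho0 x| <= M}).

Local Notation mu := (@lebesgue_measure R).
Local Notation cL := (massL rho0 L).
Local Notation xi := (x_init rho0 L N).

Lemma per_ext_id y : - (L / 2) <= y < L / 2 -> per_ext rho0 L y = rho0 y.
Proof.
move=> /andP[y1 y2]; rewrite /per_ext (_ : Num.floor _ = 0) ?mulr0 ?subr0//.
apply/eqP; rewrite floor_eq; apply/andP; split.
  by rewrite divr_ge0 ?(ltW L0)//; lra.
by rewrite add0r ltr_pdivrMr// mul1r; lra.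
Qed.

Lemma mass_le (a b : R) : a <= b ->
  (\int[mu]_(y in `[a, b]) (rho0 y)%:E <= (M * (b - a))%:E)%E.
Proof.
move=> ab; apply: (@le_trans _ _ (\int[mu]_(y in `[a, b]) (cst M%:E y))%E).
  apply: ae_ge0_le_integral => //.
  - by move=> y _; rewrite lee_fin.
  - by have /measurable_int := rho_L1; exact: measurable_funTS.
  - by move=> y _; rewrite lee_fin ltW.
  - case: rho_M => A [mA A0 sub]; exists A; split => // y /= h; apply: sub => /= hM.
    by apply: h => _; rewrite lee_fin (le_trans (ler_norm _)).
rewrite integral_cst//= lebesgue_measure_itv /= lte_fin.
by case: ltP => h; [rewrite -EFinB -EFinM | rewrite mule0 lee_fin mulr_ge0 ?subr_ge0// ltW].
Qed.

Let halfL : - (L / 2) <= L / 2. Proof. by rewrite (@le_trans _ _ 0) ?oppr_le0 ?divr_ge0 ?(ltW L0). Qed.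

(** Argues with the simple functions below the integrand, so that integrals of [per_ext] are
    compared without discussing its measurability. *)
Let subset_integral_le (f : R -> R) (A B : set R) : (forall y, 0 <= f y) -> A `<=` B ->
  (\int[mu]_(y in A) (f y)%:E <= \int[mu]_(y in B) (f y)%:E)%E.
Proof.
move=> f0 AB; rewrite [leLHS]integral_mkcond [leRHS]integral_mkcond.
have f0' C y : (0 <= ((fun y => (f y)%:E) \_ C) y)%E.
  by rewrite patchE; case: ifP => // _; rewrite lee_fin.
rewrite !ge0_integralTE//; apply: ge_ereal_sup => _ [h hA <-].
apply: ereal_sup_ubound; exists h => // y; apply: le_trans (hA y) _; rewrite !patchE.
case: ifPn => [yA|_]; last by case: ifP => // _; rewrite lee_fin.
by rewrite ifT// inE; apply: AB; rewrite inE in yA.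
Qed.

Lemma massLE : (cL%:E = \int[mu]_(y in `[(- (L / 2))%R, (L / 2)%R]) (rho0 y)%:E)%E.
Proof.
rewrite /massL fineK// ge0_fin_numE; last by apply: integral_ge0 => y _; rewrite lee_fin.
by apply: (le_lt_trans (mass_le halfL)); exact: ltry.
Qed.

Lemma massL_ge0 : 0 <= cL.
Proof. by rewrite -lee_fin massLE; apply: integral_ge0 => y _; rewrite lee_fin. Qed.

Lemma massL_le1 : (\int[mu]_x (rho0 x)%:E = 1)%E -> cL <= 1.
Proof.
move=> h; rewrite -lee_fin massLE -h; apply: ge0_subset_integral => //.
- by have /measurable_int := rho_L1.
- by move=> y _; rewrite lee_fin.
Qed.

Let meas_rho A : measurable_fun A (EFin \o rho0).
Proof. by have /measurable_int := rho_L1; exact: measurable_funTS. Qed.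

Let cut (a b c : R) : a <= b -> b <= c ->
  (\int[mu]_(y in `[a, c]) (rho0 y)%:E =
   \int[mu]_(y in `[a, b]) (rho0 y)%:E + \int[mu]_(y in `[b, c]) (rho0 y)%:E)%E.
Proof.
move=> ab bc.
rewrite (_ : `[a, c]%classic = `[a, b]%classic `|` `]b, c]%classic); last first.
  by rewrite -itv_bndbnd_setU// ?bnd_simp.
rewrite ge0_integral_setU//; last 3 first.
- exact: meas_rho.
- by move=> y _; rewrite lee_fin.
- apply/disj_setPRL => y /=; rewrite !in_itv /= => /andP[h _]; apply/negP; rewrite negb_and -!ltNge h orbT//.
by rewrite integral_itv_obnd_cbnd//; exact: meas_rho.
Qed.

Lemma mass_per (a b : R) : - (L / 2) <= a -> b < L / 2 ->
  (\int[mu]_(y in `[a, b]) (per_ext rho0 L y)%:E = \int[mu]_(y in `[a, b]) (rho0 y)%:E)%E.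
Proof.
move=> aL bL; apply: eq_integral => y; rewrite inE /= in_itv /= => /andP[ay yb].
by rewrite per_ext_id// (le_trans aL)//= (le_lt_trans yb).
Qed.

Hypothesis c0 : 0 < cL.

(** Induction on k. The mass to the left of x_k is at most k c/N, so at least c/N is left in
    [x_k, L/2] and the next supremum stays below L/2; as rho0 <= M almost everywhere, collecting c/N
    takes a length of at least c/(N M). *)
Lemma x_init_spec k : (k < N)%N ->
  [/\ - (L / 2) <= xi k, xi k <= L / 2,
      (\int[mu]_(y in `[(- (L / 2))%R, xi k]) (rho0 y)%:E <= (k%:R * (cL / N%:R))%:E)%E &
      ((k.+1 < N)%N -> cL / (N%:R * M) <= xi k.+1 - xi k)].
Proof.
have NR : 0 < N%:R :> R by rewrite ltr0n.
have q0 : 0 < cL / N%:R by rewrite divr_gt0.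
have qM : cL / (N%:R * M) = cL / N%:R / M by rewrite invfM mulrA.
move=> kN0; have step l : (l.+1 < N)%N -> - (L / 2) <= xi l -> xi l <= L / 2 ->
    (\int[mu]_(y in `[(- (L / 2))%R, xi l]) (rho0 y)%:E <= (l%:R * (cL / N%:R))%:E)%E ->
    [/\ cL / (N%:R * M) <= xi l.+1 - xi l, xi l.+1 <= L / 2 &
     (\int[mu]_(y in `[xi l, xi l.+1]) (rho0 y)%:E <= (cL / N%:R)%:E)%E].
  move=> lN x1 x2 hm.
  pose A := [set x : R | (\int[mu]_(y in `[xi l, x]) (per_ext rho0 L y)%:E < (cL / N%:R)%:E)%E].
  have xS : xi l.+1 = sup A by [].
  have tail : ((cL / N%:R)%:E <= \int[mu]_(y in `[xi l, (L / 2)%R]) (rho0 y)%:E)%E.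
    have := massLE; rewrite (cut x1 x2) => h.
    have : (cL%:E <= (l%:R * (cL / N%:R))%:E + \int[mu]_(y in `[xi l, (L / 2)%R]) (rho0 y)%:E)%E.
      by rewrite h leeD2r.
    rewrite -leeBlDl// -EFinB; apply: le_trans; rewrite lee_fin.
    have cN : cL = N%:R * (cL / N%:R) by rewrite mulrCA mulfV ?mulr1// lt0r_neq0.
    rewrite {2}cN -mulrBl ler_peMl ?(ltW q0)// -natrB ?(ltnW (ltnW lN))//.
    by rewrite ler1n subn_gt0 ltnW.
  have room : cL / (N%:R * M) <= L / 2 - xi l.
    rewrite qM ler_pdivrMr// (mulrC _ M) -lee_fin; exact: le_trans tail (mass_le x2).
  have Aub : ubound A (L / 2).
    move=> z Az; rewrite leNgt; apply/negP => Lz; move: Az; rewrite /A /= ltNge => /negP; apply.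
    apply: (le_trans tail).
    rewrite -integral_itv_bndo_bndc; last exact: meas_rho.
    rewrite (_ : \int[mu]_(y in `[xi l, (L / 2)%R[) (rho0 y)%:E = \int[mu]_(y in `[xi l, (L / 2)%R[) (per_ext rho0 L y)%:E)%E; last first.
      apply: eq_integral => y; rewrite inE /= in_itv /= => /andP[ay yb].
      by rewrite per_ext_id// (le_trans x1).
    apply: subset_integral_le => [y|y /=]; first exact: rho_ge0.
    by rewrite !in_itv /= => /andP[-> /ltW h]; rewrite (le_trans h)// ltW.
  have Aclose s : 0 <= s -> s < cL / (N%:R * M) -> A (xi l + s).
    move=> s0 sM; rewrite /A /= mass_per//; last by lra.
    apply: (le_lt_trans (mass_le _)); first by lra.
    by rewrite lte_fin addrAC subrr add0r mulrC -ltr_pdivlMr// -qM.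
  have supA : has_sup A.
    split; last by exists (L / 2).
    by exists (xi l + 0); apply: Aclose => //; rewrite divr_gt0// mulr_gt0.
  have S1 : xi l.+1 <= L / 2 by rewrite xS; apply: ge_sup; [exact: supA.1 | exact: Aub].
  have S2 : cL / (N%:R * M) <= xi l.+1 - xi l.
    rewrite leNgt; apply/negP => h.
    have hpos : 0 < cL / (N%:R * M) by rewrite divr_gt0// mulr_gt0.
    pose s := Num.max 0 ((xi l.+1 - xi l + cL / (N%:R * M)) / 2).
    have sM : s < cL / (N%:R * M) by rewrite /s gt_max hpos /=; lra.
    have : xi l + s <= xi l.+1.
      rewrite xS; apply: ub_le_sup; first exact: supA.2.
      by apply: Aclose => //; rewrite /s le_max lexx.
    have : (xi l.+1 - xi l + cL / (N%:R * M)) / 2 <= s by rewrite /s le_max lexx orbT.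
    lra.
  (* The supremum need not belong to [A]: cut at distance s before it, where the mass is below c/N;
     the remainder has mass at most M s <= e. *)
  split => //; apply/lee_addgt0Pr => e e0.
  pose s := Num.min (e / M) (xi l.+1 - xi l).
  have hpos : 0 < cL / (N%:R * M) by rewrite divr_gt0// mulr_gt0.
  have s0 : 0 < s by rewrite /s lt_min divr_gt0//= (lt_le_trans hpos).
  have s1 : xi l <= xi l.+1 - s by rewrite lerBrDl -lerBrDr /s ge_min lexx orbT.
  have s2 : xi l.+1 - s <= xi l.+1 by rewrite gerDl oppr_le0 ltW.
  rewrite (cut s1 s2); apply: leeD.
    have [z Az zs] := sup_adherent s0 supA.
    rewrite -mass_per//; last by rewrite (lt_le_trans _ S1)// gtrDl oppr_lt0.
    apply: le_trans (ltW Az); apply: subset_integral_le => [y|y /=]; first exact: rho_ge0.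
    by rewrite !in_itv /= => /andP[-> h]; rewrite (le_trans h)// ltW.
  apply: le_trans (mass_le s2) _; rewrite subKr lee_fin mulrC -ler_pdivlMr//.
  by rewrite /s ge_min lexx.
have main l : (l < N)%N -> [/\ - (L / 2) <= xi l, xi l <= L / 2 &
    (\int[mu]_(y in `[(- (L / 2))%R, xi l]) (rho0 y)%:E <= (l%:R * (cL / N%:R))%:E)%E].
  elim: l => [|l IH] lN.
    split => //=; rewrite mul0r; apply: le_trans (mass_le (lexx _)) _.
    by rewrite subrr mulr0.
  have [x1 x2 x3] := IH (ltnW lN).
  have [y1 y2 y3] := step l lN x1 x2 x3.
  have x12 : xi l <= xi l.+1.
    by rewrite -subr_ge0 (le_trans _ y1)// divr_ge0 ?mulr_ge0// ltW.
  split => //; first exact: le_trans x12.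
  rewrite (cut x1 x12) (_ : l.+1%:R = l%:R + 1 :> R); last by rewrite natr1.
  rewrite mulrDl mul1r EFinD.
  exact: leeD.
have [h1 h2 h3] := main k kN0; split => // kN.
by have [] := step k kN h1 h2 h3.
Qed.

(** The last gap is not covered by the recursion: it runs from x_(N-1) to x_0 + L = L/2 and contains
    at least the mass c - (N - 1) c/N. *)
Lemma x_init_gap k : (k < N)%N ->
  cL / (N%:R * M) <= (if k.+1 == N then xi 0%N + L else xi k.+1) - xi k.
Proof.
move=> kN; have [h1 h2 h3 h4] := x_init_spec kN.
case: eqP => [kN'|/eqP kN']; last by apply: h4; rewrite ltn_neqAle kN'.
have NR : 0 < N%:R :> R by rewrite ltr0n.
have q0 : 0 < cL / N%:R by rewrite divr_gt0.
have qM : cL / (N%:R * M) = cL / N%:R / M by rewrite invfM mulrA.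
have cN : cL = N%:R * (cL / N%:R) by rewrite mulrCA mulfV ?mulr1// lt0r_neq0.
have : (cL%:E <= (k%:R * (cL / N%:R))%:E + (M * (L / 2 - xi k))%:E)%E.
  by rewrite massLE (cut h1 h2); apply: leeD => //; exact: mass_le.
rewrite -EFinD lee_fin /= -lerBlDl => h.
rewrite qM ler_pdivrMr// (mulrC _ M) (_ : - (L / 2) + L - xi k = L / 2 - xi k); last by lra.
have cN' : cL = k%:R * (cL / N%:R) + cL / N%:R.
  by rewrite {1}cN -{1}kN' -addn1 natrD mulrDl mul1r.
by apply: le_trans h; rewrite {2}cN' addrAC subrr add0r.
Qed.
End initial_positions.

(** * Modulus of phi and bump functions *)

Section pressure.
Context {R : realType}.
Variables (phi dphi : R -> R).
Hypotheses (phi_0 : phi 0 = 0)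
  (phider : forall r : R, 0 < r -> is_derive r 1 phi (dphi r))
  (phider0 : (h^-1 * (phi h - phi 0)) @[h --> (0 : R)^'+] --> dphi 0)
  (dphicont : {within `[0, +oo[, continuous dphi})
  (phiincr : forall a b, 0 <= a -> a < b -> phi a < phi b).

(** Uniform continuity of the inverse of phi. On a mesh of width eta/2, [delta] is at most the least
    increment of phi over a mesh interval; two points more than eta apart enclose such an
    interval. *)
Lemma phi_modulus (Rb eta : R) : 0 <= Rb -> 0 < eta -> exists2 delta : R, 0 < delta &
  forall a b, 0 <= a <= Rb -> 0 <= b <= Rb -> `|phi a - phi b| < delta -> `|a - b| <= eta.
Proof.
move=> Rb0 eta0; pose u := eta / 2; have u0 : 0 < u by rewrite divr_gt0.
have [n hn] : exists n : nat, Rb / u < n%:R.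
  exists (Num.bound `|Rb / u|); apply: le_lt_trans (ler_norm _) _.
  exact: archi_boundP.
pose delta := \big[Num.min/1]_(i < n.+1) (phi (i.+1%:R * u) - phi (i%:R * u)).
have d0 : 0 < delta.
  apply/bigmin_gtP; split => // i _; rewrite subr_gt0 phiincr ?mulr_ge0 ?(ltW u0) ?(ltW eta0)//.
  by rewrite ltr_pM2r// ltr_nat.
exists delta => //.
have phile a b : 0 <= a -> a <= b -> phi a <= phi b.
  by move=> a0; rewrite le_eqVlt => /predU1P[->//|ab]; rewrite ltW// phiincr.
have key a b : 0 <= a -> b <= Rb -> a + eta < b -> delta <= phi b - phi a.
  move=> a0 bR ab; pose i := (Num.truncn (a / u)).+1.
  have au : 0 <= a / u by rewrite divr_ge0// ltW.
  have /andP[t1 t2] := truncn_itv au.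
  have p1 : a < i%:R * u by rewrite -ltr_pdivrMr.
  have p2 : (Num.truncn (a / u))%:R * u <= a by rewrite -ler_pdivlMr.
  have p3 : i.+1%:R * u <= b.
    rewrite /i -2!natr1 !mulrDl mul1r; move: ab; rewrite /u in p2 *; lra.
  have iN : (i < n.+1)%N.
    rewrite ltnS -(ler_nat R) ltW// (lt_trans _ hn)// ltr_pdivlMr// (lt_le_trans _ bR)//.
    by apply: lt_le_trans p3; rewrite ltr_pM2r// ltr_nat.
  apply: (@le_trans _ _ (phi (i.+1%:R * u) - phi (i%:R * u))).
    exact: (bigmin_le _ (Ordinal iN)).
  apply: lerB; first by apply: phile; rewrite ?mulr_ge0// ltW.
  by apply: phile => //; exact: ltW.
move=> a b /andP[a0 aR] /andP[b0 bR] hab; rewrite leNgt; apply/negP => hlt.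
have [ab|ba] := leP a b.
  have := key a b a0 bR; rewrite distrC ger0_norm ?subr_ge0// ltrBrDl in hlt.
  by move=> /(_ hlt); rewrite leNgt (le_lt_trans (ler_norm _))// distrC.
have := key b a b0 aR; rewrite gtr0_norm ?subr_gt0// ltrBrDl in hlt.
by move=> /(_ hlt); rewrite leNgt (le_lt_trans (ler_norm _)).
Qed.

(** phi' is bounded on [0, B], which settles positive arguments; the endpoint 0, where only a right
    difference quotient is known, is reached by letting a tend to 0. *)
Lemma phi_lipschitz (B : R) : 0 <= B -> exists2 Mphi : R, 0 <= Mphi &
  forall a b, 0 <= a <= B -> 0 <= b <= B -> `|phi a - phi b| <= Mphi * `|a - b|.
Proof.
move=> B0.
have cd : {within `[0, B], continuous dphi}.
  by apply: continuous_subspaceW dphicont; apply: subset_itvl.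
have [p pB hp] := EVT_max B0 cd; have [q qB hq] := EVT_min B0 cd.
pose M := `|dphi p| + `|dphi q|; have M0 : 0 <= M by rewrite addr_ge0.
have dM r : 0 <= r <= B -> `|dphi r| <= M.
  move=> rB; have r1 : r \in `[0, B] by rewrite in_itv.
  rewrite ler_norml; apply/andP; split.
    apply: le_trans (hq r r1); rewrite /M opprD; have := ler_norm (- dphi q); rewrite normrN.
    have := normr_ge0 (dphi p); lra.
  apply: le_trans (hp r r1) _; rewrite /M; have := ler_norm (dphi p); have := normr_ge0 (dphi q); lra.
have pos a b : 0 < a -> a <= b -> b <= B -> `|phi b - phi a| <= M * (b - a).
  move=> a0 ab bB; apply: (@lipschitz_of_derive _ _ dphi) => //.
  - apply: derivable_within_continuous => r; rewrite in_itv/= => /andP[ar _].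
    by have [] := phider (lt_le_trans a0 ar).
  - by move=> r /andP[ar _]; apply: phider; exact: lt_trans ar.
  - by move=> r /andP[ar rb]; apply: dM; rewrite (ltW (lt_trans a0 ar)) (le_trans (ltW rb)).
have pos0 b : 0 < b -> b <= B -> `|phi b| <= M * b.
  move=> b0 bB; apply/ler_addgt0Pr => e e0.
  (* Bounds |phi a| / a for all small a > 0, as this quotient tends to |dphi 0|. *)
  pose c := `|dphi 0| + 1; have c0 : 0 < c by rewrite /c; have := normr_ge0 (dphi 0); lra.
  have := phider0 => /cvgrPdist_lt/(_ 1 ltr01); rewrite phi_0 => near0.
  near (0 : R)^'+ => a.
  have a0 : 0 < a by [].
  have ab : a < b by near: a; exact: nbhs_right_lt.
  have ae : c * a < e.
    rewrite mulrC -ltr_pdivlMr//; near: a; apply: nbhs_right_lt; exact: divr_gt0.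
  have pa : `|phi a| <= c * a.
    have : `|dphi 0 - a^-1 * (phi a - 0)| < 1 by near: a.
    rewrite subr0 => /ltW h; rewrite -ler_pdivrMr// -[X in _ / X](gtr0_norm a0) -normf_div mulrC.
    rewrite /c -lerBlDl; apply: le_trans h; rewrite distrC; exact: lerB_dist.
  have := pos a b a0 (ltW ab) bB; rewrite -lerBlDr => h.
  have h2 : `|phi b| <= `|phi b - phi a| + `|phi a|.
    by rewrite -{1}(subrK (phi a) (phi b)) ler_normD.
  have Ma : 0 <= M * a by rewrite mulr_ge0// ltW.
  move: (pos a b a0 (ltW ab) bB); rewrite mulrBr; lra.
exists M => //.
have half a b : 0 <= a -> a <= b -> b <= B -> `|phi b - phi a| <= M * (b - a).
  rewrite le_eqVlt => /predU1P[<-|a0] ab bB; last exact: pos.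
  move: ab; rewrite phi_0 !subr0 le_eqVlt => /predU1P[<-|b0]; last exact: pos0.
  by rewrite phi_0 normr0 mulr0.
move=> a b /andP[a0 aB] /andP[b0 bB]; have [ab|/ltW ba] := leP a b.
  by rewrite distrC (distrC a) [X in _ * X]ger0_norm ?subr_ge0//; exact: half.
by rewrite [X in _ * X]ger0_norm ?subr_ge0//; exact: half.
Unshelve. all: by end_near. Qed.

End pressure.

Section bump.
Context {R : realType}.
Variables (L h : R).
Hypotheses (L0 : 0 < L) (h0 : 0 < h) (hL : h + h <= L).

Let om : R := pi *+ 2 / L.
Let om0 : 0 < om. Proof. by rewrite divr_gt0// pmulrn_lgt0// pi_gt0. Qed.
Let omL : om * L = pi *+ 2. Proof. by rewrite /om divfK// lt0r_neq0. Qed.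
(** A truncated cosine of period L: periodic by construction, Lipschitz with constant [om], and 0 at
    distance at least h from LZ. *)
Let b (z : R) : R := Num.max (cos (om * z) - cos (om * h)) 0.

Let cos_lip (x y : R) : `|cos x - cos y| <= `|x - y|.
Proof.
wlog yx : x y / y <= x => [hw|].
  by case/orP: (le_total y x) => ?; [exact: hw | rewrite distrC (distrC x); exact: hw].
rewrite [leRHS]ger0_norm ?subr_ge0// -[leRHS]mul1r.
apply: (@lipschitz_of_derive _ _ (fun z => - sin z)) => //.
- by apply: (@derive_continuous_within _ _ (fun z => - sin z)) => z; exact: is_derive_cos.
- by move=> z _; rewrite normrN sin_max.
Qed.

Let max_lip (x y : R) : `|Num.max x 0 - Num.max y 0| <= `|x - y|.
Proof.
have h1 := ler_norm (x - y); have h2 := ler_norm (y - x); rewrite distrC in h2.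
by rewrite ler_norml; case: (leP x 0) => ?; case: (leP y 0) => ?; apply/andP; split; lra.
Qed.

Let b_lip x y : `|b x - b y| <= om * `|x - y|.
Proof.
apply: le_trans (max_lip _ _) _.
rewrite (_ : _ - _ = cos (om * x) - cos (om * y)); last by lra.
by apply: le_trans (cos_lip _ _) _; rewrite -mulrBr normrM gtr0_norm.
Qed.

Let b_ge0 z : 0 <= b z. Proof. by rewrite /b le_max lexx orbT. Qed.

Let b_per z : b (z + L) = b z.
Proof. by rewrite /b mulrDr omL cosD2pi. Qed.

Let omh : 0 < om * h <= pi.
Proof.
by rewrite mulr_gt0//= -(ler_pM2r (ltr0Sn R 1)) mulr_natr mulr_natr -omL -mulrnAr ler_pM2l.
Qed.

Let b_supp z : h <= z <= L - h -> b z = 0.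
Proof.
move=> /andP[z1 z2]; apply/max_idPr; rewrite subr_le0.
have /andP[h1 h2] := omh.
have main w : h <= w -> w <= L / 2 -> cos (om * w) <= cos (om * h).
  move=> w1 w2; have hw : om * h <= om * w by rewrite ler_pM2l.
  have wpi : om * w <= pi.
    rewrite -(ler_pM2r (ltr0Sn R 1)) !mulr_natr -omL -mulrnAr ler_pM2l// -mulr_natr -ler_pdivlMr//.
  move: hw; rewrite le_eqVlt => /predU1P[->//|hw]; apply: ltW.
  by rewrite ltr_cos// in_itv /= ?h2 ?wpi ?(ltW h1)//= (ltW (lt_trans h1 hw)).
have [zL|zL] := leP z (L / 2); first exact: main.
rewrite -cosN (_ : cos (- (om * z)) = cos (om * (L - z))).
  by apply: main; lra.
by rewrite mulrBr omL addrC cosD2pi.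
Qed.

Lemma bump_exists : exists (psi H : R -> R) (Lip : R),
  [/\ (forall x y, `|psi x - psi y| <= Lip * `|x - y|), (forall z, 0 <= psi z),
      (forall z, psi (z + L) = psi z), (forall z, h <= z <= L - h -> psi z = 0) &
      (forall z : R, is_derive z 1 H (psi z)) /\ (forall z, H (z + L) = H z + 1)].
Proof.
have cb : continuous b.
  move=> z; apply: (maxr_continuous (f := fun z => cos (om * z) - cos (om * h)) (g := fun=> 0)).
    move=> y; apply: cvgB; last exact: cvg_cst.
    apply: (@continuous_comp _ _ _ (fun z => om * z) cos); last exact: continuous_cos.
    by apply: cvgM; [exact: cvg_cst | exact: cvg_id].
  by move=> y; exact: cvg_cst.
have [H [H0 Hd]] := continuous_primitive cb.
have shift z : H (z + L) - H z = H L.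
  have dS (y : R) : is_derive y 1 (fun y => H (y + L)) (b y).
    have hs : is_derive y 1 (fun y => y + L) 1.
      by have := is_deriveD (is_derive_id y 1) (is_derive_cst L y 1); rewrite addr0.
    have := @is_derive1_comp R H (fun y => y + L) y _ _ (Hd (y + L)) hs.
    by rewrite mulr1 b_per.
  have aux (u v : R) : u <= v -> H (v + L) - H (u + L) = H v - H u.
    move=> uv; apply: (@eq_of_derive _ (fun y => H (y + L)) _ b) => //.
    - exact: derive_continuous_within dS.
    - exact: derive_continuous_within Hd.
  have [z0|/ltW z0] := leP 0 z.
    by have := aux 0 z z0; rewrite H0 add0r subr0; lra.
  by have := aux z 0 z0; rewrite H0 add0r; lra.
have nd (u v : R) : u <= v -> H u <= H v.
  move=> uv; rewrite -lerN2; apply: (@nonincreasing_of_derive _ (- H) (fun z => - b z)) => //.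
  - by apply: (@derive_continuous_within _ _ (fun z => - b z)) => z; exact: is_deriveN.
  - by move=> z _; rewrite oppr_le0.
have I0 : 0 < H L.
  have b0 : 0 < b 0.
    rewrite /b lt_max mulr0 cos0 subr_gt0 -[ltRHS](@cos0 R) ltr_cos ?in_itv /= ?lexx ?pi_ge0//;
      by have /andP[h1 h2] := omh; rewrite ?h1 ?h2 ?(ltW h1).
  (* If the integral over a period were 0, the nondecreasing [H] would be constant on [0, L] and its
     derivative [b] would vanish inside, whereas b > 0 near 0. *)
  rewrite lt_neqAle -{1 2}H0 nd ?(ltW L0)// andbT; apply/negP => /eqP HL.
  have Hc z : 0 <= z <= L -> H z = 0.
    move=> /andP[z1 z2]; apply/eqP; rewrite eq_le -{2}H0 nd// andbT.
    by rewrite (le_trans (nd _ _ z2))// -HL H0.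
  near (0 : R)^'+ => z.
  have z0 : 0 < z by [].
  have zL : z < L by near: z; exact: nbhs_right_lt.
  have bz : 0 < b z.
    have := b_lip z 0; rewrite subr0 (gtr0_norm z0) => hb.
    have hz : om * z < b 0.
      by rewrite mulrC -ltr_pdivlMr//; near: z; apply: nbhs_right_lt; exact: divr_gt0.
    by move: hb; rewrite ler_norml => /andP[hb _]; lra.
  have : is_derive z 1 H 0.
    apply: (@is_derive_near _ (cst 0)).
    have : \forall y \near z, y \in `]0, L[ by apply: near_in_itvoo; rewrite in_itv /= z0.
    by apply: filterS => y; rewrite in_itv /= => /andP[y1 y2]; rewrite Hc// !ltW.
  move=> /(@derive_val _ _ _ _ _ _ _) e1; have := @derive_val _ _ _ _ _ _ _ (Hd z).
  by rewrite e1 => e2; move: bz; rewrite -e2 ltxx.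
exists (fun z => b z / H L), (fun z => H z / H L), (om / H L); split.
- move=> x y; rewrite -mulrBl normrM [`|_^-1|]gtr0_norm ?invr_gt0// mulrAC ler_pM2r ?invr_gt0//.
- by move=> z; rewrite divr_ge0// ltW.
- by move=> z; rewrite b_per.
- by move=> z hz; rewrite b_supp// mul0r.
split => z.
- have := is_deriveZ (H L)^-1 (Hd z); rewrite /GRing.scale /= mulrC.
  by rewrite (_ : (H L)^-1 \*: H = (fun z => H z / H L))//; apply/funext => y; rewrite mulrC.
- by rewrite -[H (z + L)](subrK (H z)) shift mulrDl mulfV ?lt0r_neq0// addrC.
Unshelve. all: by end_near. Qed.

End bump.

(** * Existence of the particle solution *)

Section truncated_field.
Context {R : realType}.
Variables (dK ddK phi : R -> R) (L cL : R) (N : nat) (Mdd Mphi delta : R).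
Hypotheses (L0 : 0 < L) (c0 : 0 < cL) (N0 : (0 < N)%N) (delta0 : 0 < delta).
Hypotheses (ddKd : forall z : R, z != 0 -> is_derive z 1 dK (ddK z))
  (ddKM : forall z : R, z != 0 -> `|ddK z| <= Mdd)
  (Mphi0 : 0 <= Mphi)
  (phi_lip : forall a b, 0 <= a <= cL / (N%:R * delta) -> 0 <= b <= cL / (N%:R * delta) ->
     `|phi a - phi b| <= Mphi * `|a - b|).

Definition gap (X : nat -> R) (k : nat) : R := (if k.+1 == N then X 0%N + L else X k.+1) - X k.

Definition trunc_dens (X : nat -> R) (k : nat) : R := cL / (N%:R * Num.max (gap X k) delta).

(** The branch follows the order of the indices and not the sign of z: K' may jump at 0, so a test
    on the sign could make the truncated field discontinuous. For ordered particles both agree. *)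
Definition trunc_dK (k j : nat) (z : R) : R :=
  if (j < k)%N then dK (Num.max z delta) else dK (- Num.max (- z) delta).

(* The particle velocity with all interparticle distances replaced by their maximum with [delta]:
   globally Lipschitz, and equal to the velocity as long as the gaps are at least [delta]. *)
Definition trunc_velocity (X : nat -> R) (k : nat) : R :=
  if (k < N)%N then
    - (cL / N%:R) * (\sum_(j < N | (j : nat) != k) trunc_dK k j (X k - X j))
    - (N%:R / cL) * (phi (trunc_dens X k) - phi (trunc_dens X (if k is k'.+1 then k' else N.-1)))
  else 0.

Let max_lip (x y : R) : `|Num.max x delta - Num.max y delta| <= `|x - y|.
Proof.
have h1 := ler_norm (x - y); have h2 := ler_norm (y - x); rewrite distrC in h2.
by rewrite ler_norml; case: (leP x delta) => ?; case: (leP y delta) => ?; apply/andP; split; lra.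
Qed.

Let Mdd0 : 0 <= Mdd. Proof. exact: le_trans (normr_ge0 _) (ddKM (oner_neq0 R)). Qed.

Let dK_lip (a b : R) : 0 < a * b -> `|dK a - dK b| <= Mdd * `|a - b|.
Proof.
wlog ba : a b / b <= a => [hw|] ab0.
  case/orP: (le_total b a) => ?; first exact: hw.
  by rewrite distrC (distrC a); apply: hw; rewrite // mulrC.
have nz z : b <= z -> z <= a -> z != 0.
  move=> bz za; apply/negP => /eqP z0; rewrite z0 in bz za.
  by move: ab0; rewrite ltNge mulr_ge0_le0.
rewrite [X in _ * X]ger0_norm ?subr_ge0//.
apply: (@lipschitz_of_derive _ _ ddK) => //.
- apply: derivable_within_continuous => z; rewrite in_itv /= => /andP[h1 h2].
  by have [] := ddKd (nz z h1 h2).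
- by move=> z /andP[h1 h2]; apply: ddKd; apply: nz; exact: ltW.
- by move=> z /andP[h1 h2]; apply: ddKM; apply: nz; exact: ltW.
Qed.

Let maxd z : 0 < Num.max z delta. Proof. by rewrite lt_max delta0 orbT. Qed.

Let trunc_dK_lip k j (a b : R) : `|trunc_dK k j a - trunc_dK k j b| <= Mdd * `|a - b|.
Proof.
rewrite /trunc_dK; case: ifP => _.
  apply: le_trans (dK_lip _) _; first by rewrite mulr_gt0.
  by rewrite ler_wpM2l.
apply: le_trans (dK_lip _) _; first by rewrite mulrNN mulr_gt0.
rewrite ler_wpM2l// -opprD normrN; apply: le_trans (max_lip _ _) _.
by rewrite -opprD normrN.
Qed.

Let NR : 0 < N%:R :> R. Proof. by rewrite ltr0n. Qed.

Let trunc_densI X k : 0 <= trunc_dens X k <= cL / (N%:R * delta).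
Proof.
rewrite /trunc_dens divr_ge0 ?mulr_ge0 ?(ltW c0) ?(ltW (maxd _))//= ler_pM2l//.
by rewrite lef_pV2 ?posrE ?mulr_gt0// ler_pM2l// le_max lexx orbT.
Qed.

Lemma trunc_velocity_lipschitz : exists2 Lam : R, 0 <= Lam &
  forall X Y k, `|trunc_velocity X k - trunc_velocity Y k| <= Lam * \sum_(j < N) `|X j - Y j|.
Proof.
pose A := cL / N%:R * (N%:R * (Mdd * 2)).
(* c/(N delta^2) is the Lipschitz constant of a density in its truncated gap; the factors 2 come
   from differences of two positions and of two pressures. *)
pose B := N%:R / cL * (Mphi * (cL / (N%:R * delta ^+ 2) * 2) * 2).
have A0 : 0 <= A by rewrite !mulr_ge0 ?invr_ge0 ?(ltW c0).
have D0 : 0 <= cL / (N%:R * delta ^+ 2) by rewrite divr_ge0 ?mulr_ge0 ?exprn_ge0 ?(ltW c0) ?(ltW delta0).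
have B0 : 0 <= B by rewrite mulr_ge0 ?divr_ge0 ?(ltW c0)// mulr_ge0// mulr_ge0// mulr_ge0.
exists (A + B); first by rewrite addr_ge0.
move=> X Y k; set S := \sum_(j < N) _.
have S0 : 0 <= S by apply: sumr_ge0.
have XS j : (j < N)%N -> `|X j - Y j| <= S.
  by move=> jN; rewrite /S (bigD1 (Ordinal jN))//= lerDl sumr_ge0.
have diff (a b c d : R) : `|a - c| <= S -> `|b - d| <= S -> `|(a - b) - (c - d)| <= 2 * S.
  move=> h1 h2; rewrite (_ : _ - _ = (a - c) - (b - d)); last by lra.
  by apply: le_trans (ler_normB _ _) _; rewrite mulr2n mulrDl mul1r lerD.
have gapS l : (l < N)%N -> `|gap X l - gap Y l| <= 2 * S.
  move=> lN; rewrite /gap; case: eqP => [_|/eqP h]; apply: diff; try exact: XS.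
  - by rewrite (_ : _ - _ = X 0%N - Y 0%N); [exact: XS | lra].
  - by apply: XS; rewrite ltn_neqAle h.
have densS l : (l < N)%N -> `|phi (trunc_dens X l) - phi (trunc_dens Y l)| <=
    Mphi * (cL / (N%:R * delta ^+ 2) * 2) * S.
  move=> lN; apply: le_trans (phi_lip (trunc_densI _ _) (trunc_densI _ _)) _.
  rewrite -(mulrA Mphi) ler_wpM2l//.
  have mX := maxd (gap X l); have mY := maxd (gap Y l).
  rewrite (_ : trunc_dens X l - trunc_dens Y l =
     cL / N%:R * ((Num.max (gap Y l) delta - Num.max (gap X l) delta) / (Num.max (gap X l) delta * Num.max (gap Y l) delta))); last first.
    by rewrite /trunc_dens; field; rewrite !lt0r_neq0.
  rewrite normrM [`|cL / _|]gtr0_norm ?divr_gt0// (_ : cL / (N%:R * delta ^+ 2) * 2 * S = cL / N%:R * (2 * S / delta ^+ 2)); last first.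
    by field; rewrite !lt0r_neq0.
  rewrite ler_wpM2l ?divr_ge0 ?(ltW c0)// normrM [`|_^-1|]gtr0_norm ?invr_gt0 ?mulr_gt0//.
  apply: ler_pM => //; first by rewrite invr_ge0 mulr_ge0// ltW.
    by apply: le_trans (max_lip _ _) _; rewrite distrC; exact: gapS.
  by rewrite lef_pV2 ?posrE ?mulr_gt0 ?exprn_gt0// expr2 ler_pM ?(ltW delta0)// le_max lexx orbT.
rewrite /trunc_velocity; case: ifPn => [kN|_]; last by rewrite subrr normr0 mulr_ge0// addr_ge0.
set l := (if k is k'.+1 then k' else N.-1).
have lN : (l < N)%N by exact: cyclic_pred_lt.
rewrite (_ : _ - _ = - (cL / N%:R) * (\sum_(j < N | (j : nat) != k) (trunc_dK k j (X k - X j) - trunc_dK k j (Y k - Y j)))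
   - N%:R / cL * ((phi (trunc_dens X k) - phi (trunc_dens Y k)) - (phi (trunc_dens X l) - phi (trunc_dens Y l)))); last first.
  by rewrite sumrB; lra.
apply: le_trans (ler_normB _ _) _; rewrite mulrDl; apply: lerD.
  rewrite mulNr normrN normrM ger0_norm ?divr_ge0 ?(ltW c0)// /A -!mulrA ler_wpM2l ?(ltW c0)// ler_wpM2l ?invr_ge0//.
  apply: le_trans (ler_norm_sum _ _ _) _.
  apply: (@le_trans _ _ (\sum_(j < N) (Mdd * (2 * S)))); last by rewrite sumr_const card_ord -[leLHS]mulr_natl.
  rewrite big_mkcond; apply: ler_sum => j _; case: ifP => _; last by rewrite !mulr_ge0.
  by apply: le_trans (trunc_dK_lip _ _ _ _) _; rewrite ler_wpM2l//; apply: diff; exact: XS.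
rewrite normrM ger0_norm ?divr_ge0 ?(ltW c0)// /B -!mulrA ler_wpM2l// ler_wpM2l ?invr_ge0 ?(ltW c0)//.
apply: le_trans (ler_normB _ _) _.
have h1 := densS _ kN; have h2 := densS _ lN.
apply: le_trans (lerD h1 h2) _; rewrite le_eqVlt; apply/orP; left; apply/eqP; ring.
Qed.

Lemma gapE (x : nat -> R -> R) t k : gap (x^~ t) k = x_next L N x k t - x k t.
Proof. by rewrite /gap /x_next; case: ifP. Qed.

Lemma trunc_velocityE (x : nat -> R -> R) t :
  (forall k, (k < N)%N -> delta <= x_next L N x k t - x k t) ->
  forall k, (k < N)%N -> trunc_velocity (x^~ t) k = velocity dK phi cL L N x k t.
Proof.
move=> hg k kN.
have hx l : (l < N)%N -> x l t < x_next L N x l t.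
  by move=> lN; rewrite -subr_gt0 (lt_le_trans delta0)// hg.
have hd i j : (i < j)%N -> (j < N)%N -> delta <= x j t - x i t.
  move=> ij jN; have iN := ltn_trans ij jN; apply: le_trans (hg i iN) _.
  rewrite lerB// x_next_unrolled// -(unrolled_lt L x t jN); exact: (unrolled_le N0 hx).
have densE l : (l < N)%N -> trunc_dens (x^~ t) l = dens cL L N x l t.
  by move=> lN; rewrite /trunc_dens gapE (max_idPl (hg l lN)).
rewrite /trunc_velocity kN /velocity; congr (_ * _ - _ * (phi _ - phi _)).
- apply: eq_bigr => j jk; rewrite /trunc_dK; case: ltnP => [jk'|kj].
    by rewrite (max_idPl (hd _ _ jk' kN)).
  have kj' : (k < j)%N by rewrite ltn_neqAle eq_sym jk.
  by rewrite opprB (max_idPl (hd _ _ kj' (ltn_ord j))) opprB.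
- exact: densE.
- by rewrite densE ?cyclic_pred_lt//; case: (k).
Qed.

End truncated_field.

Section congruence.
Context {R : realType}.
Variables (L cL : R) (N : nat) (x y : nat -> R -> R) (t s : R).
Hypotheses (N0 : (0 < N)%N) (xy : forall j, (j < N)%N -> x j t = y j s).

Lemma eq_x_next k : (k < N)%N -> x_next L N x k t = x_next L N y k s.
Proof.
by move=> kN; rewrite /x_next; case: eqP => [_|/eqP h]; rewrite xy// ltn_neqAle h.
Qed.

Lemma eq_dens k : (k < N)%N -> dens cL L N x k t = dens cL L N y k s.
Proof. by move=> kN; rewrite /dens eq_x_next// xy. Qed.

Lemma eq_velocity (dK phi : R -> R) k : (k < N)%N ->
  velocity dK phi cL L N x k t = velocity dK phi cL L N y k s.
Proof.
move=> kN; rewrite /velocity eq_dens//; congr (_ * _ - _ * (_ - phi _)).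
  by apply: eq_bigr => j _; rewrite !xy.
by case: k kN => [|k] kN /=; rewrite eq_dens ?ltn_predL// ltnW.
Qed.
End congruence.

(* [D] is the dissipation; [C] will not depend on [N]. *)
Definition scheme_bounds {R : realType} (phi : R -> R) (L cL T C : R) (N : nat) (y : nat -> R -> R) (D : R -> R) : Prop :=
  [/\ (forall k, (k < N)%N -> continuous (y k)),
      (forall t k, (k < N)%N -> y k t < x_next L N y k t),
      continuous D /\ (forall t, 0 <= D t),
      (\int[@lebesgue_measure R]_(t in `[0%R, T]) (D t)%:E <= C%:E)%E &
      (forall t, \sum_(k < N) `|phi (dens cL L N y k t) - phi (dens_prev cL L N y k t)| <= D t + C) /\
      (forall lam s t : R, 0 < lam -> 0 <= s -> s <= t -> t <= T ->
         cL / N%:R * \sum_(k < N) `|y k t - y k s| <= lam * C + (t - s) / lam)].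

(** * Existence, and bounds uniform in N *)

Section particle_scheme.
Context {R : realType}.
Variables (K dK ddK W phi dphi : R -> R) (c2 rhobar MK MdK Mdd : R).
Hypotheses (Keven : forall z, K z = K `|z|) (Kcont : continuous K)
  (KdK : forall z : R, z != 0 -> is_derive z 1 K (dK z))
  (ddKd : forall z : R, z != 0 -> is_derive z 1 dK (ddK z))
  (KM : forall z, `|K z| <= MK)
  (dKM : forall z : R, z != 0 -> `|dK z| <= MdK)
  (ddKM : forall z : R, z != 0 -> `|ddK z| <= Mdd).
Hypotheses (Wnn : forall r : R, 0 <= r -> 0 <= W r)
  (phidef : forall r : R, 0 < r -> derivable W r 1 /\ phi r = r * derive1 W r - W r)
  (phi_0 : phi 0 = 0)
  (phider : forall r : R, 0 < r -> is_derive r 1 phi (dphi r))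
  (phider0 : (h^-1 * (phi h - phi 0)) @[h --> (0 : R)^'+] --> dphi 0)
  (dphicont : {within `[0, +oo[, continuous dphi})
  (phiincr : forall a b, 0 <= a -> a < b -> phi a < phi b)
  (c2_0 : 0 < c2) (rhobar1 : 1 < rhobar)
  (phi4 : forall r : R, rhobar <= r -> phi r >= c2 * r).
Variables (rho0 : R -> R) (L T M : R).
Hypotheses (L0 : 0 < L) (T0 : 0 < T) (M0 : 0 < M).
Hypotheses (rho_ge0 : forall x : R, 0 <= rho0 x)
  (rho_L1 : (@lebesgue_measure R).-integrable setT (EFin \o rho0))
  (rho_M : {ae @lebesgue_measure R, forall x, `|rho0 x| <= M})
  (rho_mass : (\int[@lebesgue_measure R]_x (rho0 x)%:E = 1)%E).

Local Notation cL := (massL rho0 L).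
Hypothesis c0 : 0 < cL.

Let w := specific_energy W.
Let MK0 : 0 <= MK. Proof. exact: le_trans (normr_ge0 _) (KM 0). Qed.
Let w0 : 0 <= w M. Proof. by apply: specific_energy_ge0 => //; exact: ltW. Qed.
Let c1 : cL <= 1. Proof. exact: (massL_le1 L0 M0). Qed.
Let E0 : R := cL ^+ 2 / 2 * MK + cL * w M.

(** Gaps of at least c/(N M) mean initial densities of at most M, so the initial energy is bounded
    independently of N. *)
Lemma initial_config N (x : nat -> R -> R) : (0 < N)%N ->
  (forall k, (k < N)%N -> x k 0 = x_init rho0 L N k) ->
  (forall k, (k < N)%N -> cL / (N%:R * M) <= x_next L N x k 0 - x k 0) /\
  energy K W L cL N x 0 <= E0.
Proof.
move=> N0 x0; have NR : 0 < N%:R :> R by rewrite ltr0n.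
have g k : (k < N)%N -> cL / (N%:R * M) <= x_next L N x k 0 - x k 0.
  move=> kN; have := x_init_gap L0 N0 M0 rho_ge0 rho_L1 rho_M c0 kN.
  by rewrite /x_next; case: eqP => [_|/eqP h]; rewrite !x0// ltn_neqAle h.
have q0 : 0 < cL / (N%:R * M) by rewrite divr_gt0// mulr_gt0.
split => //; apply: (energy_le c0 N0 KM phidef phi_0 phiincr) => // k kN.
  by rewrite -subr_gt0 (lt_le_trans q0)// g.
have g0 : 0 < x_next L N x k 0 - x k 0 by rewrite (lt_le_trans q0)// g.
rewrite /dens ler_pdivrMr ?mulr_gt0// mulrCA -ler_pdivrMl// mulrC.
have := g k kN; rewrite invfM mulrA => h.
by rewrite -ler_pdivrMl// [leLHS]mulrC.
Qed.

Lemma threshold N : (0 < N)%N -> exists delta,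
  gap_threshold W cL N MK E0 delta /\ delta < cL / (N%:R * M).
Proof.
move=> N0; apply: (gap_threshold_exists _ c0 N0 phidef c2_0 rhobar1 phi4).
by rewrite divr_gt0// mulr_gt0// ltr0n.
Qed.

(** The truncated system is solved on all of [0, T]; the barrier keeps its gaps above [delta], where
    the truncated and the true field agree. *)
Lemma particle_sol_exists N : (0 < N)%N -> exists x, particle_sol dK phi rho0 L T N x.
Proof.
move=> N0; have NR : 0 < N%:R :> R by rewrite ltr0n.
have [delta [hdelta dq]] := threshold N0; have [d0 _] := hdelta.
have B0 : 0 <= cL / (N%:R * delta) by rewrite divr_ge0 ?mulr_ge0// ltW.
have [Mphi Mphi0 philip] := phi_lipschitz phi_0 phider phider0 dphicont B0.
have [Lam Lam0 FL] := trunc_velocity_lipschitz L c0 N0 d0 ddKd ddKM Mphi0 philip.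
have [u hu] := lipschitz_ode_exists (x_init rho0 L N) Lam0 (ltW T0) FL.
have cu k : (k < N)%N -> continuous (u k) by move=> kN; have [] := hu k kN.
have [g0 Eu] := initial_config N0 (fun k kN => let: And3 h _ _ := hu k kN in h).
have gaps := gaps_stay c0 N0 Keven Kcont KdK KM Wnn phidef phi_0 phiincr cu (ltW T0) hdelta.
have {}gaps : forall t : R, 0 <= t <= T -> forall k, (k < N)%N -> delta < x_next L N u k t - u k t.
  apply: gaps => //.
  - move=> t tT hg k kN; have [_ _ /(_ t tT)] := hu k kN.
    by rewrite (trunc_velocityE dK phi _ N0 d0 hg kN).
  - by move=> k kN; apply: lt_le_trans (g0 k kN).
exists u => k kN; have [h1 h2 h3] := hu k kN; split => //.
- exact: continuous_subspaceT.
- move=> t tT; have tI : 0 <= t <= T by case/andP: tT => /ltW -> /ltW ->.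
  rewrite -(trunc_velocityE dK phi _ N0 d0 _ kN); first exact: h3.
  by move=> l lN; apply/ltW/gaps.
- by move=> t tT; rewrite -subr_ge0 (le_trans (ltW d0))// ltW// gaps.
Qed.

Let CE : R := MK + w M.
Definition scheme_const : R := CE + 1 + `|MdK|.

Lemma particle_sol_bounds N x : (0 < N)%N -> particle_sol dK phi rho0 L T N x ->
  exists y D, scheme_bounds phi L cL T scheme_const N y D /\
    forall k t, (k < N)%N -> 0 <= t <= T -> y k t = x k t.
Proof.
move=> N0 sol; have NR : 0 < N%:R :> R by rewrite ltr0n.
pose y k := x k \o clamp 0 T.
have yx k t : 0 <= t <= T -> y k t = x k t by move=> tT; rewrite /y /= clamp_id.
have cy k : (k < N)%N -> continuous (y k).
  by move=> kN; have [_ h _ _] := sol k kN; apply: comp_clamp_continuous => //; exact: ltW.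
have dy (t : R) : 0 < t < T -> forall k, (k < N)%N -> is_derive t 1 (y k) (velocity dK phi cL L N y k t).
  move=> tT k kN; have [_ _ /(_ t tT) h _] := sol k kN.
  have tI : 0 <= t <= T by case/andP: tT => /ltW -> /ltW ->.
  rewrite (@eq_velocity _ L _ _ y x t t)// => [|j jN]; last exact: yx.
  by apply: is_derive_near h; apply: filterS (near_clamp_id tT) => s /= hs; rewrite /y /= hs.
have y0 k : (k < N)%N -> y k 0 = x_init rho0 L N k.
  by move=> kN; rewrite yx ?lexx ?(ltW T0)//; have [] := sol k kN.
have [g0 Ey] := initial_config N0 y0.
have [delta [hdelta dq]] := threshold N0; have [d0 _] := hdelta.
have gaps : forall t : R, 0 <= t <= T -> forall k, (k < N)%N -> delta < x_next L N y k t - y k t.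
  apply: (gaps_stay c0 N0 Keven Kcont KdK KM Wnn phidef phi_0 phiincr cy (ltW T0) hdelta (dK := dK)) => //.
  - by move=> t tT _; exact: dy.
  - by move=> k kN; apply: lt_le_trans (g0 k kN).
have hy t k : (k < N)%N -> y k t < x_next L N y k t.
  move=> kN; have ct := clamp_itv t (ltW T0).
  have e j : y j t = y j (clamp 0 T t) by rewrite /y /= (clamp_id ct).
  rewrite (@eq_x_next _ L _ y y t (clamp 0 T t))// e.
  by rewrite -subr_gt0 (lt_trans d0)// gaps.
have dKc (z : R) : z != 0 -> {for z, continuous dK} by move=> z0; exact: is_derive_continuous (ddKd z0).
have phic (r : R) : 0 < r -> {for r, continuous phi} by move=> r0; exact: is_derive_continuous (phider r0).
have Ege t : - (cL ^+ 2 / 2 * MK) <= energy K W L cL N y t by apply: energy_ge => //; exact: hy.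
have cE : cL ^+ 2 / 2 * MK + E0 <= CE.
  have cc : cL ^+ 2 <= 1 by rewrite expr_le1// ltW.
  rewrite /E0 /CE; have h1 : cL ^+ 2 * MK <= 1 * MK by rewrite ler_wpM2r.
  have h2 : cL * w M <= 1 * w M by rewrite ler_wpM2r.
  lra.
have CE0 : 0 <= CE by rewrite addr_ge0.
have Cs : CE <= scheme_const by rewrite /scheme_const; have := normr_ge0 MdK; lra.
have MdK0 : 0 <= MdK by exact: le_trans (normr_ge0 _) (dKM (oner_neq0 R)).
exists y, (dissipation dK phi L cL N y); split; last by move=> k t _; exact: yx.
split => //.
- split; first exact: (dissipation_continuous c0 N0 cy dKc phic hy).
  by move=> t; exact: (dissipation_ge0 _ _ _ _ c0).
- rewrite (integral_dissipation c0 N0 Keven Kcont KdK phidef cy T0 dKc phic hy dy) lee_fin.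
  by apply: le_trans Cs; have := Ege T; lra.
- split.
    move=> t; apply: le_trans (total_jump_le phi c0 N0 dKM hy t) _.
    rewrite lerD2l /scheme_const ger0_norm//.
    have cc : cL ^+ 2 <= 1 by rewrite expr_le1// ltW.
    have h1 : cL ^+ 2 * MdK <= MdK by rewrite -[leRHS]mul1r ler_wpM2r.
    by apply: lerD => //; apply: le_trans c1 _; rewrite lerDr.
  move=> lam s t lam0 s0 st tT.
  apply: le_trans (displacement_le c0 N0 Keven Kcont KdK phidef cy hy dy lam0 s0 st tT) _.
  apply: lerD.
    rewrite ler_pM2l//; apply: le_trans Cs; have := Ege t.
    have Es : energy K W L cL N y s <= energy K W L cL N y 0.
      apply: (@nonincreasing_of_derive _ (energy K W L cL N y) (fun r => - dissipation dK phi L cL N y r) _ _ s0).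
      - by apply: continuous_subspaceT => r; apply: (energy_continuous c0 N0 Kcont phidef cy); exact: hy.
      - move=> r /andP[r0 rs]; apply: (energy_derive_dissipation c0 N0 Keven KdK phidef hy dy).
        by rewrite r0 (lt_le_trans rs)// (le_trans st).
      - by move=> r _; rewrite oppr_le0; apply: (dissipation_ge0 _ _ _ _ c0).
    lra.
  rewrite invfM mulrACA -[leRHS]mul1r ler_wpM2r ?divr_ge0 ?subr_ge0 ?(ltW lam0)//.
  by rewrite ler_pdivrMr// mul1r (le_trans c1)// ler1n.
Qed.

End particle_scheme.

(** * Compactness *)

Definition step_dens {R : realType} (L cL : R) (N : nat) (x : nat -> R -> R) (z : R * R) : R :=
  \sum_(k < N) dens cL L N x k z.1 * torus_indic L (x k z.1) (x_next L N x k z.1) z.2.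

(** * Bounds on the step densities and their mollifications *)

Section step_densities.
Context {R : realType}.
Variables (L cL : R) (N : nat) (x : nat -> R -> R) (t : R).
Hypotheses (L0 : 0 < L) (c0 : 0 < cL) (N0 : (0 < N)%N).
Hypothesis hx : forall k, (k < N)%N -> x k t < x_next L N x k t.

Lemma step_dens_itv Rb y : (forall k, (k < N)%N -> dens cL L N x k t <= Rb) ->
  0 <= step_dens L cL N x (t, y) <= Rb.
Proof.
move=> dR; have [k [m [kN ym]]] := locate x t L0 N0 y.
rewrite /step_dens /= (torus_dens_at cL L0 N0 hx kN ym) cell_dens_lt// dR// andbT.
exact/ltW/dens_gt0.
Qed.

(** The N gaps sum to L, so one of them is at least L/N. *)
Lemma dens_min_le : exists k, (k < N)%N /\ dens cL L N x k t <= cL / L.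
Proof.
have NR : 0 < N%:R :> R by rewrite ltr0n.
apply: contrapT => hn.
have gap k : (k < N)%N -> x_next L N x k t - x k t < L / N%:R.
  move=> kN; have g0 : 0 < x_next L N x k t - x k t by rewrite subr_gt0 hx.
  rewrite ltNge; apply/negP => h; apply: hn; exists k; split => //.
  rewrite /dens ler_pM2l// lef_pV2 ?posrE ?mulr_gt0//.
  by rewrite mulrC -ler_pdivrMr.
have := sum_gaps L x t N0 0; apply/eqP; rewrite lt_eqF//.
apply: (@lt_le_trans _ _ (\sum_(i < N) (L / N%:R))).
  case: N N0 gap => // n _ gap; apply: ltr_sum => [|i _]; last first.
    by rewrite add0n -x_next_unrolled// unrolled_lt// gap.
  by apply/hasP; exists ord0; rewrite ?mem_index_enum.
by rewrite sumr_const card_ord -[leLHS]mulr_natr divfK ?lt0r_neq0.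
Qed.

Lemma jump_telescope (phi : R -> R) a b : (a < N)%N -> (b < N)%N ->
  `|phi (dens cL L N x b t) - phi (dens cL L N x a t)| <=
  \sum_(k < N) `|phi (dens cL L N x k t) - phi (dens_prev cL L N x k t)|.
Proof.
wlog ab : a b / (a <= b)%N => [hw aN bN|aN bN].
  have [/hw|/ltnW/hw] := leqP a b; first exact.
  by rewrite distrC; apply.
apply: (le_trans (ler_telescope (fun k => phi (dens cL L N x k t)) ab)).
case: N aN bN => // n _ bn; rewrite big_ord_recl /= -[leLHS]add0r lerD//.
rewrite -(big_mkord xpredT (fun l => `|phi (dens cL L n.+1 x l.+1 t) - phi (dens cL L n.+1 x l t)|)).
rewrite [leRHS](big_cat_nat (leq0n b) bn)/= (big_cat_nat (leq0n a) ab)/= -addrA addrCA lerDl.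
by rewrite addr_ge0// sumr_ge0.
Qed.

(** Some density is at most c/L, and the jumps bound the oscillation of phi(rho) from there; phi(r)
    >= c2 r turns this into a bound on the density. *)
Lemma dens_le_of_jumps (phi : R -> R) (c2 rhobar A : R) k : 0 < c2 ->
  (forall a b, 0 <= a -> a < b -> phi a < phi b) ->
  (forall r : R, rhobar <= r -> c2 * r <= phi r) ->
  \sum_(k < N) `|phi (dens cL L N x k t) - phi (dens_prev cL L N x k t)| <= A ->
  (k < N)%N -> dens cL L N x k t <= Num.max rhobar ((phi (cL / L) + A) / c2).
Proof.
move=> c20 phiincr phi4 jA kN; rewrite le_max; have [//|/ltW rk /=] := leP.
have [j [jN dj]] := dens_min_le.
rewrite ler_pdivlMr// mulrC (le_trans (phi4 _ rk))//.
have := le_trans (ler_norm _) (le_trans (jump_telescope phi jN kN) jA); rewrite lerBlDl => /le_trans; apply.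
rewrite lerD2r; move: dj; rewrite le_eqVlt => /predU1P[-> //|dj].
by apply/ltW/phiincr => //; apply/ltW/dens_gt0.
Qed.

End step_densities.

Section smoothing.
Context {R : realType}.
Variables (L cL : R) (N : nat) (x : nat -> R -> R) (psi : R -> R) (Lip : R).
Hypotheses (L0 : 0 < L) (c0 : 0 < cL) (N0 : (0 < N)%N).
Hypothesis psi_lip : forall a b : R, `|psi a - psi b| <= Lip * `|a - b|.

Lemma lip_ge0 : 0 <= Lip.
Proof. by have := le_trans (normr_ge0 _) (psi_lip 1 0); rewrite subr0 normr1 mulr1. Qed.

Lemma smoothed_dens_lip (t s y z : R) :
  `|smoothed_dens cL N x t psi y - smoothed_dens cL N x s psi z| <=
  Lip * (cL / N%:R * (\sum_(k < N) `|x k t - x k s|) + cL * `|y - z|).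
Proof.
have NR : 0 < N%:R :> R by rewrite ltr0n.
rewrite /smoothed_dens -mulrBr -sumrB normrM ger0_norm ?divr_ge0 ?(ltW c0) ?(ltW NR)//.
have -> : cL * `|y - z| = cL / N%:R * \sum_(k < N) `|y - z|.
  by rewrite sumr_const card_ord -[in RHS]mulr_natr; field; rewrite lt0r_neq0.
rewrite -mulrDr mulrCA ler_pM2l ?divr_gt0//; apply: le_trans (ler_norm_sum _ _ _) _.
rewrite -big_split /= mulr_sumr ler_sum// => k _.
apply: (le_trans (psi_lip _ _)); rewrite ler_wpM2l ?lip_ge0//.
rewrite (_ : _ - _ - _ = (x k t - x k s) - (y - z)); last by ring.
exact: ler_normB.
Qed.

Lemma smoothed_dens_bound (t y : R) : (forall z, 0 <= psi z) -> (forall z, psi (z + L) = psi z) ->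
  `|smoothed_dens cL N x t psi y| <= cL * (psi 0 + Lip * L).
Proof.
move=> psi0 psiL; have NR : 0 < N%:R :> R by rewrite ltr0n.
rewrite ger0_norm; last by rewrite mulr_ge0 ?divr_ge0 ?(ltW c0)//; apply: sumr_ge0.
have -> : cL * (psi 0 + Lip * L) = cL / N%:R * \sum_(k < N) (psi 0 + Lip * L).
  by rewrite sumr_const card_ord -[in RHS]mulr_natr; field; rewrite lt0r_neq0.
rewrite ler_pM2l ?divr_gt0// ler_sum// => k _.
have [m /andP[m1 m2]] := torus_floor 0 (x k t - y) L0.
rewrite -(psi_per_int psiL _ m) -lerBlDl (le_trans (ler_norm _))//.
rewrite (le_trans (psi_lip _ _))// ler_wpM2l ?lip_ge0// subr0 ger0_norm//.
by rewrite ltW// -[L in ltRHS]add0r.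
Qed.
End smoothing.

(** * Pointwise comparison of two approximations *)

Section comparison.
Context {R : realType}.
Variables (phi : R -> R) (c2 rhobar L cL C A eta delta h Lip : R) (psi H : R -> R).
Hypotheses (L0 : 0 < L) (c0 : 0 < cL) (C0 : 0 < C) (A0 : 0 < A) (eta0 : 0 < eta)
  (delta0 : 0 < delta).
Hypotheses (phiincr : forall a b, 0 <= a -> a < b -> phi a < phi b)
  (c20 : 0 < c2) (rhobar1 : 1 < rhobar)
  (phi4 : forall r : R, rhobar <= r -> c2 * r <= phi r).
Hypotheses (psi_lip : forall a b, `|psi a - psi b| <= Lip * `|a - b|)
  (psi_ge0 : forall z, 0 <= psi z) (psi_per : forall z, psi (z + L) = psi z)
  (psi_supp : forall z, h <= z <= L - h -> psi z = 0)
  (H_der : forall z : R, is_derive z 1 H (psi z)) (H_per : forall z, H (z + L) = H z + 1).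

Definition dens_cap : R := Num.max rhobar ((phi (cL / L) + (A + C)) / c2).

Hypothesis modulus : forall a b, 0 <= a <= dens_cap -> 0 <= b <= dens_cap ->
  `|phi a - phi b| < delta -> `|a - b| <= eta.

Lemma dens_cap_gt0 : 0 < dens_cap.
Proof. by rewrite lt_max (lt_trans _ rhobar1). Qed.

Lemma jump_sum_ge0 N x t y : 0 <= jump_sum L cL N x t h phi y.
Proof. by apply: sumr_ge0 => k _; rewrite mulr_ge0// torus_indic_ge0. Qed.

Let jumps N x t := \sum_(k < N) `|phi (dens cL L N x k t) - phi (dens_prev cL L N x k t)|.

(* Three cases: all densities are bounded and few jumps are near [y], so that both densities are
   close to their mollifications; the jumps near [y] are large; the dissipation is large. *)
Lemma step_dens_compare N1 N2 x1 x2 (t y D1 D2 : R) : (0 < N1)%N -> (0 < N2)%N ->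
  (forall k, (k < N1)%N -> x1 k t < x_next L N1 x1 k t) ->
  (forall k, (k < N2)%N -> x2 k t < x_next L N2 x2 k t) ->
  0 <= D1 -> 0 <= D2 -> jumps N1 x1 t <= D1 + C -> jumps N2 x2 t <= D2 + C ->
  Lip * L * cL / N1%:R <= eta / 2 -> Lip * L * cL / N2%:R <= eta / 2 ->
  `|smoothed_dens cL N1 x1 t psi y - smoothed_dens cL N2 x2 t psi y| <= 2 * eta ->
  `|step_dens L cL N1 x1 (t, y) - step_dens L cL N2 x2 (t, y)| <=
  5 * eta + dens_cap / delta * (jump_sum L cL N1 x1 t h phi y + jump_sum L cL N2 x2 t h phi y)
  + (D1 + D2) / A * (step_dens L cL N1 x1 (t, y) + step_dens L cL N2 x2 (t, y)).
Proof.
move=> N10 N20 hx1 hx2 D10 D20 j1 j2 l1 l2 SS.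
have V1 := jump_sum_ge0 N1 x1 t y; have V2 := jump_sum_ge0 N2 x2 t y.
have r0 N x : (0 < N)%N -> (forall k, (k < N)%N -> x k t < x_next L N x k t) ->
    0 <= step_dens L cL N x (t, y).
  move=> N0 hx; apply: sumr_ge0 => k _; rewrite mulr_ge0 ?torus_indic_ge0//.
  exact/ltW/dens_gt0.
have r1 := r0 _ _ N10 hx1; have r2 := r0 _ _ N20 hx2.
have capD : 0 <= dens_cap / delta by rewrite divr_ge0// ltW// dens_cap_gt0.
set V := _ + jump_sum _ _ _ _ _ _ _ _; have V0 : 0 <= V by rewrite addr_ge0.
set r := step_dens L cL N1 x1 (t, y) + step_dens L cL N2 x2 (t, y); have rge0 : 0 <= r by rewrite addr_ge0.
have t1 : 0 <= dens_cap / delta * V by rewrite mulr_ge0.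
have t2 : 0 <= (D1 + D2) / A * r by rewrite mulr_ge0// divr_ge0 ?addr_ge0// ltW.
have e0 : 0 <= 5 * eta by rewrite mulr_ge0// ltW.
have [DA|DA] := ltP A (D1 + D2).
  apply: (@le_trans _ _ ((D1 + D2) / A * r)); last by rewrite lerDr addr_ge0.
  apply: (@le_trans _ _ r).
    by rewrite (le_trans (ler_normB _ _))// !ger0_norm.
  by rewrite -[leLHS]mul1r ler_wpM2r// ler_pdivlMr// mul1r ltW.
have cap N x D : (0 < N)%N -> (forall k, (k < N)%N -> x k t < x_next L N x k t) ->
    jumps N x t <= D + C -> D <= A ->
    forall k, (k < N)%N -> dens cL L N x k t <= dens_cap.
  move=> N0 hx jN DN k kN; apply: dens_le_of_jumps => //.
  by apply: (le_trans jN); rewrite lerD2r.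
have cap1 := cap _ _ _ N10 hx1 j1 (le_trans (ler_wpDr D20 (lexx _)) DA).
have cap2 := cap _ _ _ N20 hx2 j2 (le_trans (ler_wpDl D10 (lexx _)) DA).
have [VD|VD] := leP delta V.
  apply: (@le_trans _ _ (dens_cap / delta * V)); last first.
    by rewrite -[leLHS]addr0 lerD// lerDr.
  apply: (@le_trans _ _ dens_cap).
    have /andP[_ i1] := step_dens_itv L0 c0 N10 hx1 y cap1.
    have /andP[_ i2] := step_dens_itv L0 c0 N20 hx2 y cap2.
    by rewrite ler_norml; lra.
  by rewrite -mulrA ler_peMr ?(ltW dens_cap_gt0)// mulrC ler_pdivlMr// mul1r.
(* 2 eta from the mollified densities and 3 eta/2 from each mollification: eta from the modulus,
   eta/2 from the Riemann sum. *)
apply: (@le_trans _ _ (5 * eta)); last by rewrite -addrA lerDl addr_ge0.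
have h1 := smoothed_dens_near L0 c0 N10 hx1 psi_lip psi_ge0 psi_per psi_supp H_der H_per cap1 modulus
  (le_lt_trans (ler_wpDr V2 (lexx _)) VD).
have h2 := smoothed_dens_near L0 c0 N20 hx2 psi_lip psi_ge0 psi_per psi_supp H_der H_per cap2 modulus
  (le_lt_trans (ler_wpDl V1 (lexx _)) VD).
rewrite -/(step_dens L cL N1 x1 (t, y)) in h1.
rewrite -/(step_dens L cL N2 x2 (t, y)) in h2.
move: h1 h2 SS; rewrite /step_dens /=.
set S1 := smoothed_dens _ _ _ _ _ _; set S2 := smoothed_dens _ _ _ _ _ _.
set s1 := \sum_(i < N1) _; set s2 := \sum_(i < N2) _ => h1 h2 SS.
have -> : s1 - s2 = (S1 - S2) + ((S2 - s2) - (S1 - s1)) by ring.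
apply: (le_trans (ler_normD _ _)); have := ler_normB (S2 - s2) (S1 - s1); lra.
Qed.
End comparison.

Section integral_sum_bounds.
Context {R : realType} d (T : measurableType d) (m : measure T R) (E : set T).
Hypothesis mE : measurable E.

Lemma integral_sum_le (f : T -> R) n (g : 'I_n -> T -> R) (b : 'I_n -> R) :
  measurable_fun E f -> (forall i, measurable_fun E (g i)) ->
  (forall i z, E z -> 0 <= g i z) ->
  (forall i, (\int[m]_(z in E) (g i z)%:E <= (b i)%:E)%E) ->
  (forall z, E z -> `|f z| <= \sum_(i < n) g i z) ->
  (\int[m]_(z in E) `|f z|%:E <= (\sum_(i < n) b i)%:E)%E.
Proof.
move=> mf mg g0 gb fg.
apply: (@le_trans _ _ (\int[m]_(z in E) (\sum_(i < n) (g i z)%:E))%E).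
  apply: ge0_le_integral => //.
  - by apply/measurable_EFinP; exact: measurableT_comp.
  - by apply: emeasurable_sum => i; exact/measurable_EFinP.
  - by move=> z Ez; rewrite sumEFin lee_fin fg.
rewrite ge0_integral_sum//; last by move=> i; exact/measurable_EFinP.
by rewrite -sumEFin; apply: lee_sum => i _.
Qed.
End integral_sum_bounds.

(** * Space-time integrals of the error terms *)

Section integrated_comparison.
Context {R : realType}.
Local Notation mu := (@lebesgue_measure R).
Variables (phi : R -> R) (L cL T C : R).
Hypotheses (L0 : 0 < L) (c0 : 0 < cL) (c1 : cL <= 1) (T0 : 0 < T) (C0 : 0 < C).
Hypothesis phic : forall r : R, 0 < r -> {for r, continuous phi}.

Local Notation E := (`[0%R, T] `*` `[(- (L / 2))%R, (L / 2)%R[).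

Definition cell_sum n (a p q : 'I_n -> R -> R) (z : R * R) : R :=
  \sum_(i < n) a i z.1 * torus_indic L (p i z.1) (q i z.1) z.2.

Lemma measurable_cell_sum n (a p q : 'I_n -> R -> R) : (forall i, continuous (a i)) ->
  (forall i, continuous (p i)) -> (forall i, continuous (q i)) ->
  measurable_fun setT (cell_sum a p q).
Proof.
move=> ca cp cq.
have mc (f : R -> R) : continuous f -> measurable_fun setT (f \o fst : R * R -> R).
  by move=> cf; apply: measurableT_comp => //; exact: continuous_measurable_fun.
apply: measurable_sum => i; apply: measurable_funM; first exact: mc.
by apply: measurable_torus_cell; [exact: mc | exact: mc |].
Qed.

Lemma space_time_measure : (mu \x mu)%E E = (T * L)%:E.
Proof.
rewrite product_measure1E; [|exact: measurable_itv..].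
rewrite [X in (X * _)%E]lebesgue_measure_itv [X in (_ * X)%E]lebesgue_measure_itv /= !lte_fin T0.
rewrite ifT; last by rewrite gtrN// divr_gt0.
by rewrite -!EFinD -EFinM; congr (_%:E); field.
Qed.

Lemma measurable_space_time : measurable E.
Proof. by apply: measurableX; exact: measurable_itv. Qed.

Lemma integral_affine_le (D : R -> R) (b c d : R) : continuous D -> (forall t, 0 <= D t) ->
  (\int[mu]_(t in `[0%R, T]) (D t)%:E <= b%:E)%E -> 0 <= c -> 0 <= d ->
  (\int[mu]_(t in `[0%R, T]) (c * D t + d)%:E <= (c * b + d * T)%:E)%E.
Proof.
move=> cD D0 Db cc0 d0.
have mD : measurable_fun (`[0, T] : set R) (EFin \o D).
  by apply/measurable_EFinP/measurable_funTS; exact: continuous_measurable_fun.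
under eq_integral do rewrite EFinD EFinM.
rewrite ge0_integralD//; last 2 first.
- by move=> t _; rewrite mule_ge0// lee_fin.
- by apply: measurable_funeM.
rewrite ge0_integralZl//; last by move=> t _; rewrite lee_fin.
rewrite integral_cst//= lebesgue_measure_itv /= lte_fin T0 sube0 EFinD !EFinM.
by rewrite leeD2r// lee_wpmul2l// lee_fin.
Qed.

Lemma integral_continuous_le (f g : R -> R) : continuous f -> continuous g ->
  (forall t, 0 <= f t) -> (forall t, f t <= g t) ->
  (\int[mu]_(t in `[0%R, T]) (f t)%:E <= \int[mu]_(t in `[0%R, T]) (g t)%:E)%E.
Proof.
move=> cf cg f0 fg; apply: ge0_le_integral => //.
- by move=> t _; rewrite lee_fin.
- by apply/measurable_EFinP/measurable_funTS; exact: continuous_measurable_fun.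
- by apply/measurable_EFinP/measurable_funTS; exact: continuous_measurable_fun.
- by move=> t _; rewrite lee_fin.
Qed.

Lemma sum_continuous n (f : 'I_n -> R -> R) : (forall i, continuous (f i)) ->
  continuous (fun t => \sum_(i < n) f i t).
Proof.
move=> cf t; apply: cvg_big => [|i _]; last exact: cf.
by move=> p; exact: add_continuous.
Qed.

Lemma jump_continuous (x : nat -> R -> R) (D : R -> R) N k : (0 < N)%N -> (k < N)%N ->
  scheme_bounds phi L cL T C N x D ->
  continuous (fun t => `|phi (dens cL L N x k t) - phi (dens_prev cL L N x k t)|).
Proof.
move=> N0 kN [cx hx _ _ _] t.
have cphi l : (l < N)%N -> (fun s => phi (dens cL L N x l s)) @ t --> phi (dens cL L N x l t).
  move=> lN; apply: (@continuous_comp _ _ _ (dens cL L N x l) phi).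
    by apply: dens_continuous => //; exact: hx.
  by apply: phic; apply: dens_gt0 => // j jN; exact: hx.
apply: (@cvg_norm _ R^o); apply: cvgB; first exact: cphi.
have lN : ((if k is k'.+1 then k' else N.-1) < N)%N by exact: cyclic_pred_lt.
rewrite dens_prevE//; under eq_fun do rewrite dens_prevE//.
exact: cphi.
Qed.

Lemma measurable_jump_sum (x : nat -> R -> R) (D : R -> R) N h : (0 < N)%N ->
  scheme_bounds phi L cL T C N x D ->
  measurable_fun setT (fun z : R * R => jump_sum L cL N x z.1 h phi z.2).
Proof.
move=> N0 sb; have [cx _ _ _ _] := sb.
apply: (@measurable_cell_sum _ (fun k t => `|phi (dens cL L N x k t) - phi (dens_prev cL L N x k t)|)
  (fun k t => x k t - h) (fun k t => x k t + h)) => k.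
- exact: jump_continuous sb.
- by move=> t; apply: cvgB; [exact: cx|exact: cvg_cst].
- by move=> t; apply: cvgD; [exact: cx|exact: cvg_cst].
Qed.

Lemma measurable_step_dens (x : nat -> R -> R) (D : R -> R) N : (0 < N)%N ->
  scheme_bounds phi L cL T C N x D -> measurable_fun setT (step_dens L cL N x).
Proof.
move=> N0 [cx hx _ _ _].
apply: (@measurable_cell_sum _ (fun k => dens cL L N x k) (fun k => x k) (fun k => x_next L N x k)) => k.
- by move=> t; apply: dens_continuous => //; exact: hx.
- exact: cx.
- exact: x_next_continuous.
Qed.

(** Each interface marks an arc of length 2h, so the space integral of [jump_sum] is at most 2h
    (D(t) + C), and D has time integral at most C. *)
Lemma integral_jumps_le (x : nat -> R -> R) (D : R -> R) N h c : (0 < N)%N ->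
  0 < h -> h + h <= L -> 0 <= c ->
  scheme_bounds phi L cL T C N x D ->
  (\int[(mu \x mu)%E]_(z in E) (c * jump_sum L cL N x z.1 h phi z.2)%:E <=
   (c * (2 * h) * (C * (1 + T)))%:E)%E.
Proof.
move=> N0 h0 hL cc0 sb; have [cx hx [cD D0] DC [jD _]] := sb.
pose a (k : 'I_N) t := c * `|phi (dens cL L N x k t) - phi (dens_prev cL L N x k t)|.
have -> : (fun z : R * R => (c * jump_sum L cL N x z.1 h phi z.2)%:E) =
    (fun z => (cell_sum a (fun k t => x k t - h) (fun k t => x k t + h) z)%:E).
  apply/funext => z; rewrite /cell_sum /jump_sum mulr_sumr; congr (_%:E).
  by apply: eq_bigr => k _; rewrite mulrA.
have ca k : continuous (a k).
  by move=> t; apply: cvgM; [exact: cvg_cst|exact: jump_continuous sb _].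
have a0 k t : 0 <= a k t by rewrite mulr_ge0.
apply: (le_trans (integral_prod_torus_le _ L0 ca _ _ a0 _)).
- by move=> k t; apply: cvgB; [exact: cx|exact: cvg_cst].
- by move=> k t; apply: cvgD; [exact: cx|exact: cvg_cst].
- by move=> k t; lra.
have ch : 0 <= c * (2 * h) by rewrite mulr_ge0// mulr_ge0// ltW.
apply: (@le_trans _ _ (\int[mu]_(t in `[0%R, T]) (c * (2 * h) * D t + c * (2 * h) * C)%:E)%E); last first.
  apply: le_trans (integral_affine_le cD D0 DC ch (mulr_ge0 ch (ltW C0))) _.
  by rewrite lee_fin le_eqVlt; apply/orP; left; apply/eqP; ring.
have e t : \sum_(k < N) a k t * (x k t + h - (x k t - h)) = c * (2 * h) *
    \sum_(k < N) `|phi (dens cL L N x k t) - phi (dens_prev cL L N x k t)|.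
  by rewrite mulr_sumr; apply: eq_bigr => k _; rewrite /a; ring.
apply: integral_continuous_le.
- apply: sum_continuous => k t; apply: cvgM; first exact: ca.
  by apply: cvgB; [apply: cvgD|apply: cvgB]; try exact: cvg_cst; exact: cx.
- by move=> t; apply: cvgD; [apply: cvgM; [exact: cvg_cst|exact: cD]|exact: cvg_cst].
- by move=> t; rewrite e mulr_ge0// sumr_ge0.
- by move=> t; rewrite e -mulrDr ler_wpM2l.
Qed.

(** At each time rho_N has mass c_L <= 1, so a weight depending on time alone passes through the
    space integral. [D'] is not tied to [x]: it is the sum of two dissipations in [dist_le] and the
    constant 1 in [step_dens_integrable]. *)
Lemma integral_dissipated_mass_le (x : nat -> R -> R) (D D' : R -> R) N b c : (0 < N)%N -> 0 <= c ->
  continuous D' -> (forall t, 0 <= D' t) -> (\int[mu]_(t in `[0%R, T]) (D' t)%:E <= b%:E)%E ->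
  scheme_bounds phi L cL T C N x D ->
  (\int[(mu \x mu)%E]_(z in E) (c * D' z.1 * step_dens L cL N x z)%:E <= (c * b)%:E)%E.
Proof.
move=> N0 cc0 cD D0 Db [cx hx _ _ _]; have NR : 0 < N%:R :> R by rewrite ltr0n.
pose a (k : 'I_N) t := c * D' t * dens cL L N x k t.
have -> : (fun z : R * R => (c * D' z.1 * step_dens L cL N x z)%:E) =
    (fun z => (cell_sum a (fun k => x k) (fun k => x_next L N x k) z)%:E).
  apply/funext => z; rewrite /cell_sum /step_dens mulr_sumr; congr (_%:E).
  by apply: eq_bigr => k _; rewrite mulrA.
have ca k : continuous (a k).
  move=> t; apply: cvgM; first by apply: cvgM; [exact: cvg_cst|exact: cD].
  by apply: dens_continuous => //; exact: hx.
have a0 k t : 0 <= a k t.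
  apply: mulr_ge0; first by rewrite mulr_ge0.
  by apply/ltW; apply: dens_gt0 => // l lN; exact: hx.
apply: (le_trans (integral_prod_torus_le _ L0 ca _ _ a0 _)).
- by move=> k t; exact: cx.
- by move=> k t; exact: x_next_continuous.
- move=> k t; rewrite ltW ?hx//= x_next_unrolled// -(unrolled_lt L x t (ltn_ord k)) -unrolledDN//.
  by apply: unrolled_le => //; [move=> l; exact: hx|rewrite -addn1 leq_add2l].
have e t : \sum_(k < N) a k t * (x_next L N x k t - x k t) = c * cL * D' t.
  have dg (k : 'I_N) : dens cL L N x k t * (x_next L N x k t - x k t) = cL / N%:R.
    by rewrite -(cell_dens_gap cL N0 (hx t) k) x_next_unrolled// cell_dens_lt// (unrolled_lt L x t (ltn_ord k)).
  under eq_bigr => k _ do rewrite /a -mulrA dg.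
  by rewrite sumr_const card_ord -[LHS]mulr_natr; field; rewrite lt0r_neq0.
under eq_integral do rewrite e -[_ * _ * D' _]addr0.
apply: le_trans (integral_affine_le cD D0 Db (mulr_ge0 cc0 (ltW c0)) (lexx 0)) _.
rewrite mul0r addr0 lee_fin -mulrA ler_wpM2l// -[leRHS]mul1r ler_wpM2r//.
rewrite -lee_fin; apply: le_trans Db; apply: integral_ge0 => t _; rewrite lee_fin//.
Qed.

End integrated_comparison.

Lemma grid_point {R : realType} (a b t : R) (n : nat) : a < b -> a <= t <= b ->
  exists i, (i < n.+2)%N /\
    let s := a + (b - a) / n.+1%:R * i%:R in a <= s <= t /\ t - s <= (b - a) / n.+1%:R.
Proof.
move=> ab /andP[at_ tb]; have w0 : 0 < (b - a) / n.+1%:R by rewrite divr_gt0 ?subr_gt0.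
set w := _ / _ in w0 *.
have q0 : 0 <= (t - a) / w by rewrite divr_ge0 ?subr_ge0// ltW.
have /andP[h1 h2] := truncn_itv q0; set i := Num.truncn _ in h1 h2.
have h3 : i%:R * w <= t - a by rewrite -ler_pdivlMr.
have h4 : t - a < i.+1%:R * w by rewrite -ltr_pdivrMr.
exists i; split.
  have : i%:R <= n.+1%:R :> R.
    rewrite -(ler_pM2r w0) (le_trans h3)// /w mulrC divfK ?pnatr_eq0//.
    by rewrite lerD2r.
  by rewrite ler_nat ltnS.
split; first by rewrite lerDl mulr_ge0 ?(ltW w0)//= mulrC -lerBrDl.
by rewrite mulrC; move: h4; rewrite -natr1 mulrDl mul1r; lra.
Qed.

Section compactness.
Context {R : realType}.
Local Notation mu := (@lebesgue_measure R).
Variables (phi : R -> R) (c2 rhobar L cL T C : R).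
Hypotheses (L0 : 0 < L) (c0 : 0 < cL) (c1 : cL <= 1) (T0 : 0 < T) (C0 : 0 < C).
Hypotheses (phiincr : forall a b : R, 0 <= a -> a < b -> phi a < phi b)
  (phic : forall r : R, 0 < r -> {for r, continuous phi})
  (c20 : 0 < c2) (rhobar1 : 1 < rhobar)
  (phi4 : forall r : R, rhobar <= r -> c2 * r <= phi r).
Variables (y : nat -> nat -> R -> R) (D : nat -> R -> R).
Hypothesis sb : forall N, (0 < N)%N -> scheme_bounds phi L cL T C N (y N) (D N).

Local Notation E := (`[0%R, T] `*` `[(- (L / 2))%R, (L / 2)%R[).
Let rho N := step_dens L cL N (y N).
Let dist N M : \bar R := (\int[(mu \x mu)%E]_(z in E) `|rho N z - rho M z|%:E)%E.

Lemma dist_le (psi H : R -> R) (A eta delta h Lip : R) N M : (0 < N)%N -> (0 < M)%N ->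
  0 < A -> 0 < eta -> 0 < delta -> 0 < h -> h + h <= L ->
  (forall a b, `|psi a - psi b| <= Lip * `|a - b|) ->
  (forall z, 0 <= psi z) -> (forall z, psi (z + L) = psi z) ->
  (forall z, h <= z <= L - h -> psi z = 0) ->
  (forall z : R, is_derive z 1 H (psi z)) -> (forall z, H (z + L) = H z + 1) ->
  (forall a b : R, 0 <= a <= dens_cap phi c2 rhobar L cL C A -> 0 <= b <= dens_cap phi c2 rhobar L cL C A ->
    `|phi a - phi b| < delta -> `|a - b| <= eta) ->
  Lip * L * cL / N%:R <= eta / 2 -> Lip * L * cL / M%:R <= eta / 2 ->
  (forall t x : R, 0 <= t <= T -> - (L / 2) <= x <= L / 2 ->
    `|smoothed_dens cL N (y N) t psi x - smoothed_dens cL M (y M) t psi x| <= 2 * eta) ->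
  (dist N M <= (5 * eta * (T * L) +
    2 * (dens_cap phi c2 rhobar L cL C A / delta * (2 * h) * (C * (1 + T))) + 4 * C / A)%:E)%E.
Proof.
move=> N0 M0 A0 eta0 delta0 h0 hL psi_lip psi0 psi_per psi_supp Hd Hp modulus lN lM SS.
have sN := sb N0; have sM := sb M0.
have [_ hxN [cDN DN0] iDN [jN _]] := sN; have [_ hxM [cDM DM0] iDM [jM _]] := sM.
set cap := dens_cap _ _ _ _ _ _ _ in modulus *.
have cap0 : 0 < cap by exact: dens_cap_gt0.
have cd0 : 0 <= cap / delta by rewrite divr_ge0 ?(ltW cap0) ?(ltW delta0).
pose D2 t := D N t + D M t.
have D20 t : 0 <= D2 t by rewrite addr_ge0.
have cD2 : continuous D2 by move=> t; apply: cvgD; [exact: cDN|exact: cDM].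
have iD2 : (\int[mu]_(t in `[0%R, T]) (D2 t)%:E <= (C + C)%:E)%E.
  under eq_integral do rewrite EFinD.
  rewrite ge0_integralD//.
  - by rewrite EFinD leeD.
  - by move=> t _; rewrite lee_fin.
  - by apply/measurable_EFinP/measurable_funTS; exact: continuous_measurable_fun.
  - by move=> t _; rewrite lee_fin.
  - by apply/measurable_EFinP/measurable_funTS; exact: continuous_measurable_fun.
(* The terms of [step_dens_compare]: each density is weighted by the dissipation of both schemes,
   whence the bound C + C. *)
pose g (z : R * R) : 'I_5 -> R := fun i => nth 0 [:: 5 * eta;
  cap / delta * jump_sum L cL N (y N) z.1 h phi z.2;
  cap / delta * jump_sum L cL M (y M) z.1 h phi z.2;
  A^-1 * D2 z.1 * rho N z; A^-1 * D2 z.1 * rho M z] i.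
pose b : 'I_5 -> R := fun i => nth 0 [:: 5 * eta * (T * L);
  cap / delta * (2 * h) * (C * (1 + T)); cap / delta * (2 * h) * (C * (1 + T));
  A^-1 * (C + C); A^-1 * (C + C)] i.
have mrho K : (0 < K)%N -> measurable_fun setT (rho K).
  by move=> K0; exact: measurable_step_dens (sb K0).
have rho0 K z : (0 < K)%N -> 0 <= rho K z.
  move=> K0; have [_ hx _ _ _] := sb K0.
  apply: sumr_ge0 => i _; rewrite mulr_ge0 ?torus_indic_ge0//.
  by apply/ltW; apply: dens_gt0 => // k kK; exact: hx.
have A'0 : 0 <= A^-1 by rewrite invr_ge0 ltW.
have mD2 : measurable_fun setT (fun z : R * R => A^-1 * D2 z.1).
  apply: measurable_funM => //; apply: (measurableT_comp (f := D2)) => //.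
  exact: continuous_measurable_fun.
have -> : 5 * eta * (T * L) + 2 * (cap / delta * (2 * h) * (C * (1 + T))) + 4 * C / A =
    \sum_(i < 5) b i.
  by rewrite !big_ord_recl big_ord0 /b /=; field; rewrite !lt0r_neq0.
apply: (@integral_sum_le R _ _ (mu \x mu)%E _ (measurable_space_time L T) (fun z => rho N z - rho M z) _ (fun i z => g z i) b).
- by apply: measurable_funTS; apply: measurable_funB; exact: mrho.
- case=> [[|[|[|[|[|//]]]]] ?]; rewrite /g /=; apply: measurable_funTS.
  + by [].
  + by apply: measurable_funM => //; exact: measurable_jump_sum sN.
  + by apply: measurable_funM => //; exact: measurable_jump_sum sM.
  + by apply: measurable_funM => //; exact: mrho.
  + by apply: measurable_funM => //; exact: mrho.
- case=> [[|[|[|[|[|//]]]]] ?] z _; rewrite /g /=.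
  + by rewrite mulr_ge0// ltW.
  + by rewrite mulr_ge0// jump_sum_ge0.
  + by rewrite mulr_ge0// jump_sum_ge0.
  + by rewrite mulr_ge0 ?rho0// mulr_ge0.
  + by rewrite mulr_ge0 ?rho0// mulr_ge0.
- case=> [[|[|[|[|[|//]]]]] ?]; rewrite /g /b /=.
  + rewrite integral_cst; last exact: measurable_space_time.
    by rewrite /= space_time_measure// EFinM.
  + exact: integral_jumps_le sN.
  + exact: integral_jumps_le sM.
  + exact: integral_dissipated_mass_le sN.
  + exact: integral_dissipated_mass_le sM.
- move=> [t x] [/= tT xL].
  have tI : 0 <= t <= T by move: tT; rewrite in_itv.
  have xI : - (L / 2) <= x <= L / 2 by move: xL; rewrite in_itv /= => /andP[-> /ltW ->].
  apply: (le_trans (step_dens_compare L0 c0 A0 eta0 delta0 phiincr c20 rhobar1 phi4 psi_lip psi0 psi_per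
    psi_supp Hd Hp modulus N0 M0 (hxN t) (hxM t) (DN0 t) (DM0 t) (jN t) (jM t) lN lM (SS t x tI xI))).
  rewrite !big_ord_recl big_ord0 /g /= /rho -/cap le_eqVlt; apply/orP; left; apply/eqP.
  by rewrite /D2; ring.
Qed.
(** [lam] is fixed small first; the time step is then taken small compared with [lam]. *)
Lemma smoothed_dens_equicontinuous (psi : R -> R) (Lip lam : R) N (s t z x : R) :
  (0 < N)%N -> (forall a b, `|psi a - psi b| <= Lip * `|a - b|) -> 0 < lam ->
  0 <= s <= t -> t <= T -> z <= x ->
  `|smoothed_dens cL N (y N) t psi x - smoothed_dens cL N (y N) s psi z| <=
  Lip * (lam * C + (t - s) / lam + (x - z)).
Proof.
move=> N0 psi_lip lam0 /andP[s0 st] tT zx.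
have [_ _ _ _ [_ /(_ lam s t lam0 s0 st tT) disp]] := sb N0.
apply: (le_trans (smoothed_dens_lip (y N) c0 N0 psi_lip t s x z)).
rewrite ler_wpM2l ?(lip_ge0 psi_lip)// lerD// ger0_norm ?subr_ge0//.
by rewrite -[leRHS]mul1r ler_wpM2r ?subr_ge0.
Qed.

Definition grid_time n (i : nat) : R := 0 + (T - 0) / n.+1%:R * i%:R.
Definition grid_space n (j : nat) : R := - (L / 2) + (L / 2 - - (L / 2)) / n.+1%:R * j%:R.

Lemma smoothed_dens_grid (psi : R -> R) (Lip lam eta : R) n N M : (0 < N)%N -> (0 < M)%N ->
  (forall a b, `|psi a - psi b| <= Lip * `|a - b|) -> 0 < lam ->
  Lip * (lam * C + T / n.+1%:R / lam + L / n.+1%:R) <= eta / 2 ->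
  (forall i j, (i < n.+2)%N -> (j < n.+2)%N ->
    `|smoothed_dens cL N (y N) (grid_time n i) psi (grid_space n j) -
      smoothed_dens cL M (y M) (grid_time n i) psi (grid_space n j)| <= eta) ->
  forall t x : R, 0 <= t <= T -> - (L / 2) <= x <= L / 2 ->
    `|smoothed_dens cL N (y N) t psi x - smoothed_dens cL M (y M) t psi x| <= 2 * eta.
Proof.
move=> N0 M0 psi_lip lam0 small close t x tT xL.
have [i [iN [s1 s2]]] := grid_point n T0 tT; rewrite -/(grid_time n i) in s1 s2.
have LL : - (L / 2) < L / 2 by rewrite gtrN// divr_gt0.
have [j [jN [z1 z2]]] := grid_point n LL xL; rewrite -/(grid_space n j) in z1 z2.
move/(_ i j iN jN) : close; move: (grid_time n i) (grid_space n j) s1 s2 z1 z2.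
move=> s z s1 s2 /andP[_ zx] z2 close.
have near K : (0 < K)%N ->
    `|smoothed_dens cL K (y K) t psi x - smoothed_dens cL K (y K) s psi z| <= eta / 2.
  move=> K0; apply: le_trans small.
  have /andP[_ tT'] := tT.
  apply: le_trans (smoothed_dens_equicontinuous K0 psi_lip lam0 s1 tT' zx) _.
  rewrite ler_wpM2l ?(lip_ge0 psi_lip)// lerD//.
    by rewrite lerD2l ler_pM2r ?invr_gt0// (le_trans s2)// subr0.
  by rewrite (le_trans z2)// opprK -splitr.
have h1 := near N N0; have h2 := near M M0; move: h1 h2 close.
set a := smoothed_dens _ _ _ _ _ _; set b := smoothed_dens _ _ _ _ _ _.
set a' := smoothed_dens _ _ _ _ _ _; set b' := smoothed_dens _ _ _ _ _ _.
move=> h1 h2 h3; rewrite (_ : a - a' = (a - b) - (a' - b') + (b - b')); last by ring.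
by apply: (le_trans (ler_normD _ _)); have := ler_normB (a - b) (a' - b'); lra.
Qed.

(** Order of the choices: A fixes the cap, the cap and eta fix delta, delta fixes h and thus the
    bump and Lip; Lip fixes lam, then the mesh n, and the first index n1. *)
Lemma cauchy_condition (e : R) : 0 < e -> exists (n1 m : nat) (s : nat -> nat -> R) (B delta : R),
  [/\ 0 < delta, forall i n, (i < m)%N -> (n1 <= n)%N -> `|s i n| <= B
    & forall n n', (n1 <= n)%N -> (n1 <= n')%N ->
       (forall i, (i < m)%N -> `|s i n - s i n'| < delta) -> (dist n n' <= e%:E)%E].
Proof.
move=> e0.
(* Makes 4 C/A = e/3; [eta] and [h] below bound the other two terms of [dist_le] by e/3 each. *)
pose A := 12 * C / e; have A0 : 0 < A by rewrite divr_gt0// mulr_gt0.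
pose cap := dens_cap phi c2 rhobar L cL C A; have cap0 : 0 < cap by exact: dens_cap_gt0.
pose eta := e / (15 * (T * L)); have eta0 : 0 < eta by rewrite divr_gt0// !mulr_gt0.
have [delta delta0 modulus] := phi_modulus phiincr (ltW cap0) eta0.
have T1 : 0 < 1 + T by rewrite addr_gt0.
pose h := Num.min (L / 2) (e * delta / (12 * cap * (C * (1 + T)))).
have h0 : 0 < h by rewrite lt_min !divr_gt0// !mulr_gt0.
have hL : h + h <= L by rewrite [leRHS]splitr lerD// ge_min lexx.
have hV : h * (12 * cap * (C * (1 + T))) <= e * delta.
  by rewrite -ler_pdivlMr ?mulr_gt0// ge_min lexx orbT.
have [psi [H [Lip [psi_lip psi0 psi_per psi_supp [Hd Hp]]]]] := bump_exists L0 h0 hL.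
have Lip0 := lip_ge0 psi_lip.
have L1 : 0 < Lip + 1 by rewrite ltr_wpDl.
(* The term in lam C takes at most eta/4, and [n] leaves eta/4 for the mesh terms. Lip + 1 is used
   because only Lip >= 0 is known. *)
pose lam := eta / (4 * (Lip + 1) * C); have lam0 : 0 < lam by rewrite divr_gt0// !mulr_gt0.
pose n := Num.truncn (4 * (Lip + 1) * (T / lam + L) / eta).
have hn : 4 * (Lip + 1) * (T / lam + L) / eta < n.+1%:R by apply: truncnS_gt.
pose n1 := (Num.truncn (2 * (Lip * L * cL) / eta)).+1.
have hn1 : 2 * (Lip * L * cL) / eta < n1%:R by apply: truncnS_gt.
(* The samples are the values on the space-time grid, the pair (i, j) being encoded as i (n + 2) +
   j. *)
exists n1, (n.+2 * n.+2)%N, (fun i N => smoothed_dens cL N (y N) (grid_time n (i %/ n.+2)) psi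
  (grid_space n (i %% n.+2))), (cL * (psi 0 + Lip * L)), eta; split => //.
  move=> i N _ N1; apply: smoothed_dens_bound => //; exact: leq_trans N1.
move=> N M N1 M1 close.
have N0 : (0 < N)%N by apply: leq_trans N1.
have M0 : (0 < M)%N by apply: leq_trans M1.
have big K : (n1 <= K)%N -> Lip * L * cL / K%:R <= eta / 2.
  move=> K1; have KR : 0 < K%:R :> R by rewrite ltr0n (leq_trans _ K1).
  have : 2 * (Lip * L * cL) / eta <= K%:R by rewrite (le_trans (ltW hn1))// ler_nat.
  rewrite ler_pdivrMr// => hK; rewrite ler_pdivrMr//; lra.
apply: (le_trans (dist_le N0 M0 A0 eta0 delta0 h0 hL psi_lip psi0 psi_per psi_supp Hd Hp modulus
  (big N N1) (big M M1) _)).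
  apply: (smoothed_dens_grid N0 M0 psi_lip lam0 (n := n)).
    have w0 : 0 < n.+1%:R :> R by [].
    have -> : eta / 2 = (Lip + 1) * (lam * C) + eta / 4.
      by rewrite /lam; field; rewrite !lt0r_neq0.
    rewrite -addrA mulrDr lerD//.
      by rewrite ler_wpM2r ?lerDl// mulr_ge0// ltW.
    rewrite (_ : T / _ / _ + _ = (T / lam + L) / n.+1%:R); last by field; rewrite !lt0r_neq0.
    move: hn; rewrite ltr_pdivrMr// => hn.
    rewrite mulrA ler_pdivrMr// (le_trans (y := (Lip + 1) * (T / lam + L)))//.
      apply: ler_wpM2r; last by rewrite lerDl.
      by apply: addr_ge0; apply: ltW => //; exact: divr_gt0.
    lra.
  move=> i j iN jN; apply/ltW.
  have := close (i * n.+2 + j)%N; rewrite divnMDl// modnMDl divn_small// modn_small// addn0; apply.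
  apply: (@leq_trans (i.+1 * n.+2)); last by rewrite leq_mul2r iN orbT.
  by rewrite mulSn [leqRHS]addnC ltn_add2l.
rewrite lee_fin -/cap.
have -> : 5 * eta * (T * L) = e / 3 by rewrite /eta; field; rewrite !lt0r_neq0.
have -> : 4 * C / A = e / 3 by rewrite /A; field; rewrite !lt0r_neq0.
have -> : 2 * (cap / delta * (2 * h) * (C * (1 + T))) = h * (12 * cap * (C * (1 + T))) / (3 * delta).
  by field; rewrite lt0r_neq0.
have : h * (12 * cap * (C * (1 + T))) / (3 * delta) <= e / 3.
  by rewrite ler_pdivrMr ?mulr_gt0// (_ : e / 3 * _ = e * delta)//; field.
lra.
Qed.

Lemma step_dens_integrable N : (0 < N)%N ->
  (mu \x mu)%E.-integrable E (EFin \o rho N).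
Proof.
move=> N0; have mE := measurable_space_time L T.
have mr : measurable_fun E (rho N) by apply: measurable_funTS; exact: measurable_step_dens (sb N0).
apply/integrableP; split; first exact/measurable_EFinP.
have [_ hx _ _ _] := sb N0.
have rho0 z : 0 <= rho N z.
  apply: sumr_ge0 => i _; rewrite mulr_ge0 ?torus_indic_ge0//.
  by apply/ltW; apply: dens_gt0 => // k kN; exact: hx.
rewrite (_ : (fun z => `|_|%E) = (fun z => (1 * (fun=> 1) z.1 * rho N z)%:E)); last first.
  by apply/funext => z /=; rewrite ger0_norm// !mul1r.
have T1 : (\int[mu]_(t in `[0%R, T]) ((fun=> 1) t)%:E <= T%:E)%E.
  by rewrite integral_cst//= lebesgue_measure_itv /= lte_fin T0 sube0 mul1e.
have cst1 : continuous (fun _ : R => 1 : R) by exact: cst_continuous.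
apply: le_lt_trans (integral_dissipated_mass_le L0 c0 c1 T0 N0 ler01 cst1 (fun=> ler01) T1 (sb N0)) _.
by rewrite ltry.
Qed.

Lemma step_dens_compact : exists (sub : nat -> nat) (g : R * R -> R),
  [/\ forall n, (0 < sub n)%N, {homo sub : m n / (m < n)%N},
      (mu \x mu)%E.-integrable E (EFin \o g) &
      (\int[(mu \x mu)%E]_(z in E) `|rho (sub n) z - g z|%:E)%E @[n --> \oo] --> 0%E].
Proof.
have [sub [sub0 subS subd]] := cauchy_subsequence 1 cauchy_condition.
have mrho n : measurable_fun E (rho (sub n)).
  by apply: measurable_funTS; exact: measurable_step_dens (sb (sub0 n)).
have [g [ig cg]] := @L1_rapid_limit _ _ R (mu \x mu)%E _ (measurable_space_time L T) (fun n => rho (sub n)) mrho (step_dens_integrable (sub0 0)) subd.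
by exists sub, g.
Qed.
End compactness.

(** * The degenerate case of zero mass on [-L/2, L/2] *)

Section massless.
Context {R : realType}.
Variables (rho0 : R -> R) (L : R) (N : nat).
Hypotheses (L0 : 0 < L) (rho_ge0 : forall x : R, 0 <= rho0 x) (m0 : massL rho0 L = 0).

Lemma massless_dens x k t : dens (massL rho0 L) L N x k t = 0.
Proof. by rewrite /dens m0 mul0r. Qed.

Lemma massless_rhoN x z : rhoN rho0 L N x z = 0.
Proof. by rewrite /rhoN big1// => k _; rewrite massless_dens mul0r. Qed.

Lemma massless_velocity (dK phi : R -> R) x k t : velocity dK phi (massL rho0 L) L N x k t = 0.
Proof.
have -> : velocity dK phi (massL rho0 L) L N x k t =
    - (massL rho0 L / N%:R) * (\sum_(j < N | (j : nat) != k) dK (x k t - x j t))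
    - (N%:R / massL rho0 L) * (phi 0 - phi 0).
  by rewrite /velocity massless_dens; case: k => [|k] /=; rewrite massless_dens.
by rewrite subrr mulr0 m0 mul0r oppr0 mul0r addr0.
Qed.

(* The supremum defining [x_init] is then taken over the empty set, hence equal to [0]. *)
Lemma massless_x_init k : x_init rho0 L N k.+1 = 0.
Proof.
rewrite /= m0 mul0r (_ : [set _ | _] = set0) ?sup0//.
apply/seteqP; split => // x /=; apply/negP; rewrite -leNgt.
by apply: integral_ge0 => y _; rewrite lee_fin rho_ge0.
Qed.

(** With c = 0 all velocities vanish, so the initial configuration, x_0 = -L/2 and the others at 0,
    is stationary. *)
Lemma massless_particle_sol (dK phi : R -> R) T : 0 < T ->
  particle_sol dK phi rho0 L T N (fun k _ => x_init rho0 L N k).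
Proof.
move=> T0 k kN; split => //.
- by apply: continuous_subspaceT => t; exact: cvg_cst.
- by move=> t tT; rewrite massless_velocity; exact: is_derive_cst.
- move=> t _; rewrite /x_next.
  have xk : x_init rho0 L N k <= 0.
    by case: k {kN} => [|k]; rewrite ?massless_x_init//= oppr_le0 divr_ge0// ltW.
  case: eqP => _; rewrite ?massless_x_init// (le_trans xk)//=.
  by rewrite {2}[L]splitr addKr divr_ge0// ltW.
Qed.
End massless.

Theorem theorem5p2 (R : realType)
  (* the kernel K, with K' = dK and K'' = ddK on R \ {0} *)
  (K dK ddK : R -> R)
  (HKeven : forall z, K z = K `|z|)
  (HKcont : continuous K)
  (HdK : forall z : R, z != 0 -> is_derive z 1 K (dK z))
  (HddK : forall z : R, z != 0 -> is_derive z 1 dK (ddK z))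
  (HddKcont : forall z : R, z != 0 -> {for z, continuous ddK})
  (HKbd : exists M : R, forall z : R, `|K z| <= M)
  (HdKbd : exists M : R, forall z : R, z != 0 -> `|dK z| <= M)
  (HddKbd : exists M : R, forall z : R, z != 0 -> `|ddK z| <= M)
  (HdKL1 : (@lebesgue_measure R).-integrable setT (EFin \o dK))
  (* the internal energy W and phi(r) = r W'(r) - W(r), with phi' = dphi *)
  (W phi dphi : R -> R) (c0 c1 c2 rhohat rhobar : R)
  (HWnn : forall r : R, 0 <= r -> 0 <= W r)
  (Hphidef : forall r : R, 0 < r -> derivable W r 1 /\ phi r = r * derive1 W r - W r)
  (Hphi0 : phi 0 = 0)
  (Hphider : forall r : R, 0 < r -> is_derive r 1 phi (dphi r))
  (Hphider0 : (h^-1 * (phi h - phi 0)) @[h --> (0 : R)^'+] --> dphi 0)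
  (Hdphicont : {within `[0, +oo[, continuous dphi})
  (Hphiincr : forall a b, 0 <= a -> a < b -> phi a < phi b)
  (Hc0 : 0 < c0) (Hc1 : 0 < c1) (Hc2 : 0 < c2)
  (Hrhohat : rhohat < 1) (Hrhobar : 1 < rhobar)
  (Hphi1 : forall r : R, 0 <= r -> dphi r * r <= c0 * phi r)
  (Hphi2 : forall r : R, 0 <= r -> phi r <= Num.max r (c0 * W r))
  (Hphi3 : forall r : R, 0 <= r -> r <= rhohat -> phi r <= c1 * r)
  (Hphi4 : forall r : R, rhobar <= r -> phi r >= c2 * r)
  (* the initial datum *)
  (rho0 : R -> R)
  (Hrho0nn : forall x : R, 0 <= rho0 x)
  (Hrho0L1 : (@lebesgue_measure R).-integrable setT (EFin \o rho0))
  (Hrho0Linf : exists M : R, {ae @lebesgue_measure R, forall x, `|rho0 x| <= M})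
  (Hrho0mass : (\int[@lebesgue_measure R]_x (rho0 x)%:E = 1)%E)
  (HF : (Fenergy K W rho0 < +oo)%E)
  (L : R) (HL : 0 < L) :
  forall T : R, 0 < T ->
  exists N0 : nat,
    (* for N large the particle approximation is defined on [0,T] *)
    (forall N : nat, (N0 <= N)%N -> exists x, particle_sol dK phi rho0 L T N x) /\
    (* and any such family of approximations converges, up to a subsequence,
       in L^1([0,T] x T_L) *)
    (forall xs : nat -> nat -> R -> R,
       (forall N : nat, (N0 <= N)%N -> particle_sol dK phi rho0 L T N (xs N)) ->
       exists (sub : nat -> nat) (rhoL : R * R -> R),
         (forall n, (N0 <= sub n)%N) /\
         {homo sub : m n / (m < n)%N >-> (m < n)%N} /\
         (@lebesgue_measure R \x @lebesgue_measure R)%E.-integrable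
            (`[0, T] `*` `[- (L / 2), L / 2[) (EFin \o rhoL) /\
         (fun n => (\int[(@lebesgue_measure R \x @lebesgue_measure R)%E]_(z in
               (`[0, T] `*` `[- (L / 2), L / 2[)%R)
               (`|rhoN rho0 L (sub n) (xs (sub n)) z - rhoL z|)%:E)%E)
           @ \oo --> 0%E).
Proof.
have [MK KM] := HKbd; have [MdK dKM] := HdKbd; have [Mdd ddKM] := HddKbd.
have [M' rho_M'] := Hrho0Linf.
pose M : R := Num.max 1 M'; have M0 : 0 < M by rewrite lt_max ltr01.
have rho_M : {ae @lebesgue_measure R, forall x, `|rho0 x| <= M}.
  case: rho_M' => A [mA A0 sub]; exists A; split => // x hx; apply: sub => /= h; apply: hx.
  by rewrite /= /M le_max h orbT.
move=> T T0; exists 1%N.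
(* If the mass is 0, every [rhoN] is 0 and converges to 0. *)
have := massL_ge0 HL M0 Hrho0nn Hrho0L1 rho_M; rewrite le_eqVlt => /predU1P[/esym m0|cL0].
  split => [N _|xs _].
    by exists (fun k _ => x_init rho0 L N k); exact: massless_particle_sol.
  exists (fun n => n.+1), (fun=> 0); split => //; split => //; split.
    by rewrite (_ : EFin \o _ = cst 0%E)//; exact: integrable0.
  rewrite (_ : (fun n => _) = fun=> 0%E); first exact: cvg_cst.
  by apply/funext => n; rewrite integral0_eq// => z _; rewrite massless_rhoN// subrr normr0.
split => [N N0|xs sol].
  exact: (particle_sol_exists HKeven HKcont HdK HddK KM ddKM HWnn Hphidef Hphi0 Hphider
    Hphider0 Hdphicont Hphiincr Hc2 Hrhobar Hphi4 HL T0 M0 Hrho0nn Hrho0L1 rho_M cL0 N0).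
have cL1 : massL rho0 L <= 1 := massL_le1 HL M0 Hrho0nn Hrho0L1 rho_M Hrho0mass.
have phic (r : R) : 0 < r -> {for r, continuous phi}.
  by move=> r0; exact: is_derive_continuous (Hphider r r0).
pose C := scheme_const W MK MdK M.
have C0 : 0 < C.
  have MK0 : 0 <= MK := le_trans (normr_ge0 _) (KM 0).
  have w0 : 0 <= specific_energy W M by apply: specific_energy_ge0 => //; exact: ltW.
  by rewrite /C /scheme_const ltr_pwDl// ltr_wpDl// addr_ge0.
pose approximates N (yD : (nat -> R -> R) * (R -> R)) := (0 < N)%N ->
  scheme_bounds phi L (massL rho0 L) T C N yD.1 yD.2 /\
  forall k (t : R), (k < N)%N -> 0 <= t <= T -> yD.1 k t = xs N k t.
have /choice[yD hyD] : forall N, exists yD, approximates N yD.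
  move=> N.
  have [->|N0] := posnP N; first by exists (fun _ _ => 0, fun=> 0).
  have [y [D [yb yx]]] := particle_sol_bounds HKeven HKcont HdK HddK KM dKM HWnn Hphidef Hphi0 Hphider
    Hphiincr Hc2 Hrhobar Hphi4 HL T0 M0 Hrho0nn Hrho0L1 rho_M Hrho0mass cL0 N0 (sol N N0).
  by exists (y, D).
have [sub [g [sub0 subS ig cg]]] := step_dens_compact HL cL0 cL1 T0 C0 Hphiincr phic Hc2 Hrhobar
  Hphi4 (fun N N0 => (hyD N N0).1).
exists sub, g; split; [exact: sub0|split; [exact: subS|split; [exact: ig|]]].
(* On [0, T] the clamped copies agree with the given solutions, so the two integrals coincide. *)
rewrite (_ : (fun n => _) = fun n => (\int[(@lebesgue_measure R \x @lebesgue_measure R)%E]_(z in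
  (`[0%R, T] `*` `[(- (L / 2))%R, (L / 2)%R[))
  `|step_dens L (massL rho0 L) (sub n) (yD (sub n)).1 z - g z|%:E)%E)//.
apply/funext => n; apply: eq_integral => z; rewrite inE => -[/= zT _].
have tT : 0 <= z.1 <= T by move: zT; rewrite in_itv.
have [_ yx] := hyD _ (sub0 n).
have xy j : (j < sub n)%N -> xs (sub n) j z.1 = (yD (sub n)).1 j z.1 by move=> jn; rewrite yx.
congr (`|_ - _|%:E); rewrite /rhoN /step_dens; apply: eq_bigr => k _.
by rewrite (eq_dens _ _ (sub0 n) xy)// (eq_x_next _ (sub0 n) xy)// xy.
Qed.
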